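(* For every $\mu>0$ there exist positive numbers $\lambda_D$, $\lambda_N$, $\lambda_{\tilde N}$ and $\lambda_{R}$ which are eigenvalues of the Dirichlet, Neumann, regional Neumann and Robin problems (see context), respectively, with non-negative eigenfunctions $u_D\in W^{s,G}_0(\Omega)$, $u_{N}\in W^{s,G}_*(\Omega)$, $u_{\tilde N}\in W^{s,G}_{reg}(\Omega)$ and $u_R\in \mathcal{X}$, respectively, normalized such that $$\Phi_{G,\Omega}(u_D)=\Phi_{G,\Omega}(u_N)=\Phi_{G,\Omega}(u_{\tilde N})=\Phi_{G,\Omega}(u_R)=\mu .$$
   Context: Let $s\in(0,1)$, let $\Omega\subset\mathbb{R}^n$ be a bounded open set with $C^{0,1}$ boundary, $\Omega^c=\mathbb{R}^n\setminus\Omega$, and let $\beta\in L^\infty(\mathbb{R}^n\setminus\Omega)$ be strictly positive. $G\colon[0,\infty)\to[0,\infty)$ is a Young function: $G(t)=\int_0^t g(\tau)\,d\tau$, with $g$ right continuous and nondecreasing, $g(0)=0$, $g(t)>0$ for $t>0$, $\lim_{t\to\infty}g(t)=\infty$, and $g=G'$. It satisfies: $1<p^-\leq \frac{tg(t)}{G(t)}\leq p^+<\infty$ for all $t>0$, for fixed constants $p^\pm$; $t\mapsto G(\sqrt t)$ is convex on $[0,\infty)$; $\int_0^1 \frac{G^{-1}(\tau)}{\tau^{(n+s)/n}}d\tau<\infty$ and $\int_1^\infty \frac{G^{-1}(\tau)}{\tau^{(n+s)/n}}d\tau=\infty$. Notation: $D_su(x,y)=\frac{u(x)-u(y)}{|x-y|^s}$,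 $d\mu=\frac{dx\,dy}{|x-y|^n}$ (unrelated to the number $\mu$); $g(|r|)\frac{r}{|r|}$ is read as $0$ when $r=0$. Modulars: $\Phi_{G,\Omega}(u)=\int_\Omega G(|u|)\,dx$, $\Phi_{s,G,\mathbb{R}^n}(u)=\iint_{\mathbb{R}^n\times\mathbb{R}^n}G(|D_su|)\,d\mu$, $\Phi_{s,G,\Omega}(u)=\iint_{\Omega\times\Omega}G(|D_su|)\,d\mu$, $\Phi_{s,G,*}(u)=\iint_{\mathbb{R}^{2n}\setminus(\Omega^c)^2}G(|D_su|)\,d\mu$, $\Phi_{G,\beta,\Omega^c}(u)=\int_{\mathbb{R}^n\setminus\Omega}\beta\,G(|u|)\,dx$. Spaces (of measurable functions): $W^{s,G}_0(\Omega)=\{u\colon\mathbb{R}^n\to\mathbb{R}: \int_{\mathbb{R}^n}G(|u|)\,dx<\infty,\ \Phi_{s,G,\mathbb{R}^n}(u)<\infty,\ u=0 \text{ a.e. in }\mathbb{R}^n\setminus\Omega\}$; $W^{s,G}_*(\Omega)=\{u\colon\mathbb{R}^n\to\mathbb{R}: \Phi_{G,\Omega}(u)<\infty,\ \Phi_{s,G,*}(u)<\infty\}$; $W^{s,G}_{reg}(\Omega)=\{u\colon\Omega\to\mathbb{R}: \Phi_{G,\Omega}(u)<\infty,\ \Phi_{s,G,\Omega}(u)<\infty\}$; $\mathcal{X}=\{u\in W^{s,G}_*(\Omega): \Phi_{G,\beta,\Omega^c}(u)<\infty\}$. Forms: $\langle(-\Delta_g)^su,v\rangle=\iint_{\mathbb{R}^n\times\mathbb{R}^n}g(|D_su|)\frac{D_su}{|D_su|}D_sv\,d\mu$;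 $\langle(-\Delta_g)_\Omega^su,v\rangle=\iint_{\Omega\times\Omega}g(|D_su|)\frac{D_su}{|D_su|}D_sv\,d\mu$; $\langle(-\Delta_g)^su,v\rangle_*=\frac12\iint_{\mathbb{R}^{2n}\setminus(\Omega^c)^2}g(|D_su|)\frac{D_su}{|D_su|}D_sv\,d\mu$. Eigenvalues: $\lambda$ is an eigenvalue with eigenfunction $u$ of - the Dirichlet problem if $u\in W^{s,G}_0(\Omega)$ and $\langle(-\Delta_g)^su,v\rangle=(\lambda-1)\int_\Omega g(|u|)\frac{u}{|u|}v\,dx$ for all $v\in W^{s,G}_0(\Omega)$; - the Neumann problem if $u\in W^{s,G}_*(\Omega)$ and $\langle(-\Delta_g)^su,v\rangle_*=(\lambda-1)\int_\Omega g(|u|)\frac{u}{|u|}v\,dx$ for all $v\in W^{s,G}_*(\Omega)$; - the regional Neumann problem if $u\in W^{s,G}_{reg}(\Omega)$ and $\langle(-\Delta_g)_\Omega^su,v\rangle=(\lambda-1)\int_\Omega g(|u|)\frac{u}{|u|}v\,dx$ for all $v\in W^{s,G}_{reg}(\Omega)$; - the Robin problem if $u\in\mathcal{X}$ and $\langle(-\Delta_g)^su,v\rangle_*=(\lambda-1)\int_\Omega g(|u|)\frac{u}{|u|}v\,dx-\int_{\mathbb{R}^n\setminus\Omega}\beta\,g(|u|)\frac{u}{|u|}v\,dx$ for all $v\in\mathcal{X}$. *)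

(* Defs.v *)
From HB Require Import structures.
From mathcomp Require Import all_boot all_order all_algebra.
From mathcomp Require Import all_classical all_reals all_analysis.

Set Implicit Arguments.
Unset Strict Implicit.
Unset Printing Implicit Defensive.

Import Order.TTheory GRing.Theory Num.Theory.
Import numFieldNormedType.Exports.

Local Open Scope classical_set_scope.
Local Open Scope ring_scope.

(* ['rV[R]_n] carries the sigma-algebra generated by the coordinates, which is
   the Borel sigma-algebra of [R^n]. *)
Definition rV_display : measure_display. Proof. exact: default_measure_display. Qed.

Section rV_measurable.
Variables (R : realType) (n : nat).

Let coord (i : 'I_n) (x : 'rV[R]_n) : measurableTypeR R := x ord0 i.

Let rV_set0 : g_sigma_preimage coord set0.
Proof. exact: sigma_algebra0. Qed.

Let rV_setC A : g_sigma_preimage coord A -> g_sigma_preimage coord (~` A).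
Proof. exact: sigma_algebraC. Qed.

Let rV_bigcup (F : (set 'rV[R]_n)^nat) :
  (forall i, g_sigma_preimage coord (F i)) ->
  g_sigma_preimage coord (\bigcup_i (F i)).
Proof. exact: sigma_algebra_bigcup. Qed.

HB.instance Definition _ := @isMeasurable.Build rV_display 'rV[R]_n
  (g_sigma_preimage coord) rV_set0 rV_setC rV_bigcup.

Lemma measurable_coord (i : 'I_n) :
  measurable_fun [set: 'rV[R]_n] (fun x => x ord0 i : measurableTypeR R).
Proof.
move=> _ Y mY; rewrite setTI; apply: sub_sigma_algebra => /=.
rewrite -bigcup_seq/=; exists i => /=; first by rewrite mem_index_enum.
by exists Y => //; rewrite setTI.
Qed.

Lemma measurable_fun_rV d (T : measurableType d) (f : T -> 'rV[R]_n) :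
  (forall i, measurable_fun [set: T] (fun x => f x ord0 i : measurableTypeR R)) ->
  measurable_fun [set: T] f.
Proof.
move=> mf _ Y; rewrite setTI; move: Y.
suff : g_sigma_preimage coord `<=` [set A | measurable (f @^-1` A)] by exact.
apply: smallest_sub.
- split => /=.
  + by rewrite preimage_set0.
  + by move=> A mA; rewrite setTD preimage_setC; exact: measurableC.
  + by move=> F mF; rewrite preimage_bigcup; exact: bigcup_measurable.
- rewrite -bigcup_seq => A [i _ [B mB <-]] /=.
  by rewrite setTI -[X in measurable X]setTI; exact: (mf i).
Qed.

End rV_measurable.

Section lebesgue_rV.
Variable R : realType.

Definition rV_cons n (p : R * 'rV[R]_n) : 'rV[R]_n.+1 :=
  \row_j oapp (fun k => p.2 ord0 k) p.1 (unlift ord0 j).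

Definition rV_uncons n (x : 'rV[R]_n.+1) : R * 'rV[R]_n :=
  (x ord0 ord0, \row_k x ord0 (lift ord0 k)).

Lemma rV_consK n : cancel (@rV_cons n) (@rV_uncons n).
Proof.
case=> a x; rewrite /rV_uncons mxE unlift_none/=; congr pair.
by apply/rowP => k; rewrite !mxE liftK.
Qed.

Lemma measurable_rV_cons n :
  measurable_fun [set: measurableTypeR R * 'rV[R]_n] (@rV_cons n).
Proof.
apply: measurable_fun_rV => i.
case: (unliftP ord0 i) => [k ->|->].
- rewrite (_ : (fun _ => _) =
    (fun x : 'rV[R]_n => x ord0 k : measurableTypeR R) \o snd); last first.
    by apply/funext => p; rewrite mxE liftK.
  by apply: measurableT_comp => //; exact: measurable_coord.
- rewrite (_ : (fun _ => _) = (fst : measurableTypeR R * 'rV[R]_n -> _)) //.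
  by apply/funext => p; rewrite mxE unlift_none.
Qed.

Lemma measurable_rV_uncons n :
  measurable_fun [set: 'rV[R]_n.+1]
    (@rV_uncons n : _ -> measurableTypeR R * 'rV[R]_n).
Proof.
apply: measurable_fun_pair; first exact: measurable_coord.
apply: measurable_fun_rV => i.
rewrite (_ : (fun _ => _) =
  (fun x : 'rV[R]_n.+1 => x ord0 (lift ord0 i) : measurableTypeR R)).
  exact: measurable_coord.
by apply/funext => x; rewrite mxE.
Qed.

Section step.
Variables (n : nat) (m : {sigma_finite_measure set 'rV[R]_n -> \bar R}).

Definition lebesgue_rVS : set 'rV[R]_n.+1 -> \bar R :=
  pushforward (@lebesgue_measure R \x m)%E (@rV_cons n).


Let lebesgue_rVS0 : lebesgue_rVS set0 = 0%E.
Proof. by rewrite /lebesgue_rVS /pushforward preimage_set0 measure0. Qed.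

Let lebesgue_rVS_ge0 A : (0 <= lebesgue_rVS A)%E.
Proof. by rewrite /lebesgue_rVS /pushforward; exact: measure_ge0. Qed.

Let preim_rV_cons A : measurable A ->
  measurable (@rV_cons n @^-1` A : set (measurableTypeR R * 'rV[R]_n)).
Proof.
by move=> mA; rewrite -[X in measurable X]setTI; exact: measurable_rV_cons.
Qed.

Let lebesgue_rVS_sigma_additive : semi_sigma_additive lebesgue_rVS.
Proof.
move=> F mF tF mUF; rewrite /lebesgue_rVS /pushforward preimage_bigcup.
apply: measure_semi_sigma_additive.
- by move=> k; exact: preim_rV_cons.
- apply/trivIsetP => /= i j _ _ ij; rewrite -preimage_setI.
  by move/trivIsetP : tF => /(_ _ _ _ _ ij) ->//; rewrite preimage_set0.
- by rewrite -preimage_bigcup; exact: preim_rV_cons.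
Qed.

HB.instance Definition _ := isMeasure.Build _ _ _ lebesgue_rVS
  lebesgue_rVS0 lebesgue_rVS_ge0 lebesgue_rVS_sigma_additive.

Let lebesgue_rVS_sigma_finite : sigma_finite setT lebesgue_rVS.
Proof.
have /sigma_finiteP[F [TF ndF Foo]] := sigma_finiteT (@lebesgue_measure R).
have /sigma_finiteP[H [TH ndH Hoo]] := sigma_finiteT m.
exists (fun k => @rV_uncons n @^-1` (F k `*` H k)).
  rewrite -preimage_bigcup; apply/esym/seteqP; split => // x _ /=.
  have [k _ Fk] : (\bigcup_k F k) (rV_uncons x).1 by rewrite -TF.
  have [l _ Hl] : (\bigcup_k H k) (rV_uncons x).2 by rewrite -TH.
  exists (maxn k l) => //; split.
    by move: Fk; exact/subsetPset/ndF/leq_maxl.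
  by move: Hl; exact/subsetPset/ndH/leq_maxr.
move=> k; have [mF Fk] := Foo k; have [mH Hk] := Hoo k.
split.
  rewrite -[X in measurable X]setTI; apply: measurable_rV_uncons => //.
  exact: measurableX.
rewrite /lebesgue_rVS /pushforward -comp_preimage.
rewrite (_ : _ \o _ = id); last by apply/funext => p /=; rewrite rV_consK.
rewrite preimage_id product_measure1E//.
by rewrite lte_mul_pinfty// ge0_fin_numE.
Qed.

HB.instance Definition _ :=
  Measure_isSigmaFinite.Build _ _ _ lebesgue_rVS lebesgue_rVS_sigma_finite.

End step.

Fixpoint lebesgue_rV n : {sigma_finite_measure set 'rV[R]_n -> \bar R} :=
  match n with
  | 0 => \d_(0 : 'rV[R]_0)
  | n'.+1 => lebesgue_rVS (lebesgue_rV n')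
  end.

Lemma lebesgue_rV_box n (A : 'I_n -> set (measurableTypeR R)) :
  (forall i, measurable (A i)) ->
  lebesgue_rV n [set x | forall i, A i (x ord0 i)] =
  (\prod_(i < n) @lebesgue_measure R (A i))%E.
Proof.
elim: n A => [|n IH] A mA.
  rewrite big_ord0 /= diracE mem_set//= => -[].
  by [].
rewrite big_ord_recl -IH; last by move=> i; exact: mA.
have mB : measurable [set x : 'rV[R]_n | forall i, A (lift ord0 i) (x ord0 i)].
  rewrite (_ : mkset _ = \bigcap_(i in [set: 'I_n])
      ((fun x : 'rV[R]_n => x ord0 i : measurableTypeR R) @^-1` A (lift ord0 i))).
    apply: fin_bigcap_measurable => [|i _]; first exact: finite_finset.
    by rewrite -[X in measurable X]setTI; exact: measurable_coord.
  by apply/seteqP; split => x /= Ax i; [move=> _|]; exact: Ax.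
rewrite /= /lebesgue_rVS /pushforward -product_measure1E//.
congr (_ _); apply/seteqP; split => -[a x] /=.
  move=> Aax; split; first by have := Aax ord0; rewrite mxE unlift_none.
  by move=> i; have := Aax (lift ord0 i); rewrite mxE liftK.
move=> [Aa Ax] i; rewrite mxE.
by case: (unliftP ord0 i) => [j ->|->] //=; exact: Ax.
Qed.

End lebesgue_rV.
Arguments lebesgue_rV {R} n.

Section euclidean.
Variables (R : realType) (n : nat).
Implicit Types (x y : 'rV[R]_n) (Omega : set 'rV[R]_n).

Definition dot x y : R := \sum_(i < n) x ord0 i * y ord0 i.

(* The library norm of ['rV[R]_n] is the sup norm; it induces the same topology,
   the same bounded sets and the same Lipschitz functions as this one. *)
Definition enorm x : R := Num.sqrt (dot x x).

(* Near each boundary point, [Omega] lies strictly above the graph of a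
   Lipschitz function in the direction of some unit vector [e]: [dot x e] is the
   height of [x] and [x - dot x e *: e] its projection on the hyperplane
   orthogonal to [e], which plays the role of [R^(n-1)]. The values of [phi]
   off this hyperplane are irrelevant. *)
Definition lipschitz_boundary Omega : Prop :=
  forall x0, (closure Omega `\` Omega°) x0 ->
  exists (e : 'rV[R]_n) (phi : 'rV[R]_n -> R),
    [/\ enorm e = 1,
        [lipschitz phi y | y in [set y | dot y e = 0]] &
        \forall x \near x0, Omega x <-> phi (x - dot x e *: e) < dot x e].

End euclidean.

Section young.
Variables (R : realType) (g G : R -> R).

(* Only the values of [g] and [G] on [[0, +oo[] matter. *)
Definition young_function : Prop :=
  [/\ [/\ {in `[0, +oo[ &, {homo g : t u / t <= u}},
          forall t, 0 <= t -> g x @[x --> t^'+] --> g t,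
          g 0 = 0,
          forall t, 0 < t -> 0 < g t &
          g x @[x --> +oo] --> +oo],
      forall t, 0 <= t -> G t = \int[lebesgue_measure]_(x in `[0, t]) g x &
      forall t : R, 0 < t -> is_derive t 1 G (g t)].

Definition young_inv : R -> R := 'pinv_(fun=> 0) `[0, +oo[%classic G.

(* [g(|r|) r/|r|]; this is 0 at [r = 0] because [0^-1 = 0]. *)
Definition g_signed (r : R) : R := g `|r| * (r / `|r|).

End young.

Section spaces.
Variables (R : realType) (n : nat) (s : R) (Omega : set 'rV[R]_n).
Variables (beta : 'rV[R]_n -> R) (g G : R -> R).
Implicit Types (u v : 'rV[R]_n -> R) (F : 'rV[R]_n -> 'rV[R]_n -> R).
Implicit Types (A : set 'rV[R]_n) (Q : set ('rV[R]_n * 'rV[R]_n)).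
Local Open Scope ereal_scope.

Definition D_s u (x y : 'rV[R]_n) : R :=
  ((u x - u y) / enorm (x - y) `^ s)%R.

(* Integral of [F] over [Q] against [dx dy / |x - y|^n]. The density is 0
   instead of infinite on the diagonal, which is negligible when [0 < n]. *)
Definition int_dmu Q F : \bar R :=
  \int[lebesgue_rV n \x lebesgue_rV n]_(z in Q)
    (F z.1 z.2 / enorm (z.1 - z.2) ^+ n)%:E.

Definition off_exterior : set ('rV[R]_n * 'rV[R]_n) :=
  ~` ((~` Omega) `*` (~` Omega)).

Definition modular A u : \bar R := \int[lebesgue_rV n]_(x in A) (G `|u x|)%:E.

Definition modular_s Q u : \bar R := int_dmu Q (fun x y => G `|D_s u x y|).

Definition modular_beta u : \bar R :=
  \int[lebesgue_rV n]_(x in ~` Omega) (beta x * G `|u x|)%:E.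

Definition W0 : set ('rV[R]_n -> R) :=
  [set u | [/\ measurable_fun setT u,
               modular setT u < +oo,
               modular_s setT u < +oo &
               {ae lebesgue_rV n, forall x, ~ Omega x -> u x = 0%R}]].

Definition Wstar : set ('rV[R]_n -> R) :=
  [set u | [/\ measurable_fun setT u,
               modular Omega u < +oo &
               modular_s off_exterior u < +oo]].

(* A function on [Omega] is represented by a function on [R^n] whose values
   outside [Omega] are irrelevant. *)
Definition Wreg : set ('rV[R]_n -> R) :=
  [set u | [/\ measurable_fun Omega u,
               modular Omega u < +oo &
               modular_s (Omega `*` Omega) u < +oo]].

Definition Xspace : set ('rV[R]_n -> R) :=
  [set u | Wstar u /\ modular_beta u < +oo].

Definition form_s Q u v : \bar R :=
  int_dmu Q (fun x y => (g_signed g (D_s u x y) * D_s v x y)%R).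

Definition form_star u v : \bar R := (2^-1)%:E * form_s off_exterior u v.

Definition form_mass u v : \bar R :=
  \int[lebesgue_rV n]_(x in Omega) (g_signed g (u x) * v x)%:E.

Definition form_beta u v : \bar R :=
  \int[lebesgue_rV n]_(x in ~` Omega) (beta x * g_signed g (u x) * v x)%:E.

Definition dirichlet_eigen (lambda : R) u : Prop :=
  W0 u /\ forall v, W0 v ->
    form_s setT u v = (lambda - 1)%:E * form_mass u v.

Definition neumann_eigen (lambda : R) u : Prop :=
  Wstar u /\ forall v, Wstar v ->
    form_star u v = (lambda - 1)%:E * form_mass u v.

Definition regional_neumann_eigen (lambda : R) u : Prop :=
  Wreg u /\ forall v, Wreg v ->
    form_s (Omega `*` Omega) u v = (lambda - 1)%:E * form_mass u v.

Definition robin_eigen (lambda : R) u : Prop :=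
  Xspace u /\ forall v, Xspace v ->
    form_star u v = (lambda - 1)%:E * form_mass u v - form_beta u v.

End spaces.

(* Main.v *)
Require Import Defs.
From mathcomp Require Import all_boot all_order all_algebra.
From mathcomp Require Import all_classical all_reals all_analysis.
From mathcomp Require Import measurable_realfun.
From mathcomp Require Import ring lra.

Set Implicit Arguments.
Unset Strict Implicit.
Unset Printing Implicit Defensive.

Import Order.TTheory GRing.Theory Num.Theory.
Import numFieldNormedType.Exports.

Local Open Scope classical_set_scope.
Local Open Scope ring_scope.

(** The Neumann problems need no variational argument: a constant function has a
    vanishing difference quotient, so every constant is an eigenfunction for
    [lambda = 1], and [G] takes all nonnegative values, which allows any prescribed
    modular on the bounded set [Omega].

    The Dirichlet and the Robin problem are the Euler-Lagrange equations for the
    minimisation of an energy [E] (the Gagliardo modular, plus twice the boundary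
    modular in the Robin case) under the constraint [M u >= mu], where [M] is the
    modular on [Omega]; the eigenvalue is one plus the Lagrange multiplier, up to a
    factor one half in the Robin case.  As an inequality, the constraint leaves
    room for one-sided variations, and a minimiser can be contracted to [M u = mu]
    and replaced by its absolute value without raising the energy
    ([energy_euler_lagrange], [exists_eigenfunction]).

    Two facts give the minimiser.  First, sublevel sets of the energy are
    precompact for [M] ([mass_compactness]): on a cell [Q] of a fine grid, Jensen's
    inequality and the Gagliardo density bound the distance of [u] to its mean over
    [Q] by a positive power of the side of [Q] ([cell_oscillation]), so that
    finitely many means control everything.  The energy contains the interaction of
    [Omega] with its whole complement, hence the mean may be taken over all of [Q]
    even if [Q] crosses the boundary.  Secondly, the convexity of
    [t |-> G (Num.sqrt t)] yields Clarkson's inequality ([young_clarkson],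
    [wmod_clarkson]), the modular analogue of the parallelogram law.  It makes
    suitable near-minimisers over the tails of a minimising sequence Cauchy in
    energy ([energy_tail_minimizers]), hence almost everywhere convergent after
    speeding up, also outside [Omega], where nothing is compact.  Fatou's lemma then
    shows that the limit is a minimiser ([energy_minimizer]).  The doubling property
    ([young_doubling]), a consequence of the upper growth exponent, keeps all
    modulars finite on linear combinations.

    The competitor needed to start is a Lipschitz bump inside [Omega], of finite
    energy because [0 < s < 1] ([bump_energy]). *)

(** * Young functions *)

(** The hypotheses on the Young function in the form used below; [G t <= t * g t]
    is the lower growth condition weakened to the exponent one. *)
Definition admissible (R : realType) (g G : R -> R) (pplus : R) : Prop :=
  [/\ young_function g G,
      forall t, 0 < t -> G t <= t * g t <= pplus * G t,
      forall t, 0 < t -> 0 < G t &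
      @convex_function R R^o `[0, +oo[%classic (fun t => G (Num.sqrt t))].

Section young_facts.
Variables (R : realType) (g G : R -> R) (pp : R).
Hypothesis HG : admissible g G pp.
Implicit Types (a b t l : R).

Local Notation gs := (g_signed g).

Lemma young0 : G 0 = 0.
Proof.
case: HG => -[_ GE _] _ _ _; rewrite GE//.
by rewrite set_itv1 Rintegral_set1.
Qed.

Lemma young_ge0 t : 0 <= t -> 0 <= G t.
Proof.
case: HG => _ _ Gp _; rewrite le_eqVlt => /predU1P[<-|/Gp/ltW//].
by rewrite young0.
Qed.

Lemma youngN_ge0 a : 0 <= G `|a|.
Proof. exact: young_ge0. Qed.

Lemma young_deriv_gt0 t : 0 < t -> 0 < g t.
Proof. by case: HG => -[[_ _ _ gp _] _ _] _ _ _; exact: gp. Qed.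

Lemma young_deriv_homo a b : 0 <= a -> a <= b -> g a <= g b.
Proof.
case: HG => -[[gm _ _ _ _] _ _] _ _ _ a0 ab; apply: gm => //;
  by rewrite in_itv/= andbT// (le_trans a0).
Qed.

Lemma young_sqrt_convex l (x y : R) : 0 <= l <= 1 -> 0 <= x -> 0 <= y ->
  G (Num.sqrt (l * x + (1 - l) * y)) <=
    l * G (Num.sqrt x) + (1 - l) * G (Num.sqrt y).
Proof.
case: HG => _ _ _ Hc /andP[l0 l1] x0 y0.
have := Hc (Itv01 l0 l1) x y.
by rewrite !inE/= !in_itv/= !andbT; apply.
Qed.

(** Convexity between [0] and [t ^+ 2]: the modular decays quadratically at the
    origin, so that [G `|_|] is differentiable there with derivative zero. *)
Lemma young_sq_scale l t : 0 <= l <= 1 -> 0 <= t -> G (l * t) <= l ^+ 2 * G t.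
Proof.
move=> /andP[l0 l1] t0.
have l2 : 0 <= l ^+ 2 <= 1 by rewrite exprn_ge0//= exprn_ile1.
have := young_sqrt_convex l2 (sqr_ge0 t) (lexx 0).
rewrite mulr0 addr0 sqrtr0 young0 mulr0 addr0 -exprMn !sqrtr_sqr.
by rewrite !ger0_norm// mulr_ge0.
Qed.

Lemma young_mvt a b : 0 < a -> a < b ->
  exists2 c, a < c < b & G b - G a = g c * (b - a).
Proof.
case: HG => -[_ _ dG] _ _ _ a0 ab.
have [|/=|c] := @MVT R G g a b ab.
- by move=> x; rewrite in_itv/= => /andP[ax _]; apply: dG; exact: lt_trans ax.
- apply: derivable_within_continuous => x; rewrite in_itv/= => /andP[ax _].
  by have [] := dG x (lt_le_trans a0 ax).
by rewrite in_itv/= => cab; exists c.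
Qed.

(** The graph of the convex function [G `|_|] lies above its tangents; every
    convexity property used below is read off from this inequality. *)
Lemma young_tangent a b : G `|a| + gs a * (b - a) <= G `|b|.
Proof.
have posc x y : 0 <= x -> 0 <= y -> G x + g x * (y - x) <= G y \/ x = 0.
  rewrite le_eqVlt => /predU1P[<-|x0]; first by right.
  rewrite le_eqVlt => /predU1P[<-|y0]; left.
    case: HG => _ /(_ x x0) /andP[+ _] _ _; rewrite young0; lra.
  have [xy|yx|->] := ltgtP x y; last by rewrite subrr mulr0 addr0.
    have [c /andP[xc cy] E] := young_mvt x0 xy.
    have := young_deriv_homo (ltW x0) (ltW xc).
    have : 0 < y - x by rewrite subr_gt0.
    move: E; move: (g c) (g x) (y - x) => A B D; nra.
  have [c /andP[yc cx] E] := young_mvt y0 yx.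
  have gcx : g c <= g x by apply: young_deriv_homo; [lra|lra].
  have : 0 < x - y by rewrite subr_gt0.
  have -> : y - x = - (x - y) by lra.
  move: E gcx; move: (g c) (g x) (x - y) => A B D; nra.
have [->|a0] := eqVneq a 0.
  by rewrite /g_signed normr0 mul0r mulr0 mul0r addr0 young0 young_ge0.
have [sa|] := posc `|a| `|b| (normr_ge0 _) (normr_ge0 _); last first.
  by move/eqP; rewrite normr_eq0 (negbTE a0).
apply: le_trans sa; rewrite lerD2l /g_signed -mulrA ler_pM2l; last first.
  by apply: young_deriv_gt0; rewrite normr_gt0.
rewrite mulrBr lerB//.
  apply: le_trans (ler_norm _) _.
  by rewrite !normrM normfV normr_id divff ?mul1r// normr_eq0.
rewrite -mulrA mulrC -mulrA -expr2 -(real_normK (num_real a)).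
by rewrite expr2 mulKf// normr_eq0.
Qed.

Lemma young_homo a b : `|a| <= `|b| -> G `|a| <= G `|b|.
Proof.
move=> ab; have [a0|a0] := eqVneq a 0.
  by rewrite a0 normr0 young0 young_ge0.
have := young_tangent `|a| `|b|; rewrite /g_signed !normr_id.
rewrite divff ?normr_eq0// mulr1.
have : 0 < g `|a| by apply: young_deriv_gt0; rewrite normr_gt0.
move: ab; rewrite -subr_ge0; move: (`|b| - _) => D; nra.
Qed.

Lemma young_convex l a b : 0 <= l <= 1 ->
  G `|l * a + (1 - l) * b| <= l * G `|a| + (1 - l) * G `|b|.
Proof.
move=> /andP[l0 l1]; set c := l * a + _.
have := young_tangent c a; have := young_tangent c b.
have E : l * (gs c * (a - c)) + (1 - l) * (gs c * (b - c)) = 0.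
  by rewrite /c; ring.
have l1' : 0 <= 1 - l by rewrite subr_ge0.
move=> /(ler_wpM2l l1') h2 /(ler_wpM2l l0) h1.
have := lerD h1 h2; rewrite !mulrDr; lra.
Qed.

Lemma young_scale l a : 0 <= l <= 1 -> G `|l * a| <= l * G `|a|.
Proof.
move=> l01; have := young_convex a 0 l01.
by rewrite mulr0 addr0 normr0 young0 mulr0 addr0.
Qed.

(** The tangent at [a] drops by [g `|a| * l * `|a| <= pp * l * G `|a|] between [a]
    and [(1 - l) * a].  Read backwards this gives the doubling property, and for
    small [l] it is the continuity of modulars under dilations. *)
Lemma young_shrink l a : 0 <= l <= 1 ->
  (1 - pp * l) * G `|a| <= G `|(1 - l) * a|.
Proof.
move=> /andP[l0 l1]; have [->|a0] := eqVneq a 0.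
  by rewrite mulr0 normr0 young0 mulr0.
have na0 : 0 < `|a| by rewrite normr_gt0.
have := young_tangent a ((1 - l) * a).
have -> : gs a * ((1 - l) * a - a) = - l * (`|a| * g `|a|).
  have -> : `|a| * g `|a| = gs a * a.
    rewrite /g_signed mulrC -mulrA; congr (_ * _).
    by rewrite mulrAC -expr2 -(real_normK (num_real a)) expr2 mulfK// gt_eqF.
  ring.
case: HG => _ /(_ _ na0)/andP[_ +] _ _.
move: (`|a| * _) (G `|a|) (G _) => A B C; nra.
Qed.

(** Iterate a contraction that at most halves the value until its ratio is at
    most one half. *)
Lemma young_doubling : exists2 D : R, 1 <= D & forall a, G `|2 * a| <= D * G `|a|.
Proof.
set q := `|pp| + 1.
have q0 : 0 < q by rewrite /q ltr_wpDl.
pose l := 1 / (2 * q).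
have l01 : 0 <= l <= 1.
  have ? : 1 <= q by rewrite /q lerDr.
  by rewrite /l divr_ge0 ?ler_pdivrMr ?mulr_gt0//=; lra.
have lq : pp * l <= 2^-1.
  have : pp <= q by rewrite /q (le_trans (ler_norm _))// lerDl.
  rewrite /l mulrA mulr1 ler_pdivrMr ?mulr_gt0//; lra.
have step a : G `|a| <= 2 * G `|(1 - l) * a|.
  have := young_shrink a l01; have := youngN_ge0 a.
  move: (pp * l) lq (G `|a|) (G _) => A ? B C; nra.
have stepn k a : G `|a| <= 2 ^+ k * G `|(1 - l) ^+ k * a|.
  elim: k a => [|k IH] a; first by rewrite !expr0 !mul1r.
  apply: le_trans (step a) _; rewrite [2 ^+ _]exprS -mulrA ler_pM2l//.
  by apply: le_trans (IH _) _; rewrite mulrA -exprSr.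
have [k kl] : exists k, (1 - l) ^+ k <= 2^-1.
  have l1 : `|1 - l| < 1.
    rewrite ger0_norm; last by lra.
    by rewrite ltrBlDr ltrDl /l divr_gt0// mulr_gt0.
  have /cvgrPdist_le/(_ 2^-1) := cvg_expr l1.
  rewrite invr_gt0 ltr0n => /(_ isT)[k _ /(_ k)] /= /(_ (leqnn _)).
  rewrite sub0r normrN => h; exists k; exact: le_trans (ler_norm _) h.
exists (2 ^+ k); first by rewrite exprn_ege1// ler1n.
move=> a; apply: le_trans (stepn k _) _.
rewrite ler_pM2l ?exprn_gt0//; apply: young_homo.
have lk0 : 0 <= (1 - l) ^+ k by rewrite exprn_ge0//; lra.
rewrite !normrM (ger0_norm lk0) ger0_norm//.
have := normr_ge0 a; move: kl; move: (_ ^+ k) `|a| => A B; nra.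
Qed.

(** [t |-> G (Num.sqrt t)] is superadditive and midpoint convex; apply both to the
    two sides of the parallelogram identity for [a] and [b]. *)
Lemma young_clarkson a b :
  G `|(a + b) / 2| + G `|(a - b) / 2| <= (G `|a| + G `|b|) / 2.
Proof.
have superadd x y : G `|x| + G `|y| <= G (Num.sqrt (x ^+ 2 + y ^+ 2)).
  set c := Num.sqrt _.
  have c0 : 0 <= c by exact: sqrtr_ge0.
  have cE : c ^+ 2 = x ^+ 2 + y ^+ 2 by rewrite sqr_sqrtr// addr_ge0// sqr_ge0.
  have [c00|cn0] := eqVneq c 0.
    have : x ^+ 2 + y ^+ 2 = 0 by rewrite -cE c00 expr0n.
    move/eqP; rewrite paddr_eq0 ?sqr_ge0// !sqrf_eq0 => /andP[/eqP-> /eqP->].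
    by rewrite normr0 c00 young0 addr0.
  have cp : 0 < c by rewrite lt_def cn0.
  have S z : z ^+ 2 <= c ^+ 2 -> G `|z| <= (`|z| / c) ^+ 2 * G c.
    move=> zc; rewrite -{1}(divfK cn0 `|z|); apply: young_sq_scale => //.
    rewrite divr_ge0//= ler_pdivrMr// mul1r.
    by rewrite -ler_sqr ?nnegrE// real_normK ?num_real.
  have xc : x ^+ 2 <= c ^+ 2 by rewrite cE lerDl sqr_ge0.
  have yc : y ^+ 2 <= c ^+ 2 by rewrite cE lerDr sqr_ge0.
  apply: le_trans (lerD (S _ xc) (S _ yc)) _.
  rewrite -mulrDl !expr_div_n !real_normK ?num_real// -mulrDl -cE.
  by rewrite divff ?mul1r// sqrf_eq0.
apply: le_trans (superadd _ _) _.
have h : 0 <= (2^-1 : R) <= 1 by rewrite invr_ge0 invf_le1// ler1n ler0n.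
have := young_sqrt_convex h (sqr_ge0 a) (sqr_ge0 b).
have -> : (1 - 2^-1 : R) = 2^-1 by lra.
rewrite -!mulrDr !sqrtr_sqr [leRHS]mulrC.
by have -> : 2^-1 * (a ^+ 2 + b ^+ 2) = ((a + b) / 2) ^+ 2 + ((a - b) / 2) ^+ 2 by field.
Qed.

Lemma young_sum_doubling (D : R) : (forall a, G `|2 * a| <= D * G `|a|) ->
  forall a b, G `|a + b| <= D * (G `|a| + G `|b|).
Proof.
move=> HD a b; have h : 0 <= (2^-1 : R) <= 1.
  by rewrite invr_ge0 invf_le1// ler1n ler0n.
have := young_convex (2 * a) (2 * b) h.
have -> : 2^-1 * (2 * a) + (1 - 2^-1) * (2 * b) = a + b by field.
move/le_trans; apply; have := HD a; have := HD b.
have := youngN_ge0 (2 * a); have := youngN_ge0 (2 * b); lra.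
Qed.

(** Functions of finite modular are thus integrable on sets of finite measure. *)
Lemma young_linear_growth a : `|a| <= 1 + (G 1)^-1 * G `|a|.
Proof.
have G1 : 0 < G 1 by case: HG => _ _ + _; apply.
have [a1|a1] := leP `|a| 1.
  rewrite (le_trans a1)// lerDl mulr_ge0 ?invr_ge0 ?(ltW G1)//.
  exact: youngN_ge0.
have a0 : 0 < `|a| by apply: lt_trans a1.
have l01 : 0 <= `|a|^-1 <= 1 by rewrite invr_ge0 normr_ge0 invf_le1// ltW.
have := young_scale `|a| l01.
rewrite mulVf ?gt_eqF// normr1 normr_id mulrC ler_pdivlMr//.
by rewrite -ler_pdivlMl// => h; rewrite (le_trans h)// lerDr.
Qed.

(** The chord slopes [k (G `|a + b / k| - G `|a|)], [k >= 1], decrease to the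
    tangent slope, so they are squeezed between integrable bounds. *)
Lemma young_slope_bounds a b k : 1 <= k ->
  gs a * b <= k * (G `|a + k^-1 * b| - G `|a|) <= G `|a + b| - G `|a|.
Proof.
move=> k1; have k0 : 0 < k by apply: lt_le_trans k1.
apply/andP; split.
  have := young_tangent a (a + k^-1 * b); rewrite addrAC subrr add0r.
  rewrite -ler_pdivrMl// mulrCA; lra.
have l01 : 0 <= k^-1 <= 1 by rewrite invr_ge0 ltW// invf_le1.
have := young_convex (a + b) a l01.
rewrite (_ : k^-1 * (a + b) + _ = a + k^-1 * b); last by ring.
move=> h; rewrite -ler_pdivlMl//; lra.
Qed.

Lemma young_signed_bound a b :
  `|gs a * b| <= G `|a + b| + G `|a - b|.
Proof.
have := young_tangent a (a + b); have := young_tangent a (a - b).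
have := youngN_ge0 a; have := youngN_ge0 (a + b); have := youngN_ge0 (a - b).
rewrite (_ : a - b - a = - b) ?mulrN; last by ring.
rewrite (_ : a + b - a = b); last by ring.
move=> *; rewrite ler_norml; apply/andP; split; lra.
Qed.

Lemma young_signed_self a : G `|a| <= gs a * a.
Proof.
have := young_tangent a 0; rewrite normr0 young0 sub0r mulrN; lra.
Qed.

Lemma young_slope_cvg a b :
  (k.+1%:R * (G `|a + k.+1%:R^-1 * b| - G `|a|)) @[k --> \oo] --> gs a * b.
Proof.
have cV : (k.+1%:R^-1 : R) @[k --> \oo] --> (0 : R) by exact: cvg_harmonic.
have [->|a0] := eqVneq a 0.
  rewrite /g_signed normr0 young0 mul0r mulr0 mul0r.
  apply: (@squeeze_cvgr _ _ _ _ (fun=> 0) (fun k => G `|b| * k.+1%:R^-1)).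
  - near=> k; rewrite add0r subr0 mulr_ge0// ?youngN_ge0//=.
    have l01 : 0 <= (k.+1%:R^-1 : R) <= 1.
      by rewrite invr_ge0 ler0n invf_le1// ler1n.
    have := young_sq_scale l01 (normr_ge0 b).
    rewrite normrM [`|_^-1|]ger0_norm ?invr_ge0// => h.
    rewrite -ler_pdivlMl// (le_trans h)//.
    by rewrite expr2 -mulrA (mulrC _ (G _)).
  - exact: cvg_cst.
  - by rewrite -[X in _ --> X](mulr0 (G `|b|)); apply: cvgM => //; exact: cvg_cst.
have [->|b0] := eqVneq b 0.
  rewrite mulr0; under eq_fun do rewrite mulr0 addr0 subrr mulr0.
  exact: cvg_cst.
(* near a nonzero point the norm is linear: reduce to the derivative at [`|a|] *)
have na0 : 0 < `|a| by rewrite normr_gt0.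
pose c := a / `|a| * b.
have cn0 : c != 0 by rewrite /c !mulf_neq0// invr_neq0// normr_eq0.
have -> : gs a * b = c * g `|a| by rewrite /g_signed /c; ring.
have dG : is_derive `|a| 1 G (g `|a|) by case: HG => -[_ _ dG] _ _ _; exact: dG.
have [dv /= Ev] := dG.
have /cvg_ex[/= l hl] := dv.
have lE : l = g `|a| by rewrite -Ev /derive; apply/esym/cvg_lim.
rewrite lE in hl.
have cc : (k.+1%:R^-1 * c : R) @[k --> \oo] --> (0 : R)^'.
  move=> A /= [e e0 hA]; move: cV => /cvgrPdist_lt/(_ (e / `|c|)); rewrite divr_gt0// ?normr_gt0// => /(_ isT).
  apply: filterS => k /=; rewrite sub0r normrN => kc; apply: hA.
    by rewrite /ball_ /= sub0r normrN normrM -ltr_pdivlMr// normr_gt0.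
  by rewrite mulf_neq0// invr_neq0// pnatr_eq0.
have := cvg_comp _ _ cc hl => /=.
move/(cvgM (cvg_cst c)); apply: cvg_trans; apply: near_eq_cvg.
have : \forall k \near \oo, `|k.+1%:R^-1 * c| < `|a|.
  have /cvgrPdist_lt/(_ _ na0) : (k.+1%:R^-1 * c : R) @[k --> \oo] --> (0 : R).
    by rewrite -[X in _ --> X](mul0r c); apply: cvgM => //; exact: cvg_cst.
  by apply: filterS => k /=; rewrite sub0r normrN.
apply: filterS => k kc.
rewrite /= /GRing.scale/= mulr1 invfM invrK.
have -> : c * (k.+1%:R * c^-1 * (G (k.+1%:R^-1 * c + `|a|) - G `|a|)) =
  k.+1%:R * (G (k.+1%:R^-1 * c + `|a|) - G `|a|).
  by field; rewrite cn0.
congr (_ * (G _ - _)).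
have -> : a + k.+1%:R^-1 * b = (a / `|a|) * (k.+1%:R^-1 * c + `|a|).
  have : (a / `|a|) ^+ 2 = 1.
    by rewrite expr_div_n real_normK ?num_real// divff// sqrf_eq0.
  rewrite /c mulrDr divfK ?gt_eqF//; move: (a / `|a|) => x x2.
  have -> : x * (k.+1%:R^-1 * (x * b)) = x ^+ 2 * (k.+1%:R^-1 * b) by ring.
  by rewrite x2 mul1r addrC.
rewrite normrM normrM normfV normr_id divff ?gt_eqF// mul1r ger0_norm//.
by move: kc; rewrite ltr_norml => /andP[? _]; rewrite -lerBlDr sub0r ltW.
Unshelve. all: by end_near. Qed.

Lemma young_continuous : continuous (fun a => G `|a|).
Proof.
have gs_bd a b : `|a| <= b -> `|gs a| <= g b.
  have [->|a0] := eqVneq a 0.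
    rewrite /g_signed normr0 mul0r mulr0 normr0 => b0.
    have := young_deriv_homo (lexx 0) b0.
    by case: HG => -[[_ _ -> _ _] _ _].
  move=> ab; have na : `|a| != 0 by rewrite normr_eq0.
  rewrite /g_signed !normrM normfV normr_id divff// mulr1 ger0_norm.
    exact: young_deriv_homo.
  by rewrite ltW// young_deriv_gt0// normr_gt0.
move=> a; apply/cvgrPdist_le => e e0.
pose M := g (`|a| + 1).
have M0 : 0 < M by apply: young_deriv_gt0; rewrite ltr_wpDl.
near=> b.
have ab : `|b - a| <= 1 by rewrite distrC; near: b; apply: cvgr_dist_le.
have abe : `|b - a| <= e / M.
  by rewrite distrC; near: b; apply: cvgr_dist_le => //; rewrite divr_gt0.
have ga : `|gs a| <= M by apply: gs_bd; rewrite lerDl.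
have gb : `|gs b| <= M.
  apply: gs_bd; rewrite -(subrK a b) addrC (le_trans (ler_normD _ _))//.
  by rewrite lerD2l.
have H (x : R) : `|x| <= M -> `|x * (b - a)| <= e.
  move=> xM; rewrite normrM (le_trans (ler_pM _ _ xM abe))//.
  by rewrite mulrC divfK// gt_eqF.
have := young_tangent a b; have := young_tangent b a.
move: (H _ ga) (H _ gb); rewrite !ler_norml => /andP[? ?] /andP[? ?].
rewrite -(opprB b a) mulrN => ? ?.
apply/andP; split; lra.
Unshelve. all: by end_near. Qed.

Lemma young_cvg (u : nat -> R) a : u k @[k --> \oo] --> a ->
  G `|u k| @[k --> \oo] --> G `|a|.
Proof.
by move=> ua; have h := @young_continuous a; exact: cvg_comp _ _ ua h.
Qed.

Lemma measurable_young : measurable_fun [set: R] (fun a => G `|a|).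
Proof. exact: continuous_measurable_fun young_continuous. Qed.

Lemma measurable_g_signed : measurable_fun [set: R] gs.
Proof.
apply: (@measurable_fun_cvg _ _ _ setT
  (fun k a => k.+1%:R * (G `|a + k.+1%:R^-1 * 1| - G `|a|))).
  move=> k; apply: measurable_funM => //; apply: measurable_funB.
    apply: (measurableT_comp measurable_young).
    exact: measurable_funD.
  exact: measurable_young.
move=> a _; have := @young_slope_cvg a 1; by rewrite mulr1.
Qed.

Lemma young_surjective y : 0 < y -> exists2 c, 0 <= c & G c = y.
Proof.
move=> y0; have G1 : 0 < G 1 by case: HG => _ _ + _; apply.
pose b := 1 + y / G 1.
have b0 : 0 <= b by rewrite addr_ge0// divr_ge0// ltW.
have Gb : y <= G b.
  have := young_linear_growth b; rewrite (ger0_norm b0) /b lerD2l mulrC.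
  by rewrite ler_pM2l// invr_gt0.
have [||c cb Gc] := @IVT R (fun a => G `|a|) 0 b y b0.
- by apply: continuous_subspaceT; exact: young_continuous.
- by rewrite normr0 young0 (ger0_norm b0) ge_min le_max (ltW y0) Gb orbT.
- move: cb; rewrite in_itv/= => /andP[c0 _]; exists c => //.
  by rewrite -Gc ger0_norm.
Qed.

End young_facts.

(** * Weighted modulars on a measure space *)

Lemma geometric_nneseries_lty (R : realType) (a q : R) : 0 <= a -> 0 <= q < 1 ->
  (\sum_(k <oo) (a * q ^+ k)%:E < +oo)%E.
Proof.
move=> a0 /andP[q0 q1].
apply: (@le_lt_trans _ _ (a / (1 - q))%:E); last exact: ltry.
have t0 k : (0 <= (a * q ^+ k)%:E)%E by rewrite lee_fin mulr_ge0// exprn_ge0.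
apply: lime_le; first by apply: is_cvg_nneseries => k _ _.
apply: nearW => k; rewrite sumEFin lee_fin big_mkord -mulr_sumr ler_wpM2l//.
have q1' : 0 < 1 - q by rewrite subr_gt0.
rewrite -[leRHS]div1r ler_pdivlMr//.
have -> : (\sum_(i < k) q ^+ i) * (1 - q) = 1 - q ^+ k.
  by rewrite -[RHS]opprB subrX1 mulrC -mulNr opprB.
by rewrite lerBlDr lerDl exprn_ge0.
Qed.

Section weighted_modular.
Context d (T : measurableType d) (R : realType) (nu : {measure set T -> \bar R}).
Variables (g G : R -> R) (pp : R) (w : T -> R).
Hypothesis HG : admissible g G pp.
Hypothesis mw : measurable_fun [set: T] w.
Hypothesis w_ge0 : forall x, 0 <= w x.
Implicit Types (f h : T -> R).

Local Notation gs := (g_signed g).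

Definition wdens f x : R := w x * G `|f x|.

Definition finite_wmod f : Prop :=
  measurable_fun [set: T] f /\ nu.-integrable [set: T] (EFin \o wdens f).

Definition wmod f : R := \int[nu]_x wdens f x.

Definition wform f h : R := \int[nu]_x (w x * (gs (f x) * h x)).

Lemma wdens_ge0 f x : 0 <= wdens f x.
Proof. by rewrite mulr_ge0// (youngN_ge0 HG). Qed.

Lemma measurable_wdens f :
  measurable_fun [set: T] f -> measurable_fun [set: T] (wdens f).
Proof.
by move=> mf; apply: measurable_funM => //;
  exact: (measurableT_comp (measurable_young HG)).
Qed.

Lemma measurable_wform_dens f h :
  measurable_fun [set: T] f -> measurable_fun [set: T] h ->
  measurable_fun [set: T] (fun x => w x * (gs (f x) * h x)).
Proof.
move=> mf mh; apply: measurable_funM => //; apply: measurable_funM => //.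
exact: (measurableT_comp (measurable_g_signed HG)).
Qed.

Lemma finite_wmodP f : measurable_fun [set: T] f ->
  finite_wmod f <-> (\int[nu]_x (wdens f x)%:E < +oo)%E.
Proof.
move=> mf; split=> [[_ /integrableP[_]]|fy].
  by under eq_integral => x _ do rewrite /= ger0_norm ?wdens_ge0//.
split => //; apply/integrableP; split.
  by apply/measurable_EFinP; exact: measurable_wdens.
by under eq_integral => x _ do rewrite /= ger0_norm ?wdens_ge0//.
Qed.

Lemma wmodE f : finite_wmod f -> (\int[nu]_x (wdens f x)%:E = (wmod f)%:E)%E.
Proof.
by move=> [_ fi]; rewrite /wmod /Rintegral fineK//; exact: integrable_fin_num.
Qed.

Lemma wmod_ge0 f : 0 <= wmod f.
Proof. by apply: Rintegral_ge0 => x _; exact: wdens_ge0. Qed.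

(** Pointwise inequalities between densities integrate. *)
Lemma wmod_dominated (a b : R) f h1 h2 : measurable_fun [set: T] f ->
  finite_wmod h1 -> finite_wmod h2 ->
  (forall x, G `|f x| <= a * G `|h1 x| + b * G `|h2 x|) ->
  finite_wmod f /\ wmod f <= a * wmod h1 + b * wmod h2.
Proof.
move=> mf [mh1 ih1] [mh2 ih2] H.
have ia : nu.-integrable setT (EFin \o (fun x => a * wdens h1 x)).
  by have := integrableZl measurableT a ih1; exact.
have ib : nu.-integrable setT (EFin \o (fun x => b * wdens h2 x)).
  by have := integrableZl measurableT b ih2; exact.
have iab : nu.-integrable setT (EFin \o (fun x => a * wdens h1 x + b * wdens h2 x)).
  by have := integrableD measurableT ia ib; exact.
have le x : wdens f x <= a * wdens h1 x + b * wdens h2 x.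
  rewrite /wdens !(mulrCA _ (w x)) -mulrDr; exact: ler_wpM2l.
have fi : nu.-integrable setT (EFin \o wdens f).
  apply: le_integrable iab => //.
    by apply/measurable_EFinP; exact: measurable_wdens.
  move=> x _ /=; rewrite lee_fin ger0_norm ?wdens_ge0// ger0_norm ?le//.
  by rewrite (le_trans (wdens_ge0 f x)).
split; first by split.
rewrite /wmod -!RintegralZl// -RintegralD//.
by apply: le_Rintegral => // x _.
Qed.

Lemma wmod_homo f h : measurable_fun [set: T] f -> finite_wmod h ->
  (forall x, `|f x| <= `|h x|) -> finite_wmod f /\ wmod f <= wmod h.
Proof.
move=> mf fh fleh; have [|||ff le] := @wmod_dominated 1 0 f h h mf => //.
  by move=> x; rewrite mul1r mul0r addr0; exact: (young_homo HG).
by split => //; rewrite (le_trans le)// mul1r mul0r addr0.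
Qed.

Lemma finite_wmod_norm f : finite_wmod f -> finite_wmod (fun x => `|f x|).
Proof.
move=> ff; have [||//] := @wmod_homo (fun x => `|f x|) f _ ff.
  by apply: measurableT_comp => //; case: ff.
by move=> x; rewrite normr_id.
Qed.

Lemma measurable_affine (a b : R) f h : measurable_fun [set: T] f ->
  measurable_fun [set: T] h -> measurable_fun [set: T] (fun x => a * f x + b * h x).
Proof.
by move=> mf mh; apply: measurable_funD; apply: measurable_funM.
Qed.

Lemma wmod_convex (l : R) f h : 0 <= l <= 1 -> finite_wmod f -> finite_wmod h ->
  finite_wmod (fun x => l * f x + (1 - l) * h x) /\
  wmod (fun x => l * f x + (1 - l) * h x) <= l * wmod f + (1 - l) * wmod h.
Proof.
move=> l01 ff fh; apply: wmod_dominated => //.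
  by apply: measurable_affine; [case: ff|case: fh].
by move=> x; exact: (young_convex HG).
Qed.

Lemma finite_wmodD f h : finite_wmod f -> finite_wmod h ->
  finite_wmod (fun x => f x + h x).
Proof.
move=> ff fh; have [D D1 HD] := young_doubling HG.
have [||//] := @wmod_dominated D D (fun x => f x + h x) f h _ ff fh.
  by apply: measurable_funD; [case: ff|case: fh].
by move=> x; rewrite -mulrDr; exact: (young_sum_doubling HG).
Qed.

Lemma finite_wmodZ (c : R) f : finite_wmod f -> finite_wmod (fun x => c * f x).
Proof.
move=> ff; have [D D1 HD] := young_doubling HG.
have mf : measurable_fun [set: T] f by case: ff.
have H k : finite_wmod (fun x => 2 ^+ k * f x).
  elim: k => [|k IH].
    by move: ff; congr finite_wmod; apply/funext => x; rewrite expr0 mul1r.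
  have [||//] := @wmod_dominated D 0 (fun x => 2 ^+ k.+1 * f x) _ _ _ IH IH.
    exact: measurable_funM.
  by move=> x; rewrite mul0r addr0 exprS -mulrA.
have [k ck] : exists k, `|c| <= 2 ^+ k.
  exists (Num.bound `|c|); apply/ltW.
  apply: lt_le_trans (archi_boundP (normr_ge0 c)) _.
  by rewrite -natrX ler_nat ltnW// ltn_expl.
have [||//] := @wmod_homo (fun x => c * f x) _ _ (H k); first exact: measurable_funM.
by move=> x; rewrite !normrM ler_wpM2r// (le_trans ck)// ler_norm.
Qed.

Lemma finite_wmodB f h : finite_wmod f -> finite_wmod h ->
  finite_wmod (fun x => f x - h x).
Proof.
move=> ff fh; have := finite_wmodD ff (finite_wmodZ (-1) fh).
by congr finite_wmod; apply/funext => x; rewrite mulN1r.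
Qed.

Lemma wmod_doubling (D : R) : (forall a, G `|2 * a| <= D * G `|a|) ->
  forall f h, finite_wmod f -> finite_wmod h ->
  wmod (fun x => f x + h x) <= D * (wmod f + wmod h).
Proof.
move=> HD f h ff fh.
have [||_] := @wmod_dominated D D (fun x => f x + h x) f h _ ff fh.
- by apply: measurable_funD; [case: ff|case: fh].
- by move=> x; rewrite -mulrDr; exact: (young_sum_doubling HG).
- by rewrite mulrDr.
Qed.

Lemma wmod_expn_doubling (D : R) : (forall a, G `|2 * a| <= D * G `|a|) ->
  0 <= D -> forall k f, finite_wmod f -> wmod (fun x => 2 ^+ k * f x) <= D ^+ k * wmod f.
Proof.
move=> HD D0 k f ff; have mf : measurable_fun [set: T] f by case: ff.
have [||_] := @wmod_dominated (D ^+ k) 0 (fun x => 2 ^+ k * f x) f f _ ff ff.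
- exact: measurable_funM.
- move=> x; rewrite mul0r addr0; elim: k => [|k IH].
    by rewrite !expr0 !mul1r.
  by rewrite !exprS -!mulrA (le_trans (HD _))// ler_wpM2l.
- by rewrite mul0r addr0.
Qed.

Lemma wmod_shrink (l : R) f : 0 <= l <= 1 -> finite_wmod f ->
  (1 - pp * l) * wmod f <= wmod (fun x => (1 - l) * f x).
Proof.
move=> l01 ff; have [_ il] := finite_wmodZ (1 - l) ff; have [_ fi] := ff.
rewrite /wmod -RintegralZl//; apply: le_Rintegral => //.
  by have := integrableZl measurableT (1 - pp * l) fi; exact.
by move=> x _; rewrite /wdens mulrCA ler_wpM2l// (young_shrink HG).
Qed.

(** This inequality replaces weak compactness: it turns almost minimising
    sequences on convex sets into sequences that are Cauchy in modular. *)
Lemma wmod_clarkson f h : finite_wmod f -> finite_wmod h ->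
  wmod (fun x => (f x + h x) / 2) + wmod (fun x => (f x - h x) / 2) <=
  (wmod f + wmod h) / 2.
Proof.
move=> ff fh.
have [_ isum] := finite_wmodZ 2^-1 (finite_wmodD ff fh).
have [_ idif] := finite_wmodZ 2^-1 (finite_wmodB ff fh).
have [_ i1] := ff; have [_ i2] := fh.
have E (u : T -> R) : (fun x => u x / 2) = (fun x => 2^-1 * u x).
  by apply/funext => x; rewrite mulrC.
rewrite (E (fun x => f x + h x)) (E (fun x => f x - h x)).
have i12 : nu.-integrable setT (EFin \o (fun x => wdens f x + wdens h x)).
  by have := integrableD measurableT i1 i2; exact.
rewrite /wmod -!RintegralD// mulrC -RintegralZl//.
apply: le_Rintegral => //.
- by have := integrableD measurableT isum idif; exact.
- by have := integrableZl measurableT 2^-1 i12; exact.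
- move=> x _; rewrite /wdens -!mulrDr mulrCA ler_wpM2l//.
  by rewrite !(mulrC 2^-1); exact: (young_clarkson HG).
Qed.

Lemma integrable_wform f h : finite_wmod f -> finite_wmod h ->
  nu.-integrable [set: T] (EFin \o (fun x => w x * (gs (f x) * h x))).
Proof.
move=> ff fh; have [_ isum] := finite_wmodD ff fh.
have [_ idif] := finite_wmodB ff fh.
have iB := integrableD measurableT isum idif.
apply: le_integrable iB => //.
  apply/measurable_EFinP; apply: measurable_wform_dens; [by case: ff|by case: fh].
move=> x _ /=; rewrite lee_fin [leRHS]ger0_norm ?addr_ge0 ?wdens_ge0//.
rewrite normrM (ger0_norm (w_ge0 x)) -mulrDr ler_wpM2l//.
exact: (young_signed_bound HG).
Qed.

Lemma wformE f h : finite_wmod f -> finite_wmod h ->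
  (\int[nu]_x (w x * (gs (f x) * h x))%:E = (wform f h)%:E)%E.
Proof.
move=> ff fh; rewrite /wform /Rintegral fineK//.
by apply: integrable_fin_num => //; exact: integrable_wform.
Qed.

Lemma wform_affine (a b : R) f h1 h2 : finite_wmod f -> finite_wmod h1 ->
  finite_wmod h2 ->
  wform f (fun x => a * h1 x + b * h2 x) = a * wform f h1 + b * wform f h2.
Proof.
move=> ff f1 f2; rewrite /wform -!RintegralZl//; try exact: integrable_wform.
rewrite -RintegralD//.
- by apply: eq_Rintegral => x _; ring.
- by have := integrableZl measurableT a (integrable_wform ff f1); exact.
- by have := integrableZl measurableT b (integrable_wform ff f2); exact.
Qed.

Lemma wmod_le_wform_self f : finite_wmod f -> wmod f <= wform f f.
Proof.
move=> ff; apply: le_Rintegral => //; first by case: ff.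
  exact: integrable_wform.
by move=> x _; rewrite ler_wpM2l// (young_signed_self HG).
Qed.

(** The modular is Gateaux differentiable, by dominated convergence of the
    chord slopes. *)
Lemma wmod_slope_cvg f h : finite_wmod f -> finite_wmod h ->
  k.+1%:R * (wmod (fun x => f x + k.+1%:R^-1 * h x) - wmod f) @[k --> \oo]
    --> wform f h.
Proof.
move=> ff fh.
have [mf fi] := ff; have [mh hi] := fh.
have fk (k : nat) : finite_wmod (fun x => f x + k.+1%:R^-1 * h x).
  by apply: finite_wmodD => //; exact: finite_wmodZ.
pose F (k : nat) x := k.+1%:R * (wdens (fun x => f x + k.+1%:R^-1 * h x) x - wdens f x).
have iF k : nu.-integrable setT (EFin \o F k).
  have iB := integrableB measurableT (proj2 (fk k)) fi.
  by have := integrableZl measurableT k.+1%:R iB; exact.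
have EF k : \int[nu]_x F k x =
    k.+1%:R * (wmod (fun x => f x + k.+1%:R^-1 * h x) - wmod f).
  rewrite /F RintegralZl//; last first.
    by have := integrableB measurableT (proj2 (fk k)) fi; exact.
  by rewrite RintegralB//; case: (fk k).
under eq_fun do rewrite -EF.
have [_ isum] := finite_wmodD ff fh.
have [_ idif] := finite_wmodB ff fh.
have ibd : nu.-integrable setT (EFin \o (fun x =>
   (wdens (fun x => f x + h x) x + wdens (fun x => f x - h x) x))).
  by have := integrableD measurableT isum idif; exact.
have [] := @dominated_convergence _ _ _ nu setT measurableT
  (fun k => EFin \o F k) (EFin \o (fun x => w x * (gs (f x) * h x)))
  (EFin \o (fun x => (wdens (fun x => f x + h x) x + wdens (fun x => f x - h x) x))).
- by move=> k; apply: measurable_int (iF k).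
- by apply: measurable_int (integrable_wform ff fh).
- apply: aeW => x _ /=; apply: cvg_EFin; first by apply: nearW.
  rewrite /comp/= /F /wdens.
  under eq_fun do rewrite -mulrBr mulrCA.
  apply: cvgM; first exact: cvg_cst.
  exact: (young_slope_cvg HG).
- exact: ibd.
- apply: aeW => x k _ /=; rewrite lee_fin.
  rewrite /F /wdens -mulrBr mulrCA -mulrDr normrM (ger0_norm (w_ge0 x)).
  rewrite ler_wpM2l//.
  have k1 : 1 <= (k.+1%:R : R) by rewrite ler1n.
  have /andP[lo up] := young_slope_bounds HG (f x) (h x) k1.
  have := young_signed_bound HG (f x) (h x).
  rewrite ler_norml => /andP[sl _].
  have := youngN_ge0 HG (f x); have := youngN_ge0 HG (f x - h x).
  move=> ? ?; rewrite ler_norml; apply/andP; split.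
    by rewrite (le_trans sl).
  by rewrite (le_trans up)//; lra.
- move=> _ _ H.
  apply: fine_cvg; rewrite /= -/(wform f h).
  rewrite -wformE//.
Qed.

Lemma integral_wdens_fatou (fk : nat -> T -> R) f :
  (forall k, finite_wmod (fk k)) -> measurable_fun [set: T] f ->
  {ae nu, forall x, 0 < w x -> fk k x @[k --> \oo] --> f x} ->
  (\int[nu]_x (wdens f x)%:E <= limn_einf (fun k => (wmod (fk k))%:E))%E.
Proof.
move=> ffk mf cvf.
pose F k x := (wdens (fk k) x)%:E.
have mF k : measurable_fun setT (F k).
  by apply/measurable_EFinP/measurable_wdens; case: (ffk k).
have cvF : {ae nu, forall x, F ^~ x @ \oo --> (wdens f x)%:E}.
  apply: filterS cvf => x; have := w_ge0 x; rewrite le_eqVlt => /predU1P[w0 _|wp].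
    rewrite /F /wdens -w0; under eq_fun do rewrite mul0r.
    by rewrite mul0r; exact: cvg_cst.
  move=> /(_ wp) cx; apply: cvg_EFin; first by apply: nearW.
  apply: cvgM; first exact: cvg_cst.

  exact: (young_cvg HG).
have -> : (\int[nu]_x (wdens f x)%:E = \int[nu]_x limn_einf (F ^~ x))%E.
  apply: ae_eq_integral => //.
  - by apply/measurable_EFinP; exact: measurable_wdens.
  - have -> : (fun x => limn_einf (F ^~ x)) = (fun x => - limn_esup (fun k => - F k x))%E.
      by apply/funext => x; rewrite (limn_esupN (F ^~ x)) oppeK.
    apply: measurableT_comp => //; apply: measurable_fun_limn_esup => k.
    exact: measurableT_comp.
  - apply: filterS cvF => x cx _; rewrite is_cvg_limn_einfE; last by apply/cvg_ex; eexists; exact: cx.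
    by apply/esym/cvg_lim.
rewrite (_ : (fun k => (wmod (fk k))%:E) = (fun k => \int[nu]_x F k x)%E); last first.
  by apply/funext => k; rewrite /F wmodE.
by apply: fatou => // k x _; rewrite lee_fin wdens_ge0.
Qed.

Lemma wmod_fatou (fk : nat -> T -> R) f (c : R) :
  (forall k, finite_wmod (fk k)) -> measurable_fun [set: T] f ->
  {ae nu, forall x, 0 < w x -> fk k x @[k --> \oo] --> f x} ->
  (\forall k \near \oo, wmod (fk k) <= c) ->
  finite_wmod f /\ wmod f <= c.
Proof.
move=> ffk mf cvf [K _ HK].
suff le : (\int[nu]_x (wdens f x)%:E <= c%:E)%E.
  have ff : finite_wmod f by apply/finite_wmodP => //; rewrite (le_lt_trans le)// ltry.
  by split => //; rewrite -lee_fin -wmodE.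
apply: le_trans (integral_wdens_fatou ffk mf cvf) _.
rewrite limn_einf_lim; apply: lime_le; first exact: is_cvg_einfs.
apply: nearW => k; apply: (@le_trans _ _ (wmod (fk (k + K)%N))%:E).
  by apply: ereal_inf_lbound; exists (k + K)%N => //=; exact: leq_addr.
by rewrite lee_fin; apply: HK => /=; exact: leq_addl.
Qed.

Lemma wmod_lsc (fk : nat -> T -> R) f (e : R) :
  (forall k, finite_wmod (fk k)) -> finite_wmod f ->
  {ae nu, forall x, 0 < w x -> fk k x @[k --> \oo] --> f x} -> 0 < e ->
  \forall k \near \oo, wmod f <= wmod (fk k) + e.
Proof.
move=> ffk ff cvf e0; have mf : measurable_fun [set: T] f by case: ff.
have := integral_wdens_fatou ffk mf cvf.
rewrite wmodE// limn_einf_lim => le.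
have : ((wmod f - e)%:E < limn (einfs (fun k => (wmod (fk k))%:E)))%E.
  by apply: lt_le_trans le; rewrite lte_fin ltrBlDr ltrDl.
rewrite (cvg_lim _ (@cvg_einfs_sup _ _))// => /ereal_sup_gt[_ [N _ <-] /ltW eN].
exists N => // k /= Nk; rewrite -lerBlDr -lee_fin (le_trans eN)//.
by apply: ereal_inf_lbound; exists k.
Qed.

(** The amplified increments have a summable modular, hence they are bounded at
    almost every point where the weight is positive, and the increments
    themselves are dominated by a geometric series. *)
Lemma wmod_ae_cvg (fk : nat -> T -> R) :
  (forall k, finite_wmod (fk k)) ->
  (forall k, wmod (fun x => 2 ^+ k * (fk k.+1 x - fk k x)) <= 2^-1 ^+ k) ->
  {ae nu, forall x, 0 < w x -> cvgn (fk ^~ x)}.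
Proof.
move=> ff Hs.
pose h k x := 2 ^+ k * (fk k.+1 x - fk k x).
have fh k : finite_wmod (h k) by apply: finite_wmodZ; exact: finite_wmodB.
pose F k x := (wdens (h k) x)%:E.
have mF k : measurable_fun setT (F k).
  by apply/measurable_EFinP/measurable_wdens; case: (fh k).
have F0 k x : (0 <= F k x)%E by rewrite lee_fin wdens_ge0.
have iS : nu.-integrable setT (fun x => \sum_(k <oo) F k x)%E.
  apply/integrableP; split.
    by apply: ge0_emeasurable_sum => // k x _.
  under eq_integral => x _ do rewrite gee0_abs ?nneseries_ge0//.
  rewrite integral_nneseries//.
  apply: (@le_lt_trans _ _ (\sum_(k <oo) (1 * 2^-1 ^+ k)%:E)%E).
    apply: lee_nneseries => k _; first by move=> _; apply: integral_ge0 => x _.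
    by rewrite /F wmodE// lee_fin mul1r; exact: Hs.
  by apply: geometric_nneseries_lty => //; rewrite invr_ge0 ler0n invf_lt1// ltr1n.
have [N [mN N0 sN]] := integrable_ae measurableT iS.
exists N; split => // x /= /not_implyP[wp ncx]; apply: sN => /= /(_ I) Sx.
apply: ncx.
pose S := fine (\sum_(k <oo) F k x)%E.
have FS k : w x * G `|h k x| <= S.
  rewrite -lee_fin /S fineK//.
  apply: (@le_trans _ _ (\sum_(0 <= i < k.+1) F i x)%E).
    by rewrite big_nat_recr//= leeDr// sume_ge0.
  by apply: nneseries_lim_ge.
have G1 : 0 < G 1 by case: HG => _ _ + _; apply.
pose C := 1 + (G 1)^-1 * (S / w x).
have hC k : `|h k x| <= C.
  apply: le_trans (young_linear_growth HG _) _.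
  rewrite lerD2l ler_wpM2l//; first by rewrite invr_ge0 ltW.
  by rewrite ler_pdivlMr// mulrC.
have incr k : `|fk k.+1 x - fk k x| <= C * 2^-1 ^+ k.
  have := hC k; rewrite /h normrM ger0_norm ?exprn_ge0// mulrC.
  by rewrite exprVn -ler_pdivlMr// exprn_gt0.
have cvS : cvgn (series (telescope (fk ^~ x))).
  apply: normed_cvg.
  apply: (@series_le_cvg _ _ (geometric C 2^-1)) => k //=.
  - by rewrite mulr_ge0// ?exprn_ge0 ?invr_ge0// (le_trans _ (hC 0%N)).
  - exact: incr.
  - by apply: is_cvg_geometric_series; rewrite ger0_norm ?invr_ge0// invf_lt1// ltr1n.
rewrite (_ : fk ^~ x = (fun k => fk 0%N x + series (telescope (fk ^~ x)) k)); last first.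
  by apply/funext => k; rewrite {1}(eq_sum_telescope (fk ^~ x) k).
by apply: is_cvgD => //; exact: is_cvg_cst.
Qed.

End weighted_modular.

(** * Constrained minimisation of a modular energy *)

Section variational.
Context d (X : measurableType d) d' (Y : measurableType d') (R : realType).
Variables (nu : {measure set X -> \bar R}) (nu' : {measure set Y -> \bar R}).
Variables (g G : R -> R) (pp : R).
Hypothesis HG : admissible g G pp.
Variables (wm wb : X -> R) (wk : Y -> R) (Z : set X).
Hypothesis mwm : measurable_fun [set: X] wm.
Hypothesis mwb : measurable_fun [set: X] wb.
Hypothesis mwk : measurable_fun [set: Y] wk.
Hypothesis wm_ge0 : forall x, 0 <= wm x.
Hypothesis wb_ge0 : forall x, 0 <= wb x.
Hypothesis wk_ge0 : forall y, 0 <= wk y.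
Hypothesis cover : {ae nu, forall x, [\/ Z x, 0 < wm x | 0 < wb x]}.
Variable D : (X -> R) -> Y -> R.
Hypothesis D_affine : forall a b f h,
  D (fun x => a * f x + b * h x) = (fun y => a * D f y + b * D h y).
Hypothesis D_meas : forall f, measurable_fun [set: X] f -> measurable_fun [set: Y] (D f).
Hypothesis D_norm : forall f y, `|D (fun x => `|f x|) y| <= `|D f y|.
Hypothesis D_cvg : forall (fk : nat -> X -> R) f,
  {ae nu, forall x, fk k x @[k --> \oo] --> f x} ->
  {ae nu', forall y, D (fk k) y @[k --> \oo] --> D f y}.
Implicit Types (u v f h : X -> R).

(** Two modulars act on functions, one of them with the weight [wm] of the
    constraint, and a third one acts on the image under the linear operator [D];
    [Z] is a set on which the functions are required to vanish. *)
Definition energy_space u : Prop :=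
  [/\ finite_wmod nu G wm u, finite_wmod nu G wb u, finite_wmod nu' G wk (D u) &
      {ae nu, forall x, Z x -> u x = 0}].

Definition energy u : R := wmod nu' G wk (D u) + wmod nu G wb u.

Definition energy_form u v : R := wform nu' g wk (D u) (D v) + wform nu g wb u v.

Local Notation K := energy_space.
Local Notation E := energy.
Local Notation M := (wmod nu G wm).

Lemma energy_ge0 u : 0 <= E u.
Proof. by rewrite /energy addr_ge0// (wmod_ge0 _ HG). Qed.

Lemma energy_space_measurable u : K u -> measurable_fun [set: X] u.
Proof. by case=> -[]. Qed.

Lemma energy_space_affine (a b : R) u v : K u -> K v -> K (fun x => a * u x + b * v x).
Proof.
move=> [u1 u2 u3 u4] [v1 v2 v3 v4]; split.
- by apply: (finite_wmodD HG) => //; exact: (finite_wmodZ HG).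
- by apply: (finite_wmodD HG) => //; exact: (finite_wmodZ HG).
- by rewrite D_affine; apply: (finite_wmodD HG) => //; exact: (finite_wmodZ HG).
- by apply: filterS2 u4 v4 => x ux vx Zx; rewrite ux// vx// !mulr0 addr0.
Qed.

Lemma energy_spaceZ (a : R) u : K u -> K (fun x => a * u x).
Proof.
move=> Ku; have := energy_space_affine a 0 Ku Ku; congr K.
by apply/funext => x; rewrite mul0r addr0.
Qed.

Lemma energy_spaceB u v : K u -> K v -> K (fun x => u x - v x).
Proof.
move=> Ku Kv; have := energy_space_affine 1 (-1) Ku Kv; congr K.
by apply/funext => x; rewrite mul1r mulN1r.
Qed.

Lemma D_scale (a : R) u : D (fun x => a * u x) = (fun y => a * D u y).
Proof.
rewrite (_ : (fun x => a * u x) = (fun x => a * u x + 0 * u x)).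
  by rewrite D_affine; apply/funext => y; rewrite mul0r addr0.
by apply/funext => x; rewrite mul0r addr0.
Qed.

Lemma energy_space_norm u : K u -> K (fun x => `|u x|) /\ E (fun x => `|u x|) <= E u.
Proof.
move=> Ku; have mu := energy_space_measurable Ku; have [u1 u2 u3 u4] := Ku.
have mnu : measurable_fun [set: X] (fun x => `|u x|) by exact: measurableT_comp.
have [|f2 le2] := @wmod_homo _ _ _ nu _ _ _ _ HG mwb wb_ge0 _ _ mnu u2.
  by move=> x; rewrite normr_id.
have [|f3 le3] := @wmod_homo _ _ _ nu' _ _ _ _ HG mwk wk_ge0 _ _ (D_meas mnu) u3.
  exact: D_norm.
split; last by rewrite lerD.
split => //; first exact: (finite_wmod_norm HG).
by apply: filterS u4 => x ux Zx; rewrite ux// normr0.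
Qed.

Lemma wmod_normE u : M (fun x => `|u x|) = M u.
Proof. by apply: eq_Rintegral => x _; rewrite /wdens normr_id. Qed.

Lemma energy_contract (l : R) u : 0 <= l <= 1 -> K u -> E (fun x => l * u x) <= E u.
Proof.
move=> /andP[l0 l1] Ku; have mu := energy_space_measurable Ku.
have [_ u2 u3 _] := Ku.
have le (a : R) : `|l * a| <= `|a|.
  by rewrite normrM (ger0_norm l0) ler_piMl.
have [||_ h2] := @wmod_homo _ _ _ nu _ _ _ _ HG mwb wb_ge0 (fun x => l * u x) _ _ u2 => //.
  exact: measurable_funM.
have [||_ h3] := @wmod_homo _ _ _ nu' _ _ _ _ HG mwk wk_ge0 (D (fun x => l * u x)) _ _ u3.
- by apply: D_meas; exact: measurable_funM.
- by move=> y; rewrite D_scale.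
- by rewrite lerD.
Qed.

Lemma wmod_contract (l : R) u : 0 <= l <= 1 -> K u -> M (fun x => l * u x) <= l * M u.
Proof.
move=> l01 [u1 _ _ _].
have z1 : finite_wmod nu G wm (fun x => 0 * u x) by exact: (finite_wmodZ HG).
have [_] := wmod_convex HG mwm wm_ge0 l01 u1 z1.
rewrite (_ : wmod _ _ _ (fun x => 0 * u x) = 0); last first.
  rewrite /wmod /Rintegral (eq_integral (cst 0%E)) ?integral0// => x _.
  by rewrite /wdens mul0r normr0 (young0 HG) mulr0.
rewrite mulr0 addr0; apply: le_trans; rewrite le_eqVlt; apply/orP; left; apply/eqP.
by congr wmod; apply/funext => x; rewrite mul0r mulr0 addr0.
Qed.

Lemma energy_clarkson u v : K u -> K v ->
  E (fun x => 2^-1 * u x + 2^-1 * v x) + E (fun x => 2^-1 * u x + - 2^-1 * v x) <=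
  (E u + E v) / 2.
Proof.
move=> [_ u2 u3 _] [_ v2 v3 _]; rewrite /E !D_affine.
have h2 := wmod_clarkson HG mwb wb_ge0 u2 v2.
have h3 := wmod_clarkson HG mwk wk_ge0 u3 v3.
have S (W : Type) (f h : W -> R) :
    (fun x => 2^-1 * f x + 2^-1 * h x) = (fun x => (f x + h x) / 2).
  by apply/funext => x; rewrite mulrC (mulrC _ (h x)) mulrDl.
have S' (W : Type) (f h : W -> R) :
    (fun x => 2^-1 * f x + - 2^-1 * h x) = (fun x => (f x - h x) / 2).
  by apply/funext => x; rewrite mulrC (mulrC _ (h x)) mulrBl mulrN.
rewrite !S !S' addrACA (le_trans (lerD h3 h2))// -mulrDl.
by rewrite ler_wpM2r ?invr_ge0// addrACA.
Qed.

(** Precompactness in the mass modular, phrased with ultrafilters so that no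
    subsequence has to be extracted. *)
Definition admits_cauchy (u : nat -> X -> R) : Prop :=
  forall F : set_system nat, UltraFilter F -> \oo `<=` F ->
  forall e : R, 0 < e -> exists2 A, F A &
    forall k l, A k -> A l -> M (fun x => u k x - u l x) <= e.

Hypothesis compactness : forall (u : nat -> X -> R) (C : R),
  (forall k, K (u k)) -> (forall k, E (u k) <= C) -> (forall k, M (u k) <= C) ->
  admits_cauchy u.

(** Diagonal extraction, made painless by a free ultrafilter: finitely many of
    its members always have a common point beyond any given rank. *)
Lemma cauchy_extraction (u : nat -> X -> R) (e : nat -> R) :
  admits_cauchy u -> (forall k, 0 < e k) ->
  exists s : nat -> nat, (forall k, (k <= s k)%N) /\
    forall i k, (i <= k)%N -> M (fun x => u (s k) x - u (s i) x) <= e i.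
Proof.
move=> cu e0.
have [F [UF sF]] := ultraFilterLemma (eventually_filter : ProperFilter \oo).
have /choice[A HA] k : exists A, F A /\
    forall i j, A i -> A j -> M (fun x => u i x - u j x) <= e k.
  by have [A FA AA] := cu F UF sF (e k) (e0 k); exists A.
have FI k : F [set n | forall i, (i <= k)%N -> A i n].
  elim: k => [|k IH].
    apply: filterS (proj1 (HA 0%N)) => n An i; by rewrite leqn0 => /eqP ->.
  apply: filterS2 IH (proj1 (HA k.+1)) => n An Akn i.
  by rewrite leq_eqVlt ltnS => /predU1P[->//|/An].
have /choice[s Hs] k : exists n, (k <= n)%N /\ forall i, (i <= k)%N -> A i n.
  have Fk : F [set n | (k <= n)%N] by apply: sF; exists k.
  by have [n [kn An]] := filter_ex (filterI Fk (FI k)); exists n.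
exists s; split=> [k|i k ik]; first by case: (Hs k).
have [_ Ai] := Hs i; have [_ Ak] := Hs k.
by apply: (proj2 (HA i)); [exact: Ak|exact: Ai].
Qed.

(** By the contraction inequality [l |-> M (l u)] is Lipschitz on [[0, 1]], and the
    intermediate value theorem applies. *)
Lemma wmod_normalize (m : R) u : K u -> 0 < m -> m <= M u ->
  exists2 l, 0 <= l <= 1 & M (fun x => l * u x) = m.
Proof.
move=> Ku m0 mM; have [u1 _ _ _] := Ku.
have lip a b : 0 <= a -> a <= b -> b <= 1 ->
    M (fun x => b * u x) - M (fun x => a * u x) <= `|pp| * M u * (b - a).
  move=> a0; rewrite le_eqVlt => /predU1P[->|ab] b1.
    by rewrite !subrr mulr0.
  have b0 : 0 < b by apply: le_lt_trans ab.
  pose l := 1 - a / b.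
  have l01 : 0 <= l <= 1.
    by rewrite /l subr_ge0 ler_pdivrMr// mul1r ltW//= lerBlDr lerDl divr_ge0// ltW.
  have f1 : finite_wmod nu G wm (fun x => b * u x) by exact: (finite_wmodZ HG).
  have := wmod_shrink HG mwm wm_ge0 l01 f1.
  rewrite (_ : (fun x => (1 - l) * _) = (fun x => a * u x)); last first.
    by apply/funext => x; rewrite /l subKr mulrA divfK// gt_eqF.
  have Mb : M (fun x => b * u x) <= b * M u by apply: wmod_contract => //; rewrite (ltW b0).
  have lb : l * b = b - a by rewrite /l mulrBl mul1r divfK// gt_eqF.
  have l0 : 0 <= l by case/andP: l01.
  have Mu0 : 0 <= M u by exact: (wmod_ge0 _ HG).
  have Mb0 : 0 <= M (fun x => b * u x) by exact: (wmod_ge0 _ HG).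
  have : pp * l * M (fun x => b * u x) <= `|pp| * M u * (b - a).
    rewrite -lb; apply: (@le_trans _ _ (`|pp| * l * M (fun x => b * u x))).
      by rewrite -!mulrA ler_wpM2r ?mulr_ge0// ler_norm.
    have -> : `|pp| * M u * (l * b) = `|pp| * l * (b * M u) by ring.
    by rewrite ler_wpM2l// mulr_ge0.
  rewrite mulrBl mul1r; lra.
pose phi (l : R) := M (fun x => l * u x).
have cphi : {within `[0, 1], continuous phi}.
  apply/subspace_continuousP => x /=; rewrite in_itv/= => /andP[x0 x1].
  apply/cvgrPdist_le => e e0.
  pose Lc := `|pp| * M u + 1.
  have Lc0 : 0 < Lc by rewrite /Lc ltr_wpDl// mulr_ge0// (wmod_ge0 _ HG).
  have le_lip a b : 0 <= a -> a <= b -> b <= 1 -> `|phi b - phi a| <= Lc * (b - a).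
    move=> a0 ab b1; rewrite ger0_norm; last first.
      rewrite subr_ge0 /phi; have [|||_ //] := @wmod_homo _ _ _ nu _ _ _ _ HG mwm wm_ge0
        (fun x => a * u x) (fun x => b * u x).
      - by apply: measurable_funM => //; exact: energy_space_measurable Ku.
      - exact: (finite_wmodZ HG).
      by move=> y; rewrite !normrM ler_wpM2r// !ger0_norm// (le_trans a0).
    by rewrite (le_trans (lip a b a0 ab b1))// ler_wpM2r ?subr_ge0// lerDl.
  near=> y.
  have : `|x - y| <= e / Lc.
    near: y; apply: cvg_within; have eL : 0 < e / Lc by rewrite divr_gt0.
    by have /cvgrPdist_le/(_ _ eL) : y @[y --> x] --> x by exact: cvg_id.
  have : y \in `[0, 1]%R by near: y; exact: withinT.
  rewrite in_itv/= => /andP[y0 y1].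
  rewrite ler_pdivlMr// mulrC => xy; apply: le_trans xy.
  have [xy|/ltW yx] := leP x y.
    by rewrite distrC (distrC x) (ger0_norm (_ : 0 <= y - x)) ?subr_ge0//; exact: le_lip.
  by rewrite (ger0_norm (_ : 0 <= x - y)) ?subr_ge0//; exact: le_lip.
have phi0 : phi 0 = 0.
  rewrite /phi /wmod /Rintegral (eq_integral (cst 0%E)) ?integral0// => x _.
  by rewrite /wdens mul0r normr0 (young0 HG) mulr0.
have phi1 : phi 1 = M u by congr wmod; apply/funext => x; rewrite mul1r.
have [|l l01 lm] := @IVT R phi 0 1 m ler01 cphi.
  by rewrite phi0 phi1 ge_min le_max (ltW m0) mM orbT.
by exists l => //; move: l01; rewrite in_itv.
Unshelve. all: by end_near. Qed.

(** The functions that stay within [e i] of [us i] in mass, for all [i <= j], form a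
    convex set [C j] that contains the tail of [us].  The infima of the energy over
    the [C j] increase to a limit below [I0]; near-minimisers [wn k] have midpoints
    in some [C j], so Clarkson's inequality makes their differences small in
    energy.  Convex combinations cost nothing for the mass, which is why the
    nonconvex constraint survives. *)
Lemma energy_tail_minimizers (us : nat -> X -> R) (e : nat -> R) (I0 : R) :
  (forall k, K (us k)) -> (forall k, E (us k) <= I0 + k.+1%:R^-1) ->
  (forall i k, (i <= k)%N -> M (fun x => us k x - us i x) <= e i) ->
  (forall k, 0 < e k) -> (forall i k, (i <= k)%N -> e k <= e i) ->
  exists wn : nat -> X -> R, [/\ forall k, K (wn k),
    forall i k, (i <= k)%N -> M (fun x => wn k x - us i x) <= e i,
    forall k, E (wn k) <= I0 + e k &
    forall i k, (i <= k)%N ->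
      E (fun x => 2^-1 * wn k x + - 2^-1 * wn i x) <= 2 * e i].
Proof.
move=> Kus Eus sM e0 e_mono.
pose C j := [set w | K w /\ forall i, (i <= j)%N -> M (fun x => w x - us i x) <= e i].
have Cus j k : (j <= k)%N -> C j (us k).
  by move=> jk; split => // i ij; apply: sM; exact: leq_trans jk.
have C_convex j v w : C j v -> C j w -> C j (fun x => 2^-1 * v x + 2^-1 * w x).
  move=> [Kv Hv] [Kw Hw]; split; first exact: energy_space_affine.
  move=> i ij.
  have h : 0 <= (2^-1 : R) <= 1 by rewrite invr_ge0 ler0n invf_le1// ler1n.
  have [f1 _ _ _] := energy_spaceB Kv (Kus i).
  have [f2 _ _ _] := energy_spaceB Kw (Kus i).
  have [_] := wmod_convex HG mwm wm_ge0 h f1 f2.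
  have -> : (1 - 2^-1 : R) = 2^-1 by lra.
  rewrite (_ : (fun x => 2^-1 * (v x - us i x) + _) =
    (fun x => 2^-1 * v x + 2^-1 * w x - us i x)); last first.
    by apply/funext => x; field.
  move/le_trans; apply; have := Hv i ij; have := Hw i ij; lra.
pose EC j := [set E w | w in C j].
have hEC j : has_inf (EC j).
  split; first by exists (E (us j)), (us j) => //; exact: Cus.
  by exists 0 => _ [w _ <-]; exact: energy_ge0.
pose dj j := inf (EC j).
have djle j w : C j w -> dj j <= E w.
  by move=> Cw; apply: ge_inf; [case: (hEC j)|exists w].
have C_mono i j w : (i <= j)%N -> C j w -> C i w.
  by move=> ij [Kw Hw]; split => // k ki; apply: Hw; exact: leq_trans ij.
have dj_mono i j : (i <= j)%N -> dj i <= dj j.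
  move=> ij; apply: lb_le_inf; first by case: (hEC j).
  by move=> _ [w Cw <-]; apply: djle; exact: C_mono Cw.
have djI j : dj j <= I0.
  apply/ler_addgt0Pr => t t0.
  have [k kd] : exists k, (k.+1%:R^-1 : R) <= t.
    exists (Num.bound t^-1); rewrite invf_ple ?posrE//; apply/ltW.
    rewrite (lt_trans (archi_boundP _))// ?invr_ge0 ?(ltW t0)//.
    by rewrite ltr_nat.
  apply: le_trans (djle j (us (maxn j k)) _) _; first by apply: Cus; exact: leq_maxl.
  rewrite (le_trans (Eus _))// lerD2l (le_trans _ kd)// lef_pV2 ?posrE//.
  by rewrite ler_nat ltnS leq_maxr.
pose dS := [set dj j | j in [set: nat]].
have hdS : has_sup dS.
  by split; [exists (dj 0%N), 0%N|exists I0 => _ [j _ <-]].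
pose l := sup dS.
have lI : l <= I0 by apply: ge_sup; [case: hdS|move=> _ [j _ <-]].
have djl j : dj j <= l by apply: ub_le_sup; [case: hdS|exists j].
have /choice[wn Hwn] (k : nat) : exists w, exists j, [/\ (k <= j)%N, C j w,
    l - e k <= dj j & E w <= l + e k].
  have [_ [j _ <-] lt] := sup_adherent (e0 k) hdS.
  pose j' := maxn j k.
  have [_ [w Cw <-] ltw] := inf_adherent (e0 k) (hEC j').
  exists w, j'; split => //; first exact: leq_maxr.
    by rewrite (le_trans (ltW lt))// dj_mono// leq_maxl.
  by rewrite (le_trans (ltW ltw))// lerD2r; exact: djl.
have Kwn k : K (wn k) by have [j [_ []]] := Hwn k.
exists wn; split => // [i k ik|k|i k ik].
- by have [j [kj [_ H] _ _]] := Hwn k; apply: H; exact: leq_trans kj.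
- by have [j [_ _ _ Ek]] := Hwn k; rewrite (le_trans Ek)// lerD2r.
have [j [_ Cj dj1 E1]] := Hwn i; have [j2 [_ Cj2 dj2 E2]] := Hwn k.
have low : l - e i <= E (fun x => 2^-1 * wn k x + 2^-1 * wn i x).
  have [jj|/ltnW jj] := leqP j j2.
    rewrite (le_trans dj1)//; apply: djle; apply: C_convex => //.
    exact: C_mono Cj2.
  apply: (@le_trans _ _ (dj j2)).
    by rewrite (le_trans _ dj2)// lerD2l lerN2 e_mono.
  by apply: djle; apply: C_convex => //; exact: C_mono Cj.
have := energy_clarkson (Kwn k) (Kwn i); have := e_mono _ _ ik; lra.
Qed.

(** Almost every point sees one of the two convergent modulars or lies in [Z]. *)
Lemma energy_space_ae_limit (wn : nat -> X -> R) : (forall k, K (wn k)) ->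
  (forall k, M (fun x => 2 ^+ k * (wn k.+1 x - wn k x)) <= 2^-1 ^+ k) ->
  (forall k, wmod nu G wb (fun x => 2 ^+ k * (wn k.+1 x - wn k x)) <= 2^-1 ^+ k) ->
  exists2 w : X -> R, measurable_fun [set: X] w &
    {ae nu, forall x, wn k x @[k --> \oo] --> w x}.
Proof.
move=> Kw Hm Hb.
have cm : {ae nu, forall x, 0 < wm x -> cvgn (wn ^~ x)}.
  by apply: (wmod_ae_cvg HG) => // k; case: (Kw k).
have cb : {ae nu, forall x, 0 < wb x -> cvgn (wn ^~ x)}.
  by apply: (wmod_ae_cvg HG) => // k; case: (Kw k).
have cz : {ae nu, forall x, Z x -> cvgn (wn ^~ x)}.
  have az : {ae nu, forall x, forall k, Z x -> wn k x = 0}.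
    by apply/ae_foralln => k; case: (Kw k).
  apply: filterS az => x zx Zx.
  rewrite (_ : wn ^~ x = cst 0); first exact: is_cvg_cst.
  by apply/funext => k; exact: zx.
pose w x := fine (limn_esup (fun k => (wn k x)%:E)).
exists w.
  apply: measurableT_comp => //; apply: measurable_fun_limn_esup => k.
  by apply/measurable_EFinP; exact: energy_space_measurable (Kw k).
apply: filterS3 cover cm (filterI cb cz) => x cov hm [hb hz].
have cx : cvgn (wn ^~ x) by case: cov => [/hz|/hm|/hb].
have -> : w x = limn (wn ^~ x).
  rewrite /w is_cvg_limn_esupE; last first.
    by apply/cvg_ex; exists (limn (wn ^~ x))%:E; apply: cvg_EFin => //; exact: nearW.
  by rewrite EFin_lim.
exact: cx.
Qed.

(** The direct method.  The energy passes to the limit by Fatou's lemma.  The mass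
    of the limit is compared with the mass [m] of [us i] through the convex
    combination [(1 - l) * us i = (1 - l) * w + l * ((1 - l) / l * (us i - w))]:
    for fixed [l = 2^-k] the last term is small by doubling, and the factor lost
    on the left tends to one with [l]. *)
Lemma energy_minimizer (m : R) u0 : 0 < m -> K u0 -> m <= M u0 ->
  exists2 u, K u & m <= M u /\ forall v, K v -> m <= M v -> E u <= E v.
Proof.
move=> m0 Ku0 mu0.
have [Db Db1 HDb] := young_doubling HG.
pose S := [set r : R | exists u, [/\ K u, M u = m & r = E u]].
have S0 : S !=set0.
  have [l l01 lE] := wmod_normalize Ku0 m0 mu0.
  by exists (E (fun x => l * u0 x)), (fun x => l * u0 x); split => //; exact: energy_spaceZ.
have lS : has_inf S.
  by split => //; exists 0 => _ [u [_ _ ->]]; exact: energy_ge0.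
pose I0 := inf S.
have I0_ge0 : 0 <= I0.
  by apply: lb_le_inf => // _ [u [_ _ ->]]; exact: energy_ge0.
have I0le v : K v -> m <= M v -> I0 <= E v.
  move=> Kv mv; have [l l01 lE] := wmod_normalize Kv m0 mv.
  apply: le_trans (energy_contract l01 Kv).
  apply: ge_inf; first by case: lS.
  by exists (fun x => l * v x); split => //; exact: energy_spaceZ.
have /choice[un Hun] (k : nat) : exists u, [/\ K u, M u = m & E u < I0 + k.+1%:R^-1].
  have k0 : 0 < (k.+1%:R^-1 : R) by rewrite invr_gt0.
  by have [_ [u [Ku Mu ->]] lt] := inf_adherent k0 lS; exists u.
have Db0 : 0 < Db by apply: lt_le_trans Db1.
(* the rates leave room for k doublings *)
pose q : R := (2 * Db)^-1.
have q0 : 0 < q by rewrite invr_gt0 mulr_gt0.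
have q1 : q < 1 by rewrite invf_lt1 ?mulr_gt0//; lra.
pose e k : R := q ^+ k.+1 / Db.
have e0 k : 0 < e k by rewrite divr_gt0// exprn_gt0.
have e_mono i k : (i <= k)%N -> e k <= e i.
  by move=> ik; rewrite ler_wpM2r ?invr_ge0 ?(ltW Db0)// ler_wiXn2l ?ltW.
have room k : Db ^+ k * (Db * (2 * e k)) <= 2^-1 ^+ k.
  have hD : Db ^+ k.+1 * Db^-1 ^+ k.+1 = 1 by rewrite -exprMn divff ?expr1n// gt_eqF.
  have h2 : 2 * 2^-1 ^+ k.+1 = 2^-1 ^+ k :> R by rewrite exprS mulrA divff ?mul1r.
  rewrite /e /q invfM exprMn.
  have -> : Db ^+ k * (Db * (2 * (2^-1 ^+ k.+1 * Db^-1 ^+ k.+1 / Db))) =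
     (2 * 2^-1 ^+ k.+1) * (Db ^+ k.+1 * Db^-1 ^+ k.+1) / Db.
    by rewrite [Db ^+ k.+1]exprSr; ring.
  by rewrite hD h2 mulr1 ler_piMr ?exprn_ge0 ?invr_ge0// invf_le1.
have e_cvg t : 0 < t -> \forall k \near \oo, e k <= t.
  move=> t0; have : `|q| < 1 by rewrite ger0_norm// ltW.
  move/cvg_expr/cvgrPdist_le => /(_ t t0); apply: filterS => k.
  rewrite sub0r normrN ger0_norm ?exprn_ge0 ?(ltW q0)//; apply: le_trans.
  rewrite /e ler_pdivrMr// (@le_trans _ _ (q ^+ k))//.
    by rewrite exprS ler_piMl ?exprn_ge0 ?ltW.
  by rewrite ler_peMr ?exprn_ge0// ltW.
have cu : admits_cauchy un.
  apply: (@compactness un (m + I0 + 1)) => k; have [Kk Mk Ek] := Hun k => //.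
    rewrite (le_trans (ltW Ek))// -addrA ler_wpDl ?(ltW m0)// lerD2l.
    by rewrite invf_le1// ler1n.
  by rewrite Mk -addrA lerDl addr_ge0.
have [s [sk sM]] := cauchy_extraction cu e0.
pose us k := un (s k).
have Kus k : K (us k) by case: (Hun (s k)).
have Mus k : M (us k) = m by case: (Hun (s k)).
have Eus k : E (us k) <= I0 + k.+1%:R^-1.
  have [_ _ /ltW Ek] := Hun (s k); rewrite (le_trans Ek)// lerD2l.
  by rewrite lef_pV2 ?posrE// ler_nat ltnS.
have [wn [Kwn Mwn Ewn Ehalf]] := energy_tail_minimizers Kus Eus sM e0 e_mono.
have [w mw cvw] : exists2 w : X -> R, measurable_fun [set: X] w &
    {ae nu, forall x, wn k x @[k --> \oo] --> w x}.
  apply: energy_space_ae_limit => // k.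
    have [f1 _ _ _] := energy_spaceB (Kwn k.+1) (Kwn k).
    rewrite (le_trans (wmod_expn_doubling HG mwm wm_ge0 HDb (ltW Db0) k f1))//.
    rewrite (le_trans _ (room k))// ler_wpM2l ?exprn_ge0 ?(ltW Db0)//.
    have [f2 _ _ _] := energy_spaceB (Kwn k.+1) (Kus k).
    have [f3 _ _ _] := energy_spaceB (Kus k) (Kwn k).
    have := wmod_doubling HG mwm wm_ge0 HDb f2 f3.
    rewrite (_ : (fun x => _ + _) = (fun x => wn k.+1 x - wn k x)); last first.
      by apply/funext => x; ring.
    move/le_trans; apply; rewrite ler_wpM2l ?(ltW Db0)// mulr_natl mulr2n lerD//.
      exact: Mwn.
    rewrite (_ : wmod _ _ _ _ = M (fun x => wn k x - us k x)) ?Mwn//.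
    by apply: eq_Rintegral => x _; rewrite /wdens distrC.
  have Kh := energy_space_affine 2^-1 (- 2^-1) (Kwn k.+1) (Kwn k).
  have [_ f1 _ _] := Kh.
  have := wmod_expn_doubling HG mwb wb_ge0 HDb (ltW Db0) k.+1 f1.
  rewrite (_ : (fun x => _ * _) = (fun x => 2 ^+ k * (wn k.+1 x - wn k x))); last first.
    by apply/funext => x; rewrite exprS; field.
  move/le_trans; apply; rewrite (le_trans _ (room k))//.
  rewrite exprSr -mulrA ler_wpM2l ?exprn_ge0 ?(ltW Db0)// ler_wpM2l ?(ltW Db0)//.
  rewrite (le_trans _ (Ehalf _ _ (leqnSn k)))// /energy lerDr.
  exact: (wmod_ge0 _ HG).
have cvDw := D_cvg cvw.
have cvZ (wt : X -> R) : {ae nu, forall x, 0 < wt x -> wn k x @[k --> \oo] --> w x}.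
  by apply: filterS cvw => x.
have cvY : {ae nu', forall y, 0 < wk y -> D (wn k) y @[k --> \oo] --> D w y}.
  by apply: filterS cvDw => y.
have Ebd k : E (wn k) <= I0 + e 0%N.
  by rewrite (le_trans (Ewn k))// lerD2l e_mono.
have Kw1 i : finite_wmod nu G wm (fun x => w x - us i x) /\
    M (fun x => w x - us i x) <= e i.
  apply: (wmod_fatou HG mwm wm_ge0 (fk := fun k x => wn k x - us i x)).
  - by move=> k; case: (energy_spaceB (Kwn k) (Kus i)).
  - by apply: measurable_funB => //; exact: energy_space_measurable (Kus i).
  - apply: filterS cvw => x cx _; apply: cvgB => //; exact: cvg_cst.
  - by exists i => // k /= ik; exact: Mwn.
have Kw : K w.
  split.
  - have [f1 _] := Kw1 0%N; have [f2 _ _ _] := Kus 0%N.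
    have := finite_wmodD HG mwm wm_ge0 f1 f2.
    by congr finite_wmod; apply/funext => x; rewrite subrK.
  - have [||||//] := @wmod_fatou _ _ _ nu _ _ _ _ HG mwb wb_ge0 wn w (I0 + e 0%N).
    + by move=> k; case: (Kwn k).
    + exact: mw.
    + exact: cvZ.
    + apply: nearW => k; rewrite (le_trans _ (Ebd k))// /energy lerDr.
      exact: (wmod_ge0 _ HG).
  - have [||||//] := @wmod_fatou _ _ _ nu' _ _ _ _ HG mwk wk_ge0 (fun k => D (wn k)) (D w) (I0 + e 0%N).
    + by move=> k; case: (Kwn k).
    + exact: D_meas.
    + exact: cvY.
    + apply: nearW => k; rewrite (le_trans _ (Ebd k))// /energy lerDl.
      exact: (wmod_ge0 _ HG).
  - have az : {ae nu, forall x, forall k, Z x -> wn k x = 0}.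
      by apply/ae_foralln => k; case: (Kwn k).
    apply: filterS2 az cvw => x zx cx Zx.
    have z0 : wn ^~ x = cst 0 by apply/funext => k; exact: zx.
    rewrite z0 in cx; have := cvg_unique _ cx (cvg_cst _); exact.
have [w1 w2 w3 _] := Kw.
exists w => //; split.
  (* l = 2^-k, so that division by l is k doublings *)
  have shr k : (1 - pp * 2^-1 ^+ k) * m <= M w.
    apply/ler_addgt0Pr => t t0.
    pose l : R := 2^-1 ^+ k.
    have l0 : 0 < l by rewrite exprn_gt0// invr_gt0.
    have l01 : 0 <= l <= 1 by rewrite ltW//= exprn_ile1// ?invr_ge0// invf_le1// ler1n.
    have [i Hi] : exists i, e i <= t / Db ^+ k.
      have := e_cvg (t / Db ^+ k); rewrite divr_gt0 ?exprn_gt0// => /(_ isT)[i _ Hi].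
      by exists i; apply: Hi => /=.
    have [u1 _ _ _] := Kus i.
    have := wmod_shrink HG mwm wm_ge0 l01 u1; rewrite Mus => /le_trans; apply.
    pose f x := 2 ^+ k * (us i x - w x).
    have [fwu leu] := Kw1 i.
    have uE : (fun x => us i x - w x) = (fun x => -1 * (w x - us i x)).
      by apply/funext => x; ring.
    have fuw : finite_wmod nu G wm (fun x => us i x - w x).
      by rewrite uE; exact: (finite_wmodZ HG).
    have ff : finite_wmod nu G wm f by exact: (finite_wmodZ HG).
    have ff1 : finite_wmod nu G wm (fun x => (1 - l) * f x) by exact: (finite_wmodZ HG).
    have [_] := wmod_convex HG mwm wm_ge0 l01 ff1 w1.
    rewrite (_ : (fun x => _ + _) = (fun x => (1 - l) * us i x)); last first.
      apply/funext => x; rewrite /f.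
      have : l * 2 ^+ k = 1 by rewrite -exprMn mulVf ?expr1n.
      move: (2 ^+ k) => c lc.
      have -> : l * ((1 - l) * (c * (us i x - w x))) = (l * c) * ((1 - l) * (us i x - w x)) by ring.
      by rewrite lc; ring.
    move/le_trans; apply.
    have leff : M (fun x => (1 - l) * f x) <= t.
      have [|||_] := @wmod_homo _ _ _ nu _ _ _ _ HG mwm wm_ge0 (fun x => (1 - l) * f x) f => //.
      - by case: ff1.
      - move=> x; rewrite normrM ler_piMl// ger0_norm; case/andP: l01 => *; lra.
      move/le_trans; apply.
      rewrite (le_trans (wmod_expn_doubling HG mwm wm_ge0 HDb (ltW Db0) k fuw))//.
      rewrite -ler_pdivlMl ?exprn_gt0// mulrC (le_trans _ Hi)// (le_trans _ leu)//.
      rewrite le_eqVlt; apply/orP; left; apply/eqP.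
      by apply: eq_Rintegral => x _; rewrite /wdens distrC.
    have Mff0 : 0 <= M (fun x => (1 - l) * f x) by exact: (wmod_ge0 _ HG).
    have Mw0 : 0 <= M w by exact: (wmod_ge0 _ HG).
    case/andP: l01 => _ l1; rewrite addrC lerD//; first by rewrite ler_piMl// lerBlDr lerDl ltW.
    by rewrite (le_trans _ leff)// ler_piMl.
  have cv : (1 - pp * 2^-1 ^+ k) * m @[k --> \oo] --> (1 - pp * 0) * m.
    apply: cvgM; last exact: cvg_cst.
    apply: cvgB; first exact: cvg_cst.
    apply: cvgM; first exact: cvg_cst.
    by apply: cvg_expr; rewrite ger0_norm ?invr_ge0// invf_lt1// ltr1n.
  rewrite mulr0 subr0 mul1r in cv.
  rewrite -(cvg_lim _ cv)//; apply: limr_le; first by apply/cvg_ex; exists m.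
  by apply: nearW.
move=> v Kv mv; apply: le_trans (I0le _ Kv mv).
apply/ler_addgt0Pr => t t0.
have t30 : 0 < t / 3 by rewrite divr_gt0.
have fwn k : finite_wmod nu G wb (wn k) by case: (Kwn k).
have fDwn k : finite_wmod nu' G wk (D (wn k)) by case: (Kwn k).
have n1 := wmod_lsc HG mwb wb_ge0 fwn w2 (cvZ wb) t30.
have n2 := wmod_lsc HG mwk wk_ge0 fDwn w3 cvY t30.
have [k [h1 [h2 h3]]] := filter_ex (filterI n1 (filterI n2 (e_cvg _ t30))).
have := Ewn k; rewrite /energy; lra.
Qed.

(** If [wform u v > 0] then [u + v / k] is admissible for large [k], since the
    constraint is an inequality, so the energy does not decrease along [v].  A
    linear form that is nonnegative wherever another one is positive is a
    nonnegative multiple of it; the latter does not vanish at [u]. *)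
Lemma energy_euler_lagrange (m : R) u : 0 < m -> K u -> m <= M u ->
  (forall v, K v -> m <= M v -> E u <= E v) ->
  exists2 L : R, 0 <= L & forall v, K v ->
    energy_form u v = L * wform nu g wm u v.
Proof.
move=> m0 Ku mu umin; have [u1 u2 u3 _] := Ku.
have ef_affine a b v1 v2 : K v1 -> K v2 ->
    energy_form u (fun x => a * v1 x + b * v2 x) = a * energy_form u v1 + b * energy_form u v2.
  move=> [_ v12 v13 _] [_ v22 v23 _]; rewrite /energy_form D_affine.
  rewrite (wform_affine HG mwk wk_ge0)// (wform_affine HG mwb wb_ge0)//; ring.
have mf_affine a b v1 v2 : K v1 -> K v2 ->
    wform nu g wm u (fun x => a * v1 x + b * v2 x) =
    a * wform nu g wm u v1 + b * wform nu g wm u v2.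
  by move=> [v11 _ _ _] [v21 _ _ _]; rewrite (wform_affine HG mwm wm_ge0).
have pos v : K v -> 0 < wform nu g wm u v -> 0 <= energy_form u v.
  move=> Kv vp; have [v1 v2 v3 _] := Kv.
  have c1 := wmod_slope_cvg HG mwm wm_ge0 u1 v1.
  have c2 := wmod_slope_cvg HG mwb wb_ge0 u2 v2.
  have c3 := wmod_slope_cvg HG mwk wk_ge0 u3 v3.
  have /(_ _) c23 := cvgD c3 c2.
  have nb : \forall k \near \oo, 0 < k.+1%:R * (M (fun x => u x + k.+1%:R^-1 * v x) - M u).
    exact: (cvgr_gt _ c1).
  rewrite /energy_form -(cvg_lim _ c23)//; apply: limr_ge; first by apply/cvg_ex; eexists; exact: c23.
  apply: filterS nb => k; rewrite pmulr_rgt0// subr_gt0 => /ltW Mk.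
  have Kk : K (fun x => u x + k.+1%:R^-1 * v x).
    have := energy_space_affine 1 k.+1%:R^-1 Ku Kv; congr K.
    by apply/funext => x; rewrite mul1r.
  have := umin _ Kk (le_trans mu Mk).
  rewrite /energy (_ : D (fun x => u x + k.+1%:R^-1 * v x) = (fun y => D u y + k.+1%:R^-1 * D v y)).
    by move=> h; rewrite -mulrDr mulr_ge0// addrACA -opprD subr_ge0.
  have := D_affine 1 k.+1%:R^-1 u v.
  rewrite (_ : (fun x => 1 * _ + _) = (fun x => u x + k.+1%:R^-1 * v x)).
    by move=> ->; apply/funext => y; rewrite mul1r.
  by apply/funext => x; rewrite mul1r.
have uu : 0 < wform nu g wm u u.
  apply: lt_le_trans m0 (le_trans mu _).
  exact: (wmod_le_wform_self HG).
have ker v : K v -> wform nu g wm u v = 0 -> 0 <= energy_form u v.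
  move=> Kv v0; apply/ler_addgt0Pr => t t0.
  pose c := t / (`|energy_form u u| + 1).
  have c0 : 0 < c by rewrite divr_gt0// ltr_wpDl.
  have := pos _ (energy_space_affine 1 c Kv Ku).
  rewrite mf_affine// v0 mulr0 add0r mulr_gt0// => /(_ isT).
  rewrite ef_affine// mul1r => /le_trans; apply; rewrite lerD2l.
  rewrite /c mulrAC ler_pdivrMr ?ltr_wpDl// ler_wpM2l ?(ltW t0)//.
  by rewrite (le_trans (ler_norm _))// lerDl.
exists (energy_form u u / wform nu g wm u u).
  by rewrite divr_ge0 ?(ltW uu)//; apply: pos.
move=> v Kv; pose c := wform nu g wm u v / wform nu g wm u u.
have cE : wform nu g wm u v = c * wform nu g wm u u by rewrite divfK// gt_eqF.
have h1 := ker _ (energy_space_affine 1 (- c) Kv Ku).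
have h2 := ker _ (energy_space_affine (-1) c Kv Ku).
rewrite mf_affine// ef_affine// cE in h1; rewrite mf_affine// ef_affine// cE in h2.
rewrite cE mulrCA divfK ?gt_eqF//; apply/eqP; rewrite eq_le; apply/andP; split.
  by have := h2 _; rewrite mulN1r addNr => /(_ erefl); rewrite mulN1r; lra.
by have := h1 _; rewrite mul1r mulNr subrr => /(_ erefl); rewrite mul1r; lra.
Qed.

(** Contraction to the exact mass and passage to the absolute value both decrease
    the energy, hence preserve minimality under the inequality constraint. *)
Lemma exists_eigenfunction (m : R) u0 : 0 < m -> K u0 -> 0 < M u0 ->
  exists u, exists L : R, [/\ K u, forall x, 0 <= u x, M u = m, 0 <= L &
    forall v, K v -> energy_form u v = L * wform nu g wm u v].
Proof.
move=> m0 Ku0 Mu0.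
pose c := 1 + m / M u0.
have c1 : 1 <= c by rewrite /c lerDl divr_ge0 ?ltW.
have c0 : 0 < c by apply: lt_le_trans c1.
have Kc := energy_spaceZ c Ku0.
have mc : m <= M (fun x => c * u0 x).
  have ci : 0 <= c^-1 <= 1 by rewrite invr_ge0 ltW//= invf_le1.
  have := wmod_contract ci Kc.
  rewrite (_ : (fun x => _ * _) = u0); last by apply/funext => x; rewrite mulKf// gt_eqF.
  rewrite ler_pdivlMl// => /(le_trans _); apply.
  by rewrite /c mulrDl mul1r divfK ?gt_eqF// lerDr ltW.
have [w Kw [mw wmin]] := energy_minimizer m0 Kc mc.
have [l l01 lE] := wmod_normalize Kw m0 mw.
have Kl := energy_spaceZ l Kw.
have [Kn En] := energy_space_norm Kl.
pose u x := `|l * w x|.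
have Mu : M u = m by rewrite wmod_normE.
have umin v : K v -> m <= M v -> E u <= E v.
  move=> Kv mv; apply: le_trans (wmin v Kv mv).
  by apply: le_trans En _; exact: energy_contract.
have mu : m <= M u by rewrite Mu.
have [L L0 HL] := energy_euler_lagrange m0 Kn mu umin.
by exists u, L; split => // x; exact: normr_ge0.
Qed.

End variational.

(** * The Gagliardo difference quotient on pairs of points *)

Section difference_quotient.
Variables (R : realType) (n : nat) (s : R).
Local Notation rV := ('rV[R]_n).
Local Notation L := (@lebesgue_rV R n).
Implicit Types (u : rV -> R).

Definition distance (z : rV * rV) : R := enorm (z.1 - z.2).

Definition diff_quot u (z : rV * rV) : R := D_s s u z.1 z.2.

Lemma dot_ge0 (x : rV) : 0 <= dot x x.
Proof. by apply: sumr_ge0 => i _; rewrite -expr2 sqr_ge0. Qed.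

Lemma enorm_ge0 (x : rV) : 0 <= enorm x.
Proof. exact: sqrtr_ge0. Qed.

Lemma distance_ge0 z : 0 <= distance z.
Proof. exact: enorm_ge0. Qed.

Lemma coord_le_enorm (x : rV) i : `|x ord0 i| <= enorm x.
Proof.
rewrite -ler_sqr ?nnegrE ?enorm_ge0// sqr_sqrtr ?dot_ge0//.
rewrite real_normK ?num_real// /dot (bigD1 i)//= -expr2 lerDl.
by apply: sumr_ge0 => j _; rewrite -expr2 sqr_ge0.
Qed.

Lemma enorm_le_coord (x : rV) (h : R) : 0 <= h ->
  (forall i, `|x ord0 i| <= h) -> enorm x <= n%:R * h.
Proof.
move=> h0 xh; rewrite -ler_sqr ?nnegrE ?enorm_ge0 ?mulr_ge0//.
rewrite sqr_sqrtr ?dot_ge0//.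
apply: (@le_trans _ _ (\sum_(i < n) h ^+ 2)).
  apply: ler_sum => i _; rewrite -expr2 -(real_normK (num_real (x _ _))).
  by rewrite ler_sqr ?nnegrE.
rewrite sumr_const card_ord -[leLHS]mulr_natl exprMn ler_wpM2r ?sqr_ge0//.
by rewrite -natrX ler_nat; case: n => // k; rewrite -[X in (X <= _)%N]expn1 leq_pexp2l.
Qed.

Lemma measurable_distance : measurable_fun [set: rV * rV] distance.
Proof.
rewrite /distance /enorm; apply: (@measurableT_comp _ _ _ _ _ _ (fun x : R => Num.sqrt x)).
  by apply: continuous_measurable_fun => x; exact: sqrt_continuous.
apply: measurable_sum => i.
have m1 : measurable_fun setT (fun z : rV * rV => (z.1 - z.2) ord0 i : R).
  rewrite (_ : (fun z => _) = (fun z : rV * rV => z.1 ord0 i - z.2 ord0 i)).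
    by apply: measurable_funB; apply: (measurableT_comp (@measurable_coord R n i)).
  by apply/funext => z; rewrite !mxE.
exact: measurable_funM.
Qed.

Lemma measurable_distance_powR (a : R) :
  measurable_fun [set: rV * rV] (fun z => distance z `^ a).
Proof. exact: (measurableT_comp (measurable_powR a) measurable_distance). Qed.

Lemma measurable_distance_powV (k : nat) :
  measurable_fun [set: rV * rV] (fun z => (distance z ^+ k)^-1).
Proof.
rewrite (_ : (fun z => _) = (fun z => distance z `^ (- k%:R))).
  exact: measurable_distance_powR.
by apply/funext => z; rewrite powRN powR_mulrn// distance_ge0.
Qed.

Lemma diff_quot_affine a b u v :
  diff_quot (fun x => a * u x + b * v x) =
  (fun z => a * diff_quot u z + b * diff_quot v z).
Proof.
by apply/funext => z; rewrite /diff_quot /D_s !mulrA -mulrDl; congr (_ / _); ring.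
Qed.

Lemma measurable_diff_quot u : measurable_fun [set: rV] u ->
  measurable_fun [set: rV * rV] (diff_quot u).
Proof.
move=> mu; rewrite (_ : diff_quot u = (fun z => (u z.1 - u z.2) * distance z `^ (- s))).
  apply: measurable_funM; last exact: measurable_distance_powR.
  by apply: measurable_funB; apply: (measurableT_comp mu).
by apply/funext => z; rewrite /diff_quot /D_s powRN.
Qed.

Lemma diff_quot_norm u z : `|diff_quot (fun x => `|u x|) z| <= `|diff_quot u z|.
Proof.
rewrite /diff_quot /D_s !normrM ler_wpM2r//; exact: ler_dist_dist.
Qed.

Lemma ae_pair (P : rV -> Prop) : {ae L, forall x, P x} ->
  {ae (L \x L)%E, forall z, P z.1 /\ P z.2}.
Proof.
move=> [N [mN N0 sN]].
have h1 : {ae (L \x L)%E, forall z, P z.1}.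
  exists (N `*` setT); split => [||z /= nP].
  - exact: measurableX.
  - transitivity (L N * L setT)%E; first exact: product_measure1E.
    by rewrite N0 mul0e.
  - by split => //; exact: sN.
have h2 : {ae (L \x L)%E, forall z, P z.2}.
  exists (setT `*` N); split => [||z /= nP].
  - exact: measurableX.
  - transitivity (L setT * L N)%E; first exact: product_measure1E.
    by rewrite N0 mule0.
  - by split => //; exact: sN.
by apply: filterS2 h1 h2 => z.
Qed.

Lemma diff_quot_cvg (uk : nat -> rV -> R) u :
  {ae L, forall x, uk k x @[k --> \oo] --> u x} ->
  {ae (L \x L)%E, forall z, diff_quot (uk k) z @[k --> \oo] --> diff_quot u z}.
Proof.
move=> /ae_pair; apply: filterS => z [c1 c2]; rewrite /diff_quot /D_s.
by apply: cvgM; [apply: cvgB|exact: cvg_cst].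
Qed.

End difference_quotient.

(** * Oscillation on cells and compactness in the mass modular *)

Section oscillation.
Variables (R : realType) (n : nat) (s : R) (g G : R -> R) (pp : R).
Hypothesis HG : admissible g G pp.
Hypothesis s_gt0 : 0 < s.
Local Notation rV := ('rV[R]_n).
Local Notation L := (@lebesgue_rV R n).
Implicit Types (f u : rV -> R) (A B P Q : set rV).

Definition quot_dens f (z : rV * rV) : R :=
  G `|diff_quot s f z| / distance z ^+ n.

Lemma quot_dens_ge0 f z : 0 <= quot_dens f z.
Proof. by rewrite divr_ge0 ?(youngN_ge0 HG)// exprn_ge0// distance_ge0. Qed.

Lemma measurable_quot_dens f : measurable_fun [set: rV] f ->
  measurable_fun [set: rV * rV] (quot_dens f).
Proof.
move=> mf; apply: measurable_funM; last exact: measurable_distance_powV.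
exact: (measurableT_comp (measurable_young HG) (measurable_diff_quot s mf)).
Qed.

Lemma ge0_integral_setX A B (F : rV * rV -> \bar R) :
  measurable A -> measurable B -> measurable_fun setT F -> (forall z, 0 <= F z)%E ->
  (\int[L \x L]_(z in A `*` B) F z = \int[L]_(x in A) \int[L]_(y in B) F (x, y))%E.
Proof.
move=> mA mB mF F0.
have mAB : measurable (A `*` B) by exact: measurableX.
rewrite integral_mkcond fubini_tonelli1; last 2 first.
- by apply/(measurable_restrictT _ mAB); exact: measurable_funTS.
- by move=> z; apply: erestrict_ge0.
rewrite [RHS]integral_mkcond; apply: eq_integral => x _; rewrite /fubini_F patchE.
case: ifPn => xA.
  rewrite [RHS]integral_mkcond; apply: eq_integral => y _; rewrite !patchE.
  by rewrite in_setX xA.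
rewrite integral0_eq// => y _; rewrite patchE in_setX (negbTE xA)//.
Qed.

Lemma measurable_integral_section B (F : rV * rV -> \bar R) :
  measurable B -> measurable_fun setT F -> (forall z, 0 <= F z)%E ->
  measurable_fun setT (fun x => \int[L]_(y in B) F (x, y))%E.
Proof.
move=> mB mF F0.
have mAB : measurable ([set: rV] `*` B) by exact: measurableX.
have := @measurable_fun_fubini_tonelli_F _ _ _ _ _ L (F \_ (setT `*` B)) _ _.
have H1 : measurable_fun setT (F \_ (setT `*` B)).
  by apply/(measurable_restrictT _ mAB); exact: measurable_funTS.
have H2 z : (0 <= (F \_ (setT `*` B)) z)%E by apply: erestrict_ge0.
move=> /(_ H1 H2); apply: eq_measurable_fun => x _; rewrite /fubini_F.
rewrite [RHS]integral_mkcond; apply: eq_integral => y _; rewrite !patchE.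
by rewrite in_setX in_setT.
Qed.

(** Near the diagonal the difference itself is controlled by the singular
    density, with a gain [rho `^ s] from [G (l t) <= l G t] and the volume factor
    [rho ^+ n] from the kernel. *)
Lemma quot_dens_controls f x y (rho : R) :
  distance (x, y) <= rho -> rho <= 1 ->
  G `|f x - f y| <= rho `^ s * rho ^+ n * quot_dens f (x, y).
Proof.
set r := distance (x, y) => rrho rho1.
have r0 : 0 <= r by exact: distance_ge0.
have rho0 : 0 <= rho by apply: le_trans rrho.
have [r00|rn0] := eqVneq r 0.
  have -> : x = y.
    apply/rowP => i; apply/eqP; rewrite -subr_eq0 -normr_le0.
    have := coord_le_enorm (x - y) i; rewrite -[enorm _]/(distance (x, y)) -/r r00.
    by rewrite !mxE.
  rewrite subrr normr0 (young0 HG); apply: mulr_ge0; last exact: quot_dens_ge0.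
  by rewrite mulr_ge0 ?powR_ge0 ?exprn_ge0.
have rp : 0 < r by rewrite lt_def rn0.
have rs0 : 0 < r `^ s by rewrite powR_gt0.
have rs1 : r `^ s <= 1.
  have p1 : 1 `^ s = 1 by rewrite powR1.
  by rewrite -[leRHS]p1 ge0_ler_powR ?nnegrE ?(ltW s_gt0)// (le_trans rrho).
have E : f x - f y = r `^ s * diff_quot s f (x, y).
  by rewrite /diff_quot /D_s /= mulrC divfK// gt_eqF.
have l01 : 0 <= r `^ s <= 1 by rewrite ltW.
rewrite E (le_trans (young_scale HG _ l01))//.
have -> : r `^ s * G `|diff_quot s f (x, y)| = r `^ s * r ^+ n * quot_dens f (x, y).
  by rewrite /quot_dens -/r; field; rewrite expf_neq0.
apply: ler_wpM2r; first exact: quot_dens_ge0.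
apply: ler_pM; rewrite ?powR_ge0 ?exprn_ge0//.
  by rewrite ge0_ler_powR ?nnegrE ?(ltW s_gt0).
by rewrite lerXn2r ?nnegrE.
Qed.

Definition mean Q f : R := (fine (L Q))^-1 * \int[L]_(y in Q) f y.

(** Jensen's inequality, from the tangent at the mean. *)
Lemma jensen_mean Q f (c : R) : measurable Q -> (0 < L Q < +oo)%E ->
  measurable_fun [set: rV] f -> L.-integrable Q (EFin \o f) ->
  ((fine (L Q) * G `|c - mean Q f|)%:E <= \int[L]_(y in Q) (G `|c - f y|)%:E)%E.
Proof.
move=> mQ /andP[Q0 Qoo] mf fi.
set V := fine (L Q).
have VE : (V%:E = L Q)%E by rewrite /V fineK// ge0_fin_numE.
have V0 : 0 < V by rewrite -lte_fin VE.
have mG : measurable_fun Q (fun y => G `|c - f y|).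
  apply: measurable_funTS; apply: (measurableT_comp (measurable_young HG)).
  exact: measurable_funB.
have [->|Foo] := eqVneq (\int[L]_(y in Q) (G `|c - f y|)%:E)%E +oo%E.
  exact: leey.
have Gi : L.-integrable Q (EFin \o (fun y => G `|c - f y|)).
  apply/integrableP; split; first exact/measurable_EFinP.
  under eq_integral => y _ do rewrite /= ger0_norm ?(youngN_ge0 HG)//.
  by rewrite ltey.
pose t := c - mean Q f.
have ic (a : R) : L.-integrable Q (EFin \o (fun=> a)).
  apply/integrableP; split; first exact/measurable_EFinP.
  have -> : (\int[L]_(x in Q) `|(EFin \o (fun=> a)) x| = `|a|%:E * L Q)%E.
    exact: integral_cst.
  by rewrite -VE -EFinM ltry.
have imf : L.-integrable Q (EFin \o (fun y => mean Q f - f y)).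
  by have := integrableB mQ (ic (mean Q f)) fi; exact.
have i2 : L.-integrable Q (EFin \o (fun y => g_signed g t * (mean Q f - f y))).
  by have := integrableZl mQ (g_signed g t) imf; exact.
have i1 : L.-integrable Q (EFin \o (fun y => G `|t| + g_signed g t * (mean Q f - f y))).
  by have := integrableD mQ (ic (G `|t|)) i2; exact.
have := le_Rintegral mQ i1 Gi.
have H y : G `|t| + g_signed g t * (mean Q f - f y) <= G `|c - f y|.
  have := young_tangent HG t (c - f y).
  by have -> : c - f y - t = mean Q f - f y by rewrite /t; ring.
move=> /(_ (fun y _ => H y)).
rewrite RintegralD// RintegralZl// RintegralB// !Rintegral_cst// -/V.
have -> : mean Q f * V - \int[L]_(y in Q) f y = 0.
  by rewrite /mean mulrAC mulVf ?gt_eqF// mul1r subrr.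
rewrite mulr0 addr0 -lee_fin mulrC => /le_trans; apply.
by rewrite /Rintegral fineK//; exact: integrable_fin_num.
Qed.

Section cell.
Variables (Q P : set rV) (rho kappa : R).
Hypothesis mQ : measurable Q.
Hypothesis mP : measurable P.
Hypothesis PQ : P `<=` Q.
Hypothesis Qpos : (0 < L Q < +oo)%E.
Hypothesis Qdiam : forall x y, Q x -> Q y -> distance (x, y) <= rho.
Hypothesis rho0 : 0 < rho.
Hypothesis rho1 : rho <= 1.
Hypothesis Qfat : rho ^+ n <= kappa * fine (L Q).

Let V := fine (L Q).

Let VE : (V%:E = L Q)%E.
Proof. by case/andP: Qpos => Q0 Qoo; rewrite /V fineK// ge0_fin_numE. Qed.

Let V0 : 0 < V.
Proof. by rewrite -lte_fin VE; case/andP: Qpos. Qed.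

(** [P] is the part of the cell [Q] where the function is to be controlled; the
    mean is taken over all of [Q], and [kappa] compares volume and diameter. *)
Lemma cell_oscillation f : measurable_fun [set: rV] f ->
  L.-integrable Q (EFin \o f) ->
  (\int[L]_(x in P) (G `|f x - mean Q f|)%:E <=
   (kappa * rho `^ s)%:E * \int[L \x L]_(z in P `*` Q) (quot_dens f z)%:E)%E.
Proof.
move=> mf fi.
have mF : measurable_fun setT (fun z => (quot_dens f z)%:E).
  by apply/measurable_EFinP; exact: measurable_quot_dens.
have F0 z : (0 <= (quot_dens f z)%:E)%E by rewrite lee_fin quot_dens_ge0.
have k0 : 0 <= kappa.
  by rewrite -(pmulr_lge0 _ V0) (le_trans _ Qfat)// exprn_ge0// ltW.
have mI := measurable_integral_section mQ mF F0.
rewrite ge0_integral_setX// -ge0_integralZl//; last 3 first.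
- by apply: measurable_funTS; exact: mI.
- by move=> x _; apply: integral_ge0.
- by rewrite lee_fin mulr_ge0// powR_ge0.
have mGf (c : rV -> R) : measurable_fun setT c ->
    measurable_fun setT (fun y => (G `|c y|)%:E).
  by move=> mc; apply/measurable_EFinP; exact: (measurableT_comp (measurable_young HG)).
have mFx x : measurable_fun setT (fun y => (quot_dens f (x, y))%:E).
  by apply: measurableT_comp mF _; exact: measurable_pair1.
apply: ge0_le_integral => //.
- by move=> x _; rewrite lee_fin (youngN_ge0 HG).
- by apply: measurable_funTS; apply: mGf; exact: measurable_funB.
- by apply: measurable_funTS; apply: measurable_funeM; exact: mI.
move=> x Px.
rewrite -(@lee_pmul2l _ V%:E)// -EFinM.
apply: le_trans (jensen_mean (f x) mQ Qpos mf fi) _.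
apply: (@le_trans _ _ (\int[L]_(y in Q) ((rho `^ s * rho ^+ n)%:E * (quot_dens f (x, y))%:E))%E).
  apply: ge0_le_integral => //.
  - by move=> y _; rewrite lee_fin (youngN_ge0 HG).
  - by apply: measurable_funTS; apply: mGf; exact: measurable_funB.
  - by apply: measurable_funTS; exact: measurable_funeM.
  - by move=> y Qy; rewrite -EFinM lee_fin; apply: quot_dens_controls => //; apply: Qdiam => //; exact: PQ.
rewrite ge0_integralZl//; last 2 first.
- by apply: measurable_funTS.
- by rewrite lee_fin mulr_ge0 ?powR_ge0// exprn_ge0// ltW.
rewrite muleA lee_wpmul2r//; first by apply: integral_ge0.
rewrite -EFinM lee_fin mulrA [leRHS]mulrC ler_wpM2l ?powR_ge0//.
by rewrite mulrC.
Qed.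

(** The modular over the whole cell is recovered from the part [P] of positive
    measure by averaging [f y = f x + (f y - f x)] over [x] in [P]. *)
Lemma cell_integrable f (C1 C2 : R) : measurable_fun [set: rV] f -> (0 < L P)%E ->
  (\int[L]_(x in P) (G `|f x|)%:E <= C1%:E)%E ->
  (\int[L \x L]_(z in P `*` Q) (quot_dens f z)%:E <= C2%:E)%E ->
  forall D, (forall a, G `|2 * a| <= D * G `|a|) -> 0 <= D ->
  (\int[L]_(y in Q) (G `|f y|)%:E <= (D * (V * C1 + C2) / fine (L P))%:E)%E.
Proof.
move=> mf P0 H1 H2 D HD D0.
have Poo : (L P < +oo)%E.
  case/andP: Qpos => _; apply: le_lt_trans; apply: le_measure => //; by rewrite inE.
set W := fine (L P).
have WE : (W%:E = L P)%E by rewrite /W fineK// ge0_fin_numE.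
have W0 : 0 < W by rewrite -lte_fin WE.
have mG : measurable_fun setT (fun y => (G `|f y|)%:E).
  by apply/measurable_EFinP; exact: (measurableT_comp (measurable_young HG)).
have G0 y : (0 <= (G `|f y|)%:E)%E by rewrite lee_fin (youngN_ge0 HG).
have mF : measurable_fun setT (fun z => (quot_dens f z)%:E).
  by apply/measurable_EFinP; exact: measurable_quot_dens.
have F0 z : (0 <= (quot_dens f z)%:E)%E by rewrite lee_fin quot_dens_ge0.
have mPQ : measurable (P `*` Q) by exact: measurableX.
have m1 : measurable_fun setT (fun z : rV * rV => (G `|f z.1|)%:E).
  exact: (measurableT_comp mG).
have m2 : measurable_fun setT (fun z : rV * rV => (G `|f z.2|)%:E).
  exact: (measurableT_comp mG).
rewrite mulrC EFinM lee_pdivlMl//.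
have -> : (W%:E * \int[L]_(y in Q) (G `|f y|)%:E =
    \int[L \x L]_(z in P `*` Q) (G `|f z.2|)%:E)%E.
  rewrite (@ge0_integral_setX _ _ (fun z => (G `|f z.2|)%:E))//=.
  rewrite WE muleC; apply/esym; exact: integral_cst.
apply: (@le_trans _ _ (\int[L \x L]_(z in P `*` Q)
    (D%:E * ((G `|f z.1|)%:E + (quot_dens f z)%:E)))%E).
  apply: ge0_le_integral => //.
  - exact: measurable_funTS.
  - by apply: measurable_funTS; apply: measurable_funeM; exact: emeasurable_funD.
  move=> [x y] [/= Px Qy]; rewrite -EFinD -EFinM lee_fin.
  have := young_sum_doubling HG HD (f x) (f y - f x).
  rewrite [f x + _]addrC subrK => /le_trans; apply; rewrite ler_wpM2l// lerD2l.
  rewrite distrC; have := @quot_dens_controls f x y rho (Qdiam (PQ Px) Qy) rho1.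
  move/le_trans; apply; rewrite ler_piMl ?quot_dens_ge0//.
  rewrite mulr_ile1 ?powR_ge0 ?exprn_ge0 ?(ltW rho0)// ?exprn_ile1 ?(ltW rho0)//.
  have p1 : 1 `^ s = 1 by rewrite powR1.
  by rewrite -[leRHS]p1 ge0_ler_powR ?nnegrE ?(ltW s_gt0) ?(ltW rho0).
rewrite ge0_integralZl//; last 2 first.
- by apply: measurable_funTS; exact: emeasurable_funD.
- by move=> z _; rewrite adde_ge0.
rewrite ge0_integralD//; last 2 first.
- exact: measurable_funTS.
- exact: measurable_funTS.
rewrite [in leRHS]EFinM; apply: lee_wpmul2l; first by rewrite lee_fin.
rewrite EFinD; apply: leeD => //.
rewrite (@ge0_integral_setX _ _ (fun z => (G `|f z.1|)%:E))//=.
have -> : (\int[L]_(x in P) \int[L]_(y in Q) (G `|f x|)%:E =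
   V%:E * \int[L]_(x in P) (G `|f x|)%:E)%E.
  rewrite -ge0_integralZl//; last 2 first.
  - exact: measurable_funTS.
  - by rewrite lee_fin ltW.
  by apply: eq_integral => x _; rewrite VE muleC; exact: integral_cst.
by rewrite EFinM lee_wpmul2l// lee_fin ltW.
Qed.

End cell.

End oscillation.

(** * Borel sets and grids *)

Lemma bounded_ultra_limit (R : realType) (F : set_system nat) (m : nat -> R) (B : R) :
  UltraFilter F -> (forall k, `|m k| <= B) ->
  exists a, forall e, 0 < e -> F [set k | `|m k - a| <= e].
Proof.
move=> UF mB.
have cB : compact (`[- B, B]%classic : set R) by exact: segment_compact.
have FB : (m @ F) `[- B, B]%classic.
  apply: (@filterS _ F _ setT); last exact: filterT.
  by move=> k _ /=; rewrite in_itv/= -ler_norml.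
have [a [_ ca]] := cB (m @ F) _ FB.
exists a => e e0.
have [//|FC] := in_ultra_setVsetC [set k | `|m k - a| <= e] UF.
have nb : nbhs a [set x : R | `|x - a| <= e].
  have /cvgrPdist_le/(_ _ e0) : x @[x --> a] --> a by exact: cvg_id.
  by apply: filterS => x; rewrite distrC.
have [x [hx hx']] := ca [set x | ~ (`|x - a| <= e)] _ FC nb.
by [].
Qed.

Section grid.
Variables (R : realType) (n : nat).
Local Notation rV := ('rV[R]_n).
Local Notation L := (@lebesgue_rV R n).

Definition box (lo hi : 'I_n -> R) : set rV :=
  [set x | forall i, lo i <= x ord0 i < hi i].

Lemma measurable_box lo hi : measurable (box lo hi).
Proof.
rewrite (_ : box lo hi = \bigcap_(i in [set: 'I_n])
    ((fun x : rV => x ord0 i : measurableTypeR R) @^-1` `[lo i, hi i[%classic)).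
  apply: fin_bigcap_measurable => [|i _]; first exact: finite_finset.
  by rewrite -[X in measurable X]setTI; apply: measurable_coord.
by apply/seteqP; split => x /= h i => [_|]; have := h i; rewrite /= in_itv/=; [|apply].
Qed.

Lemma lebesgue_box lo hi : (forall i, lo i < hi i) ->
  L (box lo hi) = (\prod_(i < n) (hi i - lo i))%:E.
Proof.
move=> lh; rewrite (_ : box lo hi = [set x : rV | forall i, `[lo i, hi i[%classic (x ord0 i)]).
  transitivity (\prod_(i < n) @lebesgue_measure R `[lo i, hi i[%classic)%E.
    by apply: (@lebesgue_rV_box R n (fun i => `[lo i, hi i[%classic)) => i.
  rewrite -prodEFin; apply: eq_bigr => i _.
  by rewrite lebesgue_measure_itv/= lte_fin lh EFinB.
by apply/seteqP; split => x /= h i; have := h i; rewrite /= in_itv.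
Qed.

Lemma coord_le_norm (x : rV) i : `|x ord0 i| <= `|x|.
Proof.
rewrite [leRHS]/Num.norm/= mx_normrE.
exact: (le_bigmax _ (fun ij : 'I_1 * 'I_n => `|x ij.1 ij.2|) (ord0, i)).
Qed.

(** An open set is the union of the boxes with rational data that it contains. *)
Lemma open_measurable_rV (Om : set rV) : open Om -> measurable Om.
Proof.
move=> oOm.
pose bx (q : {ffun 'I_n -> rat} * rat) :=
  box (fun i => ratr (q.1 i) - ratr q.2) (fun i => ratr (q.1 i) + ratr q.2 : R).
pose U (k : nat) : set rV :=
  if unpickle k is Some q then (if `[< bx q `<=` Om >] then bx q else set0) else set0.
rewrite (_ : Om = \bigcup_k U k).
  apply: bigcup_measurable => k _; rewrite /U; case: unpickle => // q.
  by case: ifP => // _; exact: measurable_box.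
apply/seteqP; split => [x Omx|x [k _]]; last first.
  by rewrite /U; case: unpickle => // q; case: asboolP => // h; exact: h.
have /nbhs_ballP[e /= e0 be] : nbhs x Om by exact: open_nbhs_nbhs.
have [r] : exists r : rat, (ratr r : R) \in `]0, (e / 2)[.
  by apply: rat_in_itvoo; rewrite divr_gt0.
rewrite in_itv/= => /andP[r0 re].
have /choice[q Hq] (i : 'I_n) : exists q : rat, (ratr q : R) \in `](x ord0 i - ratr r), (x ord0 i + ratr r)[.
  by apply: rat_in_itvoo; lra.
exists (pickle ([ffun i => q i], r)) => //; rewrite /U pickleK.
have xb : bx ([ffun i => q i], r) x.
  by move=> i /=; rewrite ffunE; have := Hq i; rewrite in_itv/= => /andP[? ?]; apply/andP; split; lra.
case: asboolP => // -[] y yb; apply: be.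
rewrite /ball/=; split => // i j; rewrite (ord1 i); have /andP[yl yh] := yb j.
have := Hq j; rewrite in_itv/= => /andP[ql qh].
rewrite /= ffunE in yl yh; rewrite /ball/= ltr_norml; apply/andP; split; lra.
Qed.

Lemma bounded_coord (Om : set rV) : bounded_set Om ->
  exists2 a : R, 0 < a & forall x, Om x -> forall i, `|x ord0 i| < a.
Proof.
move=> [M [Mr bM]]; exists (`|M| + 2); first by rewrite ltr_wpDl.
move=> x Omx i; have h : M < `|M| + 1 by rewrite (le_lt_trans (ler_norm _))// ltrDl.
have := bM _ h x Omx => /= hx.
rewrite (le_lt_trans (coord_le_norm _ _))// (le_lt_trans hx)// ltrD2l ltr1n//.
Qed.

(** The half-open cells of a cubic grid; the side is as small as desired and the
    volume is comparable with the n-th power of the diameter. *)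
Lemma grid_exists (Om : set rV) (r0 : R) : (0 < n)%N -> bounded_set Om -> 0 < r0 ->
  exists (J : finType) (Q : J -> set rV) (rho : R),
    [/\ 0 < rho <= r0, forall j, measurable (Q j) /\ (0 < L (Q j) < +oo)%E,
        forall j x y, Q j x -> Q j y -> distance (x, y) <= rho,
        forall j, rho ^+ n <= n%:R ^+ n * fine (L (Q j)) &
        forall x, Om x -> exists j, Q j x] /\
    forall i j x, Q i x -> Q j x -> i = j.
Proof.
move=> n0 /bounded_coord[a a0 aOm] r00.
pose N := (Num.bound (n%:R * (2 * a) / r0)).+1.
pose h : R := 2 * a / N%:R.
have N0 : 0 < N%:R :> R by rewrite ltr0n.
have h0 : 0 < h by rewrite divr_gt0// mulr_gt0.
have hN : h * N%:R = 2 * a by rewrite divfK// gt_eqF.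
pose Q (j : {ffun 'I_n -> 'I_N}) :=
  box (fun i => (j i)%:R * h - a) (fun i => (j i).+1%:R * h - a).
have lohi (j : {ffun 'I_n -> 'I_N}) i : (j i)%:R * h - a < (j i).+1%:R * h - a.
  by rewrite ltrD2r ltr_pM2r// ltr_nat.
have LQ j : L (Q j) = (h ^+ n)%:E.
  rewrite lebesgue_box; last exact: lohi.
  congr _%:E; rewrite -[n in RHS]card_ord -prodr_const; apply: eq_bigr => i _.
  by rewrite -natr1; ring.
have idx (j : {ffun 'I_n -> 'I_N}) x i : Q j x -> nat_of_ord (j i) = Num.truncn ((x ord0 i + a) / h).
  move=> /(_ i)/andP[lo hi]; apply/esym/truncn_def.
  by rewrite ler_pdivlMr// ltr_pdivrMr// -lerBlDr lo/= -ltrBrDr.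
exists {ffun 'I_n -> 'I_N}, Q, (n%:R * h); split; first split.
- rewrite mulr_gt0 ?ltr0n//=.
  rewrite /h mulrA ler_pdivrMr// -ler_pdivrMl// mulrC.
  apply/ltW/(lt_le_trans (archi_boundP _)).
    by rewrite divr_ge0 ?(ltW r00)// !mulr_ge0// ltW.
  by rewrite ler_nat.
- by move=> j; split; [exact: measurable_box|rewrite LQ lte_fin exprn_gt0//= ltry].
- move=> j x y Qx Qy; apply: enorm_le_coord; first exact: ltW.
  move=> i; rewrite !mxE; have /andP[xl xh] := Qx i; have /andP[yl yh] := Qy i.
  rewrite ler_norml; rewrite -natr1 in xh yh; apply/andP; split; lra.
- by move=> j; rewrite LQ/= exprMn.
- move=> x Omx.
  have lt i : (Num.truncn ((x ord0 i + a) / h) < N)%N.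
    have := aOm x Omx i; rewrite ltr_norml => /andP[xl xh].
    have : (x ord0 i + a) / h < N%:R by rewrite ltr_pdivrMr// mulrC hN; lra.
    move=> lt; rewrite -(ltr_nat R); apply: le_lt_trans lt.
    by have /truncn_itv/andP[] : 0 <= (x ord0 i + a) / h by rewrite divr_ge0 ?ltW//; lra.
  exists [ffun i => Ordinal (lt i)] => i; rewrite ffunE/=.
  have := aOm x Omx i; rewrite ltr_norml => /andP[xl xh].
  have y0 : 0 <= (x ord0 i + a) / h by rewrite divr_ge0 ?ltW//; lra.
  have := truncn_itv y0 => /andP[lo hi].
  move: lo hi; rewrite ler_pdivlMr// ltr_pdivrMr//.
  by rewrite lerBlDr => -> /= ; rewrite ltrBrDr.
- move=> i j x Qi Qj; apply/ffunP => l; apply/val_inj => /=.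
  by rewrite (idx _ _ _ Qi) (idx _ _ _ Qj).
Qed.

End grid.

Section mass_compactness.
Variables (R : realType) (n : nat) (s : R) (g G : R -> R) (pp : R).
Variable Omega : set 'rV[R]_n.
Hypothesis HG : admissible g G pp.
Hypothesis n_gt0 : (0 < n)%N.
Hypothesis s_gt0 : 0 < s.
Hypothesis Omega_open : open Omega.
Hypothesis Omega_bounded : bounded_set Omega.
Local Notation rV := ('rV[R]_n).
Local Notation L := (@lebesgue_rV R n).
Implicit Types (f u : rV -> R).

Let mOmega : measurable Omega.
Proof. exact: open_measurable_rV. Qed.

Lemma measurable_off_exterior : measurable (off_exterior Omega).
Proof. by apply: measurableC; apply: measurableX; exact: measurableC. Qed.

Section cells.
Variables (J : finType) (Q : J -> set rV) (rho : R).
Hypothesis rho0 : 0 < rho.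
Hypothesis rho1 : rho <= 1.
Hypothesis mQ : forall j, measurable (Q j).
Hypothesis Qpos : forall j, (0 < L (Q j) < +oo)%E.
Hypothesis Qdiam : forall j x y, Q j x -> Q j y -> distance (x, y) <= rho.
Hypothesis Qfat : forall j, rho ^+ n <= n%:R ^+ n * fine (L (Q j)).
Hypothesis Qcover : forall x, Omega x -> exists j, Q j x.
Hypothesis Qdisj : forall i j x, Q i x -> Q j x -> i = j.

Let mP j : measurable (Omega `&` Q j).
Proof. exact: measurableI. Qed.

Lemma sum_cells (F : rV -> \bar R) : measurable_fun setT F -> (forall x, 0 <= F x)%E ->
  (\int[L]_(x in Omega) F x = \sum_(j : J) \int[L]_(x in Omega `&` Q j) F x)%E.
Proof.
move=> mF F0.
have OE : Omega = \big[setU/set0]_(j : J) (Omega `&` Q j).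
  rewrite -bigcup_seq; apply/seteqP; split => [x Ox|x [j _ []]//].
  by have [j Qj] := Qcover Ox; exists j => //=; rewrite mem_index_enum.
rewrite {1}OE ge0_integral_bigsetU//.
- exact: index_enum_uniq.
- by apply/trivIsetP => i j _ _ ij; apply/seteqP; split => // x [[_ /Qdisj h] [_ /h /eqP]]; rewrite (negbTE ij).
- exact: measurable_funTS.
Qed.

Lemma sum_pairs_le (F : rV * rV -> \bar R) : measurable_fun setT F -> (forall z, 0 <= F z)%E ->
  (\sum_(j : J) \int[L \x L]_(z in (Omega `&` Q j) `*` Q j) F z <=
   \int[L \x L]_(z in off_exterior Omega) F z)%E.
Proof.
move=> mF F0.
have mPQ j : measurable ((Omega `&` Q j) `*` Q j) by exact: measurableX.
rewrite -(@ge0_integral_bigsetU _ _ _ _ _ (fun j => (Omega `&` Q j) `*` Q j))//.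
- apply: ge0_subset_integral => //.
  + exact: bigsetU_measurable.
  + exact: measurable_off_exterior.
  + exact: measurable_funTS.
  + by rewrite -bigcup_seq => z [j _ [[Oz _] _]] [].
- exact: index_enum_uniq.
- apply/trivIsetP => i j _ _ ij; apply/seteqP; split => // z [[_ /Qdisj h] [_ /h /eqP]].
  by rewrite (negbTE ij).
- exact: measurable_funTS.
Qed.

(** Only the cells meeting [Omega] in positive measure matter, and there the
    mean is taken over the whole cell: the interaction of [Omega] with its
    complement controls it, whatever the shape of the boundary. *)
Lemma mass_le_of_means f (D delta C : R) : (forall a, G `|2 * a| <= D * G `|a|) -> 0 <= D ->
  0 <= delta ->
  measurable_fun [set: rV] f ->
  (forall j, (0 < L (Omega `&` Q j))%E -> L.-integrable (Q j) (EFin \o f)) ->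
  (forall j, (0 < L (Omega `&` Q j))%E -> `|mean (Q j) f| <= delta) ->
  (\int[L \x L]_(z in off_exterior Omega) (quot_dens s G f z)%:E <= C%:E)%E ->
  (\int[L]_(x in Omega) (G `|f x|)%:E <=
   (D * (n%:R ^+ n * rho `^ s) * C + D * (\sum_j fine (L (Q j))) * G delta)%:E)%E.
Proof.
move=> HD D0 d0 mf fi fm fC.
have mG : measurable_fun setT (fun y => (G `|f y|)%:E).
  by apply/measurable_EFinP; exact: (measurableT_comp (measurable_young HG)).
have G0 y : (0 <= (G `|f y|)%:E)%E by rewrite lee_fin (youngN_ge0 HG).
have mF : measurable_fun setT (fun z => (quot_dens s G f z)%:E).
  by apply/measurable_EFinP; exact: (measurable_quot_dens s HG).
have F0 z : (0 <= (quot_dens s G f z)%:E)%E by rewrite lee_fin (quot_dens_ge0 _ HG).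
have k0 : 0 <= n%:R ^+ n * rho `^ s by rewrite mulr_ge0 ?powR_ge0 ?exprn_ge0.
rewrite sum_cells//.
apply: (@le_trans _ _ (\sum_(j : J) ((D * (n%:R ^+ n * rho `^ s))%:E *
    \int[L \x L]_(z in (Omega `&` Q j) `*` Q j) (quot_dens s G f z)%:E +
    (D * fine (L (Q j)) * G delta)%:E))%E).
  apply: lee_sum => j _.
  have [P0|] := eqVneq (L (Omega `&` Q j)) 0%E.
    rewrite null_set_integral//; last exact: measurable_funTS.
    apply: adde_ge0; last by rewrite lee_fin !mulr_ge0// ?fine_ge0// (young_ge0 HG).
    by apply: mule_ge0; [rewrite lee_fin mulr_ge0|exact: integral_ge0].
  move=> Pn0; have P0 : (0 < L (Omega `&` Q j))%E by rewrite lt0e Pn0/=.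
  have PQ : Omega `&` Q j `<=` Q j by move=> x [].
  have osc := cell_oscillation HG s_gt0 (mQ j) (mP j) PQ (Qpos j) (Qdiam (j:=j)) rho0 rho1
    (Qfat j) mf (fi j P0).
  set m := mean (Q j) f in osc.
  have mGm : measurable_fun setT (fun y => (G `|f y - m|)%:E).
    apply/measurable_EFinP; apply: (measurableT_comp (measurable_young HG)).
    exact: measurable_funB.
  apply: (@le_trans _ _ (\int[L]_(x in Omega `&` Q j) (D%:E * (G `|f x - m|)%:E + (D * G delta)%:E))%E).
    apply: ge0_le_integral => //.
    - exact: measurable_funTS.
    - apply: measurable_funTS; apply: emeasurable_funD => //; exact: measurable_funeM.
    move=> x _; rewrite -EFinM -EFinD lee_fin.
    have := young_sum_doubling HG HD (f x - m) m; rewrite subrK => /le_trans; apply.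
    rewrite mulrDr lerD2l ler_wpM2l//.
    rewrite -[in leRHS](ger0_norm d0); apply: (young_homo HG).
    by rewrite (ger0_norm d0); exact: fm.
  rewrite ge0_integralD//; last 3 first.
  - by move=> x _; rewrite mule_ge0// lee_fin (youngN_ge0 HG).
  - by apply: measurable_funTS; exact: measurable_funeM.
  - by move=> x _; rewrite lee_fin mulr_ge0// (young_ge0 HG).
  apply: leeD.
    rewrite ge0_integralZl//; last 2 first.
    - exact: measurable_funTS.
    - by move=> x _; rewrite lee_fin (youngN_ge0 HG).
    rewrite EFinM -muleA; apply: lee_wpmul2l; first by rewrite lee_fin.
    exact: osc.
  have -> : (\int[L]_(x in Omega `&` Q j) (D * G delta)%:E = (D * G delta)%:E * L (Omega `&` Q j))%E.
    exact: integral_cst.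
  rewrite mulrAC [in leRHS]EFinM; apply: lee_wpmul2l; first by rewrite lee_fin mulr_ge0// (young_ge0 HG).
  have /andP[_ Qoo] := Qpos j.
  rewrite fineK ?ge0_fin_numE//; apply: le_measure => //; by rewrite inE.
rewrite big_split/= EFinD; apply: leeD; last first.
  by rewrite sumEFin lee_fin -mulr_suml mulr_sumr.
rewrite -ge0_sume_distrr; last by move=> j _; apply: integral_ge0.
rewrite [in leRHS]EFinM; apply: lee_wpmul2l; first by rewrite lee_fin mulr_ge0.
by apply: le_trans fC; exact: sum_pairs_le.
Qed.

(** The bound depends on the cell, which is harmless on a fixed finite grid. *)
Lemma cell_means_bounded (j : J) (C1 C2 : R) : (0 < L (Omega `&` Q j))%E ->
  exists B : R, forall f, measurable_fun [set: rV] f ->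
  (\int[L]_(x in Omega) (G `|f x|)%:E <= C1%:E)%E ->
  (\int[L \x L]_(z in off_exterior Omega) (quot_dens s G f z)%:E <= C2%:E)%E ->
  L.-integrable (Q j) (EFin \o f) /\ `|mean (Q j) f| <= B.
Proof.
move=> P0; have [D D1 HD] := young_doubling HG.
have D0 : 0 <= D by apply: le_trans D1.
have G1 : 0 < G 1 by case: HG => _ _ + _; apply.
set V := fine (L (Q j)).
have /andP[Q0 Qoo] := Qpos j.
have VE : (V%:E = L (Q j))%E by rewrite /V fineK// ge0_fin_numE.
have V0 : 0 < V by rewrite -lte_fin VE.
pose C3 := D * (V * C1 + C2) / fine (L (Omega `&` Q j)).
exists (V^-1 * (V + (G 1)^-1 * C3)) => f mf f1 f2.
have PQ : Omega `&` Q j `<=` Q j by move=> x [].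
have mG : measurable_fun setT (fun y => (G `|f y|)%:E).
  by apply/measurable_EFinP; exact: (measurableT_comp (measurable_young HG)).
have G0 y : (0 <= (G `|f y|)%:E)%E by rewrite lee_fin (youngN_ge0 HG).
have mF : measurable_fun setT (fun z => (quot_dens s G f z)%:E).
  by apply/measurable_EFinP; exact: (measurable_quot_dens s HG).
have F0 z : (0 <= (quot_dens s G f z)%:E)%E by rewrite lee_fin (quot_dens_ge0 _ HG).
have f1' : (\int[L]_(x in Omega `&` Q j) (G `|f x|)%:E <= C1%:E)%E.
  apply: le_trans f1; apply: ge0_subset_integral => //; exact: measurable_funTS.
have f2' : (\int[L \x L]_(z in (Omega `&` Q j) `*` Q j) (quot_dens s G f z)%:E <= C2%:E)%E.
  apply: le_trans f2; apply: ge0_subset_integral => //.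
  - exact: measurableX.
  - exact: measurable_off_exterior.
  - exact: measurable_funTS.
  - by move=> z [[Oz _] _] [].
have I3 := cell_integrable HG s_gt0 (mQ j) (mP j) PQ (Qpos j) (Qdiam (j:=j)) rho0 rho1
   mf P0 f1' f2' HD D0.
rewrite -/V -/C3 in I3.
have bd : (\int[L]_(y in Q j) `|f y|%:E <= (V + (G 1)^-1 * C3)%:E)%E.
  apply: (@le_trans _ _ (\int[L]_(y in Q j) (1%:E + ((G 1)^-1)%:E * (G `|f y|)%:E))%E).
    apply: ge0_le_integral => //.
    - apply: measurable_funTS; apply/measurable_EFinP; exact: measurableT_comp.
    - apply: measurable_funTS; apply: emeasurable_funD => //; exact: measurable_funeM.
    - by move=> y _; rewrite -EFinM -EFinD lee_fin; exact: (young_linear_growth HG).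
  rewrite ge0_integralD//; last 2 first.
  - by move=> y _; rewrite mule_ge0// lee_fin invr_ge0 ltW.
  - by apply: measurable_funTS; exact: measurable_funeM.
  rewrite EFinD; apply: leeD.
    have -> : (\int[L]_(x in Q j) 1%:E = 1%:E * L (Q j))%E by exact: integral_cst.
    by rewrite mul1e VE.
  rewrite ge0_integralZl//; last 2 first.
  - exact: measurable_funTS.
  - by rewrite lee_fin invr_ge0 ltW.
  by rewrite EFinM lee_wpmul2l// lee_fin invr_ge0 ltW.
have fi : L.-integrable (Q j) (EFin \o f).
  apply/integrableP; split; first by apply: measurable_funTS; exact/measurable_EFinP.
  by rewrite (le_lt_trans bd)// ltry.
split => //; rewrite /mean -/V normrM (ger0_norm (_ : 0 <= V^-1)) ?invr_ge0 ?(ltW V0)//.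
rewrite ler_wpM2l ?invr_ge0 ?(ltW V0)//.
rewrite (le_trans (le_normr_Rintegral (mQ j) fi))// -lee_fin.
apply: le_trans bd; rewrite /Rintegral fineK//.
apply: integrable_fin_num => //; exact: integrable_norm.
Qed.

End cells.

(** Rellich's theorem: on a fine grid the mass of a difference is controlled by
    its finitely many means, and those converge along any ultrafilter. *)
Lemma mass_compactness (u : nat -> rV -> R) (C e : R) (F : set_system nat) :
  UltraFilter F -> (forall k, measurable_fun [set: rV] (u k)) ->
  (forall k, \int[L]_(x in Omega) (G `|u k x|)%:E <= C%:E)%E ->
  (forall k, \int[L \x L]_(z in off_exterior Omega) (quot_dens s G (u k) z)%:E <= C%:E)%E ->
  0 < e ->
  exists2 A, F A & forall k l, A k -> A l ->
    (\int[L]_(x in Omega) (G `|u k x - u l x|)%:E <= e%:E)%E.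
Proof.
move=> UF mu uM uE e0; have [D D1 HD] := young_doubling HG.
have D0 : 0 < D by apply: lt_le_trans D1.
have G1 : 0 < G 1 by case: HG => _ _ + _; apply.
have C0 : 0 <= C.
  rewrite -lee_fin; apply: le_trans (uM 0%N); apply: integral_ge0 => x _.
  by rewrite lee_fin (youngN_ge0 HG).
(* with side [rho], [rho `^ s <= e / (2 c)], the oscillations cost at most [e / 2] *)
pose c := D * n%:R ^+ n * (D * (C + C)) + 1.
have c0 : 0 < c.
  by rewrite ltr_wpDl// !mulr_ge0 ?exprn_ge0 ?addr_ge0// ltW.
pose t := e / 2 / c.
have t0 : 0 < t by rewrite !divr_gt0.
pose r0 := Num.min 1 (t `^ s^-1).
have r00 : 0 < r0 by rewrite lt_min ltr01 powR_gt0.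
have [J [Q [rho [[/andP[rho0 rhor] mQ Qdiam Qfat Qcover] Qdisj]]]] :=
  grid_exists n_gt0 Omega_bounded r00.
have rho1 : rho <= 1 by rewrite (le_trans rhor)// ge_min lexx.
have rhos : rho `^ s <= t.
  have : rho <= t `^ s^-1 by rewrite (le_trans rhor)// ge_min lexx orbT.
  move=> h; have := @ge0_ler_powR R s (ltW s_gt0) rho (t `^ s^-1).
  rewrite !nnegrE (ltW rho0) powR_ge0 => /(_ isT isT h).
  by rewrite -powRrM mulVf ?gt_eqF// powRr1// ltW.
have mQ1 j : measurable (Q j) by case: (mQ j).
have mQ2 j : (0 < L (Q j) < +oo)%E by case: (mQ j).
(* means within [delta] of each other cost the remaining [e / 2] *)
pose S := D * (\sum_j fine (L (Q j))) * G 1 + 1.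
have S0 : 0 < S.
  rewrite ltr_wpDl// !mulr_ge0 ?(ltW D0) ?(ltW G1)//.
  by apply: sumr_ge0 => j _; rewrite fine_ge0.
pose delta := Num.min 1 (e / 2 / S).
have d0 : 0 < delta by rewrite lt_min ltr01 !divr_gt0.
have Gd : D * (\sum_j fine (L (Q j))) * G delta <= e / 2.
  have l01 : 0 <= delta <= 1 by rewrite ltW//= ge_min lexx.
  have := young_scale HG 1 l01; rewrite mulr1 normr1 ger0_norm ?(ltW d0)// => h.
  have h0 : 0 <= D * (\sum_j fine (L (Q j))).
    by rewrite mulr_ge0 ?(ltW D0)//; apply: sumr_ge0 => j _; rewrite fine_ge0.
  apply: le_trans (ler_wpM2l h0 h) _.
  have dS : delta * S <= e / 2 by rewrite -ler_pdivlMr// ge_min lexx orbT.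
  apply: le_trans dS; rewrite mulrCA ler_wpM2l ?(ltW d0)//.
  by rewrite /S lerDl.
pose m j k := if (0 < L (Omega `&` Q j))%E then mean (Q j) (u k) else 0.
have /choice[a Ha] (j : J) : exists a, forall e, 0 < e -> F [set k | `|m j k - a| <= e].
  have [P0|P0] := boolP (0 < L (Omega `&` Q j))%E; last first.
    exists 0 => d d00; apply: filterE => k /=.
    by rewrite /m (negbTE P0) subrr normr0 ltW.
  have [B HB] := cell_means_bounded rho0 rho1 mQ1 mQ2 Qdiam C C P0.
  apply: (@bounded_ultra_limit _ F (m j) B) => // k.
  by rewrite /m P0; have [] := HB (u k) (mu k) (uM k) (uE k).
have d20 : 0 < delta / 2 by rewrite divr_gt0.
exists [set k | forall j, `|m j k - a j| <= delta / 2].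
  by apply: filter_forall => j; exact: Ha.
move=> k l Ak Al.
have muk : measurable_fun setT (fun x => u k x - u l x) by exact: measurable_funB.
have mi i j : (0 < L (Omega `&` Q j))%E -> L.-integrable (Q j) (EFin \o u i).
  move=> P0; have [B HB] := cell_means_bounded rho0 rho1 mQ1 mQ2 Qdiam C C P0.
  by have [] := HB (u i) (mu i) (uM i) (uE i).
have mF i : measurable_fun setT (fun z => (quot_dens s G (u i) z)%:E).
  by apply/measurable_EFinP; exact: (measurable_quot_dens s HG).
have F0 i z : (0 <= (quot_dens s G (u i) z)%:E)%E by rewrite lee_fin (quot_dens_ge0 _ HG).
have Ekl : (\int[L \x L]_(z in off_exterior Omega)
    (quot_dens s G (fun x => u k x - u l x)%R z)%:E <= (D * (C + C))%:E)%E.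
  apply: (@le_trans _ _ (\int[L \x L]_(z in off_exterior Omega)
    (D%:E * ((quot_dens s G (u k) z)%:E + (quot_dens s G (u l) z)%:E)))%E).
    apply: ge0_le_integral => //.
    - exact: measurable_off_exterior.
    - by move=> z _; rewrite lee_fin (quot_dens_ge0 _ HG).
    - by apply: measurable_funTS; apply/measurable_EFinP; exact: (measurable_quot_dens s HG).
    - by apply: measurable_funTS; apply: measurable_funeM; exact: emeasurable_funD.
    move=> z _; rewrite -EFinD -EFinM lee_fin /quot_dens -mulrDl mulrA.
    rewrite ler_wpM2r ?invr_ge0 ?exprn_ge0 ?distance_ge0//.
    have -> : diff_quot s (fun x => u k x - u l x) z = diff_quot s (u k) z + - diff_quot s (u l) z.
      by rewrite /diff_quot /D_s -mulrBl; congr (_ / _); ring.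
    by rewrite -[X in _ + G X]normrN; exact: (young_sum_doubling HG).
  have mOff := measurable_off_exterior.
  rewrite ge0_integralZl//; last 3 first.
  - by apply: measurable_funTS; exact: emeasurable_funD.
  - by move=> z _; rewrite adde_ge0.
  - by rewrite lee_fin ltW.
  rewrite ge0_integralD//; last 2 first.
  - exact: measurable_funTS.
  - exact: measurable_funTS.
  by rewrite EFinM lee_wpmul2l ?lee_fin ?(ltW D0)// EFinD leeD.
have := @mass_le_of_means J Q rho rho0 rho1 mQ1 mQ2 Qdiam Qfat Qcover Qdisj
  (fun x => u k x - u l x) D delta (D * (C + C)) HD (ltW D0) (ltW d0) muk.
have fi j : (0 < L (Omega `&` Q j))%E -> L.-integrable (Q j) (EFin \o (fun x => u k x - u l x)).
  by move=> P0; have := integrableB (mQ1 j) (mi k j P0) (mi l j P0); exact.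
have fm j : (0 < L (Omega `&` Q j))%E -> `|mean (Q j) (fun x => u k x - u l x)| <= delta.
  move=> P0; rewrite /mean RintegralB ?mulrBr//; [|exact: mi|exact: mi].
  have := Ak j; have := Al j; rewrite /m P0 /mean => h1 h2.
  rewrite (_ : _ - _ = (fine (L (Q j)))^-1 * (\int[L]_(y in Q j) u k y) - a j
     - ((fine (L (Q j)))^-1 * (\int[L]_(y in Q j) u l y) - a j)); last by ring.
  by rewrite (le_trans (ler_normB _ _))// [leRHS]splitr lerD.
move=> /(_ fi fm Ekl)/le_trans; apply; rewrite lee_fin [leRHS]splitr lerD//.
have cE : c * rho `^ s <= e / 2 by rewrite mulrC -ler_pdivlMr.
apply: le_trans cE; rewrite /c.
have -> : D * (n%:R ^+ n * rho `^ s) * (D * (C + C)) = D * n%:R ^+ n * (D * (C + C)) * rho `^ s by ring.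
by rewrite ler_wpM2r ?powR_ge0// lerDl.
Qed.

End mass_compactness.

(** * A bump function of finite energy *)

Section bump.
Variables (R : realType) (n : nat) (s : R) (g G : R -> R) (pp : R).
Hypothesis HG : admissible g G pp.
Hypothesis n_gt0 : (0 < n)%N.
Hypothesis s_gt0 : 0 < s.
Hypothesis s_lt1 : s < 1.
Local Notation rV := ('rV[R]_n).
Local Notation L := (@lebesgue_rV R n).

Lemma distanceC (x y : rV) : distance (x, y) = distance (y, x).
Proof.
rewrite /distance /enorm; congr Num.sqrt; apply: eq_bigr => i _.
by rewrite !mxE -!expr2 -sqrrN opprB.
Qed.

Definition cball (x : rV) (rho : R) : set rV := [set y : rV | (distance (x, y) <= rho)%R].

Lemma measurable_cball (x : rV) (rho : R) : measurable (cball x rho).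
Proof.
have md : measurable_fun setT (fun y : rV => distance (x, y)).
  by apply: measurableT_comp (@measurable_distance R n) _; exact: measurable_pair1.
have := md measurableT `]-oo, rho]%classic (measurable_itv _).
by rewrite setTI; congr measurable; apply/seteqP; split => y /=; rewrite in_itv.
Qed.

Lemma cball_measure (x : rV) (rho : R) : 0 < rho ->
  (L (cball x rho) <= ((3 * rho) ^+ n)%:E)%E.
Proof.
move=> rho0.
have -> : ((3 * rho) ^+ n)%:E =
    L (box (fun i => x ord0 i - rho) (fun i => x ord0 i + 2 * rho)).
  rewrite lebesgue_box => [|i]; last by lra.
  congr _%:E; rewrite -[n in LHS]card_ord -prodr_const; apply: eq_bigr => i _; ring.
apply: le_measure; rewrite ?inE.
- exact: measurable_cball.
- exact: measurable_box.
move=> y /= dy i; have := le_trans (coord_le_enorm (x - y) i) dy.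
by rewrite !mxE ler_norml => /andP[? ?]; apply/andP; split; lra.
Qed.

(** Upper bound by dyadic shells: a summable amount of mass per shell. *)
Definition shells (A q : R) (rho : nat -> R) (x y : rV) : \bar R :=
  (\sum_(j <oo) (A * q ^+ j * (2 / rho j) ^+ n * \1_(cball x (rho j)) y)%:E)%E.

Section shells_integral.
Variables (A q : R) (rho : nat -> R).
Hypothesis A0 : 0 <= A.
Hypothesis q01 : 0 <= q < 1.
Hypothesis rho0 : forall j, 0 < rho j.

Let coef_ge0 j : 0 <= A * q ^+ j * (2 / rho j) ^+ n.
Proof.
case/andP: q01 => q0 _.
by rewrite !mulr_ge0 ?exprn_ge0 ?divr_ge0// ltW.
Qed.

Let term_ge0 j (x y : rV) :
  (0 <= (A * q ^+ j * (2 / rho j) ^+ n * \1_(cball x (rho j)) y)%:E)%E.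
Proof. by rewrite lee_fin mulr_ge0// coef_ge0. Qed.

Let measurable_term j x : measurable_fun [set: rV] (fun y =>
  (A * q ^+ j * (2 / rho j) ^+ n * \1_(cball x (rho j)) y)%:E).
Proof.
apply/measurable_EFinP; apply: measurable_funM => //.
by apply: measurable_indic; exact: measurable_cball.
Qed.

Lemma measurable_shells x : measurable_fun [set: rV] (shells A q rho x).
Proof. by apply: ge0_emeasurable_sum => // j y _. Qed.

Lemma shells_ge0 x y : (0 <= shells A q rho x y)%E.
Proof. by apply: nneseries_ge0 => j _ _. Qed.

Lemma shells_integral : exists2 C : R, 0 <= C &
  forall x, (\int[L]_y shells A q rho x y <= C%:E)%E.
Proof.
have A6 : 0 <= A * 6 ^+ n by rewrite mulr_ge0 ?exprn_ge0.
pose S := (\sum_(j <oo) (A * 6 ^+ n * q ^+ j)%:E)%E.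
have q0 : 0 <= q by case/andP: q01.
have S0 : (0 <= S)%E.
  by apply: nneseries_ge0 => j _ _; rewrite lee_fin mulr_ge0// exprn_ge0.
have Soo : (S < +oo)%E by exact: geometric_nneseries_lty.
exists (fine S); first exact: fine_ge0.
move=> x; rewrite fineK ?ge0_fin_numE// /shells integral_nneseries//.
apply: lee_nneseries => j _; first by move=> _; apply: integral_ge0.
under eq_integral => y _ do rewrite EFinM.
rewrite ge0_integralZl//; last 2 first.
- by apply/measurable_EFinP; apply: measurable_indic; exact: measurable_cball.
- by rewrite lee_fin.
have -> : (\int[L]_y (\1_(cball x (rho j)) y)%:E = L (cball x (rho j)))%E.
  by rewrite integral_indic ?setIT//; exact: measurable_cball.
apply: le_trans (lee_wpmul2l _ (cball_measure x (rho0 j))) _.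
  by rewrite lee_fin.
have E6 : (2 / rho j) ^+ n * (3 * rho j) ^+ n = 6 ^+ n.
  by rewrite -exprMn; congr (_ ^+ _); field; rewrite gt_eqF.
by rewrite -EFinM lee_fin -(mulrA _ _ ((3 * _) ^+ _)) E6 mulrAC.
Qed.

Lemma le_shells j (x y : rV) (v : R) : rho j / 2 < distance (x, y) <= rho j ->
  0 <= v -> v <= A * q ^+ j -> ((v / distance (x, y) ^+ n)%:E <= shells A q rho x y)%E.
Proof.
move=> /andP[dl du] v0 vA.
apply: (@le_trans _ _ (A * q ^+ j * (2 / rho j) ^+ n * \1_(cball x (rho j)) y)%:E).
  rewrite indicE mem_set// mulr1 lee_fin ler_pM//.
    by rewrite invr_ge0 exprn_ge0// distance_ge0.
  have dp : 0 < distance (x, y) by rewrite (lt_trans _ dl)// divr_gt0.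
  rewrite -exprVn lerXn2r ?nnegrE ?invr_ge0 ?distance_ge0 ?divr_ge0 ?(ltW (rho0 j))//.
  by rewrite -[leRHS]invf_div lef_pV2 ?posrE ?divr_gt0// ltW.
apply: (@le_trans _ _ (\sum_(0 <= i < j.+1) (A * q ^+ i * (2 / rho i) ^+ n *
    \1_(cball x (rho i)) y)%:E)%E).
  by rewrite big_nat_recr//= leeDr// sume_ge0.
exact: nneseries_lim_ge.
Qed.

End shells_integral.

(** Built on the l1 norm, whose Lipschitz bound and measurability are read off
    coordinatewise. *)
Definition bump (c : rV) (r : R) (x : rV) : R :=
  Num.max 0 (r - \sum_(i < n) `|x ord0 i - c ord0 i|).

Lemma bump_ge0 c r x : 0 <= bump c r x.
Proof. by rewrite /bump le_max lexx. Qed.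

Lemma bump_le c r x : 0 <= r -> bump c r x <= r.
Proof. by move=> r0; rewrite /bump ge_max r0 gerBl sumr_ge0. Qed.

Lemma measurable_bump c r : measurable_fun [set: rV] (bump c r).
Proof.
apply: measurable_maxr => //; apply: measurable_funB => //.
apply: measurable_sum => i; apply: measurableT_comp => //.
by apply: measurable_funB => //; exact: measurable_coord.
Qed.

Lemma bump_support c r x : bump c r x != 0 ->
  box (fun i => c ord0 i - r) (fun i => c ord0 i + r) x.
Proof.
have [h|h] := leP (r - \sum_(i < n) `|x ord0 i - c ord0 i|) 0.
  by rewrite /bump max_l// eqxx.
move=> _ i; have : `|x ord0 i - c ord0 i| < r.
  apply: le_lt_trans (_ : \sum_(i < n) `|x ord0 i - c ord0 i| < r); last by lra.
  by rewrite (bigD1 i)//= lerDl sumr_ge0.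
by rewrite ltr_norml => /andP[? ?]; apply/andP; split; lra.
Qed.

Lemma bump_lipschitz c r x y :
  `|bump c r x - bump c r y| <= n%:R * distance (x, y).
Proof.
have H (a b : R) : `|Num.max 0 a - Num.max 0 b| <= `|a - b|.
  case: (leP 0 a) => ?; case: (leP 0 b) => ?; rewrite ?subrr ?normr0//.
    by rewrite subr0 (ger0_norm (_ : 0 <= a))// (ger0_norm (_ : 0 <= a - b)); lra.
  by rewrite sub0r normrN (ger0_norm (_ : 0 <= b))// (ler0_norm (_ : a - b <= 0)); lra.
apply: le_trans (H _ _) _.
rewrite (_ : r - _ - _ = \sum_(i < n) `|y ord0 i - c ord0 i| -
  \sum_(i < n) `|x ord0 i - c ord0 i|); last by ring.
rewrite -sumrB.
apply: le_trans (ler_norm_sum _ _ _) _.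
apply: (@le_trans _ _ (\sum_(i < n) distance (x, y))); last first.
  by rewrite sumr_const card_ord -[leLHS]mulr_natl.
apply: ler_sum => i _; rewrite (le_trans (ler_dist_dist _ _))//.
have := coord_le_enorm (x - y) i; rewrite !mxE; apply: le_trans.
by rewrite distrC le_eqVlt; apply/orP; left; apply/eqP; congr `|_|; ring.
Qed.

Lemma quot_densC (f : rV -> R) x y : quot_dens s G f (x, y) = quot_dens s G f (y, x).
Proof.
have e : enorm (x - y) = enorm (y - x) := distanceC x y.
have e' : `|diff_quot s f (x, y)| = `|diff_quot s f (y, x)|.
  by rewrite /diff_quot /D_s/= e !normrM distrC.
exact: (congr2 (fun a b => G a / b ^+ n) e' (distanceC x y)).
Qed.

Lemma powR_expn (a t : R) j : 0 <= a -> (a `^ t) ^+ j = (a ^+ j) `^ t.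
Proof. move=> a0; rewrite -[LHS]powR_mulrn ?powR_ge0// -powRrM mulrC powRrM.
by rewrite powR_mulrn. Qed.

(** Close to the diagonal the Lipschitz bound leaves the integrable power
    [d `^ (1 - s - n)] of the distance [d], far from it boundedness leaves
    [d `^ (- s - n)]; both are summed over dyadic shells. *)
Lemma bump_quot_dens_le c r : 0 <= r <= 1 ->
  exists2 C : R, 0 <= C & forall x,
  (\int[L]_y (quot_dens s G (bump c r) (x, y))%:E <= C%:E)%E.
Proof.
move=> /andP[r0 r1].
have G1 : 0 <= G 1 by apply: (young_ge0 HG).
have Gn : 0 <= G n%:R by apply: (young_ge0 HG).
pose q1 : R := 2^-1 `^ (1 - s).
pose q2 : R := 2^-1 `^ s.
have h2 : 0 < (2^-1 : R) by rewrite invr_gt0.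
have h21 : (2^-1 : R) < 1 by rewrite invf_lt1// ltr1n.
have pw (t : R) : 0 < t -> 0 <= (2^-1 : R) `^ t < 1.
  move=> t0; rewrite powR_ge0/=.
  have p1 : 1 `^ t = 1 by rewrite powR1.
  by rewrite -[ltRHS]p1 gt0_ltr_powR ?nnegrE ?ltW.
have q101 : 0 <= q1 < 1 by apply: pw; rewrite subr_gt0.
have q201 : 0 <= q2 < 1 by exact: pw.
pose rho1 (j : nat) : R := 2^-1 ^+ j.
pose rho2 (j : nat) : R := 2 ^+ j.+1.
have rho10 j : 0 < rho1 j by rewrite exprn_gt0.
have rho20 j : 0 < rho2 j by rewrite exprn_gt0.
have [C1 C10 HC1] := shells_integral Gn q101 rho10.
have [C2 C20 HC2] := shells_integral G1 q201 rho20.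
exists (C1 + C2); first exact: addr_ge0.
move=> x.
have mb := measurable_bump c r.
have mF : measurable_fun setT (fun z => (quot_dens s G (bump c r) z)%:E).
  by apply/measurable_EFinP; exact: (measurable_quot_dens s HG).
apply: (@le_trans _ _ (\int[L]_y (shells (G n%:R) q1 rho1 x y + shells (G 1) q2 rho2 x y))%E); last first.
  rewrite ge0_integralD//.
  - by rewrite EFinD leeD.
  - by move=> y _; exact: shells_ge0.
  - exact: measurable_shells.
  - by move=> y _; exact: shells_ge0.
  - exact: measurable_shells.
apply: ge0_le_integral => //.
- by move=> y _; rewrite lee_fin (quot_dens_ge0 _ HG).
- by apply: measurableT_comp mF _; exact: measurable_pair1.
- by apply: emeasurable_funD; exact: measurable_shells.
move=> y _; set d := distance (x, y).
have S1 := shells_ge0 Gn q101 rho10 x y.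
have S2 := shells_ge0 G1 q201 rho20 x y.
have d0 : 0 <= d by exact: distance_ge0.
have [d00|dn0] := eqVneq d 0.
  apply: le_trans (adde_ge0 S1 S2); rewrite lee_fin /quot_dens.
  have -> : bump c r x = bump c r y :> R -> diff_quot s (bump c r) (x, y) = 0.
    by rewrite /diff_quot /D_s/= => ->; rewrite subrr mul0r.
  by rewrite normr0 (young0 HG) mul0r.
  apply/eqP; rewrite -subr_eq0 -normr_le0.
  by have := bump_lipschitz c r x y; rewrite -/d d00 mulr0.
have dp : 0 < d by rewrite lt_def dn0.
have ds : 0 < d `^ s by rewrite powR_gt0.
have qE : diff_quot s (bump c r) (x, y) = (bump c r x - bump c r y) / d `^ s by [].
have v0 : 0 <= G `|diff_quot s (bump c r) (x, y)| by exact: (youngN_ge0 HG).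
have p1 (t : R) : 1 `^ t = 1 by rewrite powR1.
have [d1|d1] := leP d 1.
  have [j jP] : exists j, rho1 j / 2 < d <= rho1 j.
    have ex : exists j, rho1 j / 2 < d.
      have h2' : `|2^-1 : R| < 1 by rewrite ger0_norm ?ltW.
      have /cvgrPdist_lt/(_ _ dp)[j _ /(_ j (leqnn j)) /=] := cvg_expr h2'.
      rewrite sub0r normrN ger0_norm ?exprn_ge0 ?(ltW h2)// => lt.
      by exists j; rewrite (le_lt_trans _ lt)// ler_pdivrMr// ler_peMr ?(ltW (rho10 j))// ler1n.
    case: (ex_minnP ex) => -[|j] jd jmin; [exists 0%N|exists j.+1]; rewrite jd/= /rho1.
      by rewrite expr0.
    rewrite exprSr leNgt; apply/negP => /jmin; by rewrite ltnn.
  apply: le_trans (leeDl _ S2); apply: (le_shells Gn q101 rho10 jP v0).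
  have s10 : 0 <= 1 - s by rewrite subr_ge0 ltW.
  have l01 : 0 <= d `^ (1 - s) <= 1.
    by rewrite powR_ge0/= -[leRHS](p1 (1 - s)) ge0_ler_powR ?nnegrE.
  have : G `|diff_quot s (bump c r) (x, y)| <= G `|d `^ (1 - s) * n%:R|.
    apply: (young_homo HG); rewrite qE normrM normfV (ger0_norm (ltW ds)) ler_pdivrMr//.
    rewrite (ger0_norm (_ : 0 <= _ * n%:R)) ?mulr_ge0 ?powR_ge0// mulrAC.
    rewrite -powRD ?dn0 ?implybT// subrK powRr1// mulrC; exact: bump_lipschitz.
  move/le_trans; apply; rewrite (le_trans (young_scale HG _ l01))//.
  rewrite (ger0_norm (ler0n _ _)) mulrC ler_wpM2l// /q1 powR_expn ?(ltW h2)//.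
  by rewrite ge0_ler_powR ?nnegrE ?exprn_ge0 ?(ltW h2)//; case/andP: jP.
have [j jP] : exists j, rho2 j / 2 < d <= rho2 j.
  have ex : exists j, d <= rho2 j.
    exists (Num.bound d); apply/ltW; apply: lt_le_trans (archi_boundP d0) _.
    by rewrite /rho2 -natrX ler_nat ltnW// ltnW// ltn_expl.
  case: (ex_minnP ex) => -[|j] jd jmin; [exists 0%N|exists j.+1]; rewrite jd andbT.
    by rewrite /rho2 expr1 divff.
  by rewrite /rho2 exprSr mulfK// ltNge; apply/negP => /jmin; rewrite ltnn.
apply: le_trans (leeDr _ S1); apply: (le_shells G1 q201 rho20 jP v0).
have l01 : 0 <= q2 ^+ j <= 1.
  by case/andP: q201 => ? ?; rewrite exprn_ge0//= exprn_ile1// ltW.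
have : G `|diff_quot s (bump c r) (x, y)| <= G `|q2 ^+ j * 1|.
  apply: (young_homo HG); rewrite qE normrM normfV (ger0_norm (ltW ds)) ler_pdivrMr//.
  rewrite mulr1 (ger0_norm (_ : 0 <= q2 ^+ j)); last by case/andP: l01.
  have b1 : `|bump c r x - bump c r y| <= 1.
    have := bump_ge0 c r x; have := bump_ge0 c r y.
    have := bump_le c x r0; have := bump_le c y r0.
    by move=> *; rewrite ler_norml; apply/andP; split; lra.
  rewrite (le_trans b1)// /q2 powR_expn ?(ltW h2)// -powRM ?exprn_ge0 ?(ltW h2)//.
  rewrite -[leLHS](p1 s) ge0_ler_powR ?nnegrE ?(ltW s_gt0)// ?mulr_ge0 ?exprn_ge0 ?(ltW h2)//.
  rewrite exprVn mulrC ler_pdivlMr ?exprn_gt0// mul1r.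
  by move: jP; rewrite /rho2 exprSr mulfK// => /andP[/ltW].
move/le_trans; apply; rewrite (le_trans (young_scale HG _ l01))//.
by rewrite normr1 mulrC.
Qed.

(** The bump has finite energy: the density vanishes unless one of the two
    points lies in its support. *)
Lemma bump_energy c r : 0 < r <= 1 ->
  (\int[L \x L]_z (quot_dens s G (bump c r) z)%:E < +oo)%E.
Proof.
move=> /andP[r0 r1]; have mb := measurable_bump c r.
pose F z := (quot_dens s G (bump c r) z)%:E.
have mF : measurable_fun setT F.
  by apply/measurable_EFinP; exact: (measurable_quot_dens s HG).
have F0 z : (0 <= F z)%E by rewrite lee_fin (quot_dens_ge0 _ HG).
have [|C C0 HC] := @bump_quot_dens_le c r; first by rewrite ltW.
set B := box (fun i => c ord0 i - r) (fun i => c ord0 i + r).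
have mB : measurable B by exact: measurable_box.
have LB : (L B < +oo)%E.
  by rewrite lebesgue_box ?ltry// => i; lra.
have m1 : measurable (B `*` [set: rV]) by exact: measurableX.
have m2 : measurable ([set: rV] `*` B) by exact: measurableX.
have i1 : (\int[L \x L]_(z in B `*` setT) F z < +oo)%E.
  rewrite ge0_integral_setX//.
  apply: (@le_lt_trans _ _ (\int[L]_(x in B) C%:E)%E).
    apply: ge0_le_integral => //.
    - by move=> x _; exact: integral_ge0.
    - by apply: measurable_funTS; exact: measurable_integral_section.
    - by move=> x _; exact: HC.
  have -> : (\int[L]_(x in B) C%:E = C%:E * L B)%E by exact: integral_cst.
  by rewrite lte_mul_pinfty.
have E : (\int[L \x L]_z F z <= \int[L \x L]_z ((F \_ (B `*` setT)) z + (F \_ (setT `*` B)) z))%E.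
  have mr1 : measurable_fun setT (F \_ (B `*` setT)).
    by apply/(measurable_restrictT _ m1); exact: measurable_funTS.
  have mr2 : measurable_fun setT (F \_ (setT `*` B)).
    by apply/(measurable_restrictT _ m2); exact: measurable_funTS.
  apply: ge0_le_integral => //; first exact: emeasurable_funD.
  move=> [x y] _; rewrite !patchE !in_setX !in_setT/= andbT.
  case: ifPn => xB; first by rewrite leeDl//; case: ifP.
  case: ifPn => yB; first by rewrite add0e.
  rewrite /F /quot_dens /diff_quot /D_s/=.
  have bx : bump c r x = 0.
    by apply/eqP; apply: contraNT xB => /bump_support; rewrite inE.
  have by0 : bump c r y = 0.
    by apply/eqP; apply: contraNT yB => /bump_support; rewrite inE.
  by rewrite bx by0 subrr mul0r normr0 (young0 HG) mul0r adde0.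
apply: (le_lt_trans E); rewrite ge0_integralD//; last 4 first.
- by move=> z _; apply: erestrict_ge0.
- by apply/(measurable_restrictT _ m1); exact: measurable_funTS.
- by move=> z _; apply: erestrict_ge0.
- by apply/(measurable_restrictT _ m2); exact: measurable_funTS.
rewrite -!integral_mkcond lte_add_pinfty//.
suff -> : (\int[L \x L]_(z in setT `*` B) F z = \int[L \x L]_(z in B `*` setT) F z)%E by [].
transitivity (\int[L]_(y in B) \int[L]_x F (x, y))%E; last first.
  apply: etrans (esym (ge0_integral_setX mB measurableT mF F0)).
  apply: eq_integral => x _; apply: eq_integral => y _.
  by rewrite /F (quot_densC _ y x).
rewrite [LHS]integral_mkcond fubini_tonelli2; last 2 first.
- by apply/(measurable_restrictT _ m2); exact: measurable_funTS.
- by move=> z; apply: erestrict_ge0.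
rewrite [RHS]integral_mkcond; apply: eq_integral => y _; rewrite /fubini_G patchE.
case: ifPn => yB.
  by apply: eq_integral => x _; rewrite !patchE in_setX in_setT yB.
by rewrite integral0_eq// => x _; rewrite patchE in_setX in_setT (negbTE yB).
Qed.

Lemma bump_mass_gt0 (c : rV) r (Om : set rV) : measurable Om -> 0 < r ->
  box (fun i => c ord0 i - r) (fun i => c ord0 i + r) `<=` Om ->
  (0 < \int[L]_(x in Om) (G `|bump c r x|)%:E)%E.
Proof.
move=> mOm r0 BOm; have n0 : 0 < n%:R :> R by rewrite ltr0n.
pose h := r / 2 / n%:R; have h0 : 0 < h by rewrite !divr_gt0.
have hr : h <= r.
  rewrite /h -mulrA ler_piMr ?(ltW r0)// -invfM invf_le1; last by rewrite mulr_gt0.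
  by rewrite -natrM ler1n muln_gt0.
pose B := box (fun i => c ord0 i - h) (fun i => c ord0 i + h).
have mB : measurable B by exact: measurable_box.
have LB : (0 < L B)%E.
  rewrite lebesgue_box => [|i]; last by lra.
  rewrite lte_fin prodr_gt0// => i _; lra.
have mbG : measurable_fun setT (fun x => (G `|bump c r x|)%:E).
  apply/measurable_EFinP; apply: (measurableT_comp (measurable_young HG)).
  exact: measurable_bump.
have G0 x : (0 <= (G `|bump c r x|)%:E)%E by rewrite lee_fin (youngN_ge0 HG).
have Gr : 0 < G (r / 2) by case: HG => _ _ + _; apply; rewrite divr_gt0.
apply: (@lt_le_trans _ _ (\int[L]_(x in B) (G (r / 2))%:E)%E).
  have -> : (\int[L]_(x in B) (G (r / 2))%:E = (G (r / 2))%:E * L B)%E by exact: integral_cst.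
  by rewrite mule_gt0.
have BO : B `<=` Om.
  by move=> x Bx; apply: BOm => i; have /andP[? ?] := Bx i; apply/andP; split; lra.
apply: (@le_trans _ _ (\int[L]_(x in B) (G `|bump c r x|)%:E)%E); last first.
  by apply: ge0_subset_integral => //; exact: measurable_funTS.
apply: ge0_le_integral => //.
- by move=> x _; rewrite lee_fin ltW.
- exact: measurable_funTS.
move=> x Bx; rewrite lee_fin -[r / 2 in leLHS]ger0_norm ?divr_ge0 ?(ltW r0)//.
apply: (young_homo HG); rewrite ger0_norm ?divr_ge0 ?(ltW r0)// ger0_norm ?bump_ge0//.
rewrite /bump le_max; apply/orP; right; rewrite lerBrDr -lerBrDl.
apply: (@le_trans _ _ (\sum_(i < n) h)).
  by apply: ler_sum => i _; have /andP[? ?] := Bx i; rewrite ler_norml; apply/andP; split; lra.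
rewrite sumr_const card_ord -[leLHS]mulr_natl /h mulrC divfK ?gt_eqF//; lra.
Qed.

Lemma bump_mass_lty (c : rV) r : 0 < r ->
  (\int[L]_x (G `|bump c r x|)%:E < +oo)%E.
Proof.
move=> r0.
set B := box (fun i => c ord0 i - r) (fun i => c ord0 i + r).
have mB : measurable B by exact: measurable_box.
have LB : (L B < +oo)%E by rewrite lebesgue_box ?ltry// => i; lra.
have mbG : measurable_fun setT (fun x => (G `|bump c r x|)%:E).
  apply/measurable_EFinP; apply: (measurableT_comp (measurable_young HG)).
  exact: measurable_bump.
apply: (@le_lt_trans _ _ (\int[L]_(x in B) (G r)%:E)%E); last first.
  have -> : (\int[L]_(x in B) (G r)%:E = (G r)%:E * L B)%E by exact: integral_cst.
  by rewrite lte_mul_pinfty// lee_fin (young_ge0 HG)// ltW.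
rewrite [leRHS]integral_mkcond; apply: ge0_le_integral => //.
- by move=> x _; rewrite lee_fin (youngN_ge0 HG).
- by apply/(measurable_restrictT _ mB).
move=> x _; rewrite patchE; case: ifPn => xB.
  rewrite lee_fin -[r in leRHS]ger0_norm ?(ltW r0)//.
  apply: (young_homo HG); rewrite (ger0_norm (ltW r0)) ger0_norm ?bump_ge0//.
  by apply: bump_le; exact: ltW.
have -> : bump c r x = 0.
  by apply/eqP; apply: contraNT xB => /bump_support; rewrite inE.
by rewrite normr0 (young0 HG).
Qed.

End bump.

(** * The four eigenvalue problems *)

Section weights.
Context d (T : measurableType d) (R : realType) (nu : {measure set T -> \bar R}).

Lemma integral_weight_mkcond (D : set T) (w F : T -> R) :
  (\int[nu]_(x in D) (w x * F x)%:E =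
   \int[nu]_x ((if x \in D then w x else 0)%R * F x)%:E)%E.
Proof.
rewrite integral_mkcond; apply: eq_integral => x _; rewrite patchE.
by case: ifP => // _; rewrite mul0r.
Qed.

Lemma integral_indic_mkcond (D : set T) (F : T -> R) :
  (\int[nu]_(x in D) (F x)%:E = \int[nu]_x (\1_D x * F x)%:E)%E.
Proof.
rewrite integral_mkcond; apply: eq_integral => x _; rewrite patchE indicE.
by case: ifP => // _; rewrite ?mul1r ?mul0r.
Qed.

Lemma measurable_weight (D : set T) (w : T -> R) : measurable D ->
  measurable_fun D w -> measurable_fun setT (fun x => if x \in D then w x else 0).
Proof. by move=> mD mw; have /(measurable_restrictT _ mD) := mw. Qed.

Variables (g G : R -> R) (pp : R) (w : T -> R) (c : R).
Hypothesis HG : admissible g G pp.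
Hypothesis c_gt0 : 0 < c.

Lemma finite_wmod_scale f : finite_wmod nu G w f <-> finite_wmod nu G (fun x => c * w x) f.
Proof.
split => -[mf fi]; split => //.
  have := integrableZl measurableT c fi; apply: eq_integrable => // x _.
  by rewrite /= /wdens -mulrA.
have := integrableZl measurableT c^-1 fi; apply: eq_integrable => // x _.
by rewrite /= -EFinM /wdens -!mulrA mulKf// gt_eqF.
Qed.

Hypothesis mw : measurable_fun [set: T] w.
Hypothesis w_ge0 : forall x, 0 <= w x.

Lemma wform_scale f h : finite_wmod nu G w f -> finite_wmod nu G w h ->
  wform nu g (fun x => c * w x) f h = c * wform nu g w f h.
Proof.
move=> ff fh; rewrite /wform -RintegralZl//; last exact: (integrable_wform HG).
by apply: eq_Rintegral => x _; rewrite -mulrA.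
Qed.

End weights.

Section eigen.
Variables (R : realType) (n : nat) (s : R) (g G : R -> R) (pp : R).
Variable Omega : set 'rV[R]_n.
Hypothesis HG : admissible g G pp.
Hypothesis n_gt0 : (0 < n)%N.
Hypothesis s_gt0 : 0 < s.
Hypothesis s_lt1 : s < 1.
Hypothesis Omega_neq0 : Omega !=set0.
Hypothesis Omega_open : open Omega.
Hypothesis Omega_bounded : bounded_set Omega.
Local Notation rV := ('rV[R]_n).
Local Notation L := (@lebesgue_rV R n).
Implicit Types (u v : rV -> R).

Let mOmega : measurable Omega.
Proof. exact: open_measurable_rV. Qed.

Lemma open_contains_box : exists (c : rV) (r : R), 0 < r <= 1 /\
  box (fun i => c ord0 i - r) (fun i => c ord0 i + r) `<=` Omega.
Proof.
have [c Oc] := Omega_neq0.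
have /nbhs_ballP[e /= e0 be] : nbhs c Omega by exact: open_nbhs_nbhs.
pose r := Num.min 1 (e / 2).
have re : r <= e / 2 by rewrite ge_min lexx orbT.
exists c, r; split; first by rewrite lt_min ltr01 divr_gt0//= ge_min lexx.
move=> x Bx; apply: be; rewrite /ball/=; split => // i j; rewrite (ord1 i).
have /andP[xl xh] := Bx j.
by rewrite /ball/= ltr_norml; apply/andP; split; lra.
Qed.

Lemma measure_Omega : (0 < L Omega < +oo)%E.
Proof.
apply/andP; split.
  have [c [r [/andP[r0 _] BO]]] := open_contains_box.
  apply: (@lt_le_trans _ _ (L (box (fun i => c ord0 i - r) (fun i => c ord0 i + r)))).
    by rewrite lebesgue_box => [|i]; [rewrite lte_fin prodr_gt0// => i _|]; lra.
  by apply: le_measure; rewrite ?inE//; exact: measurable_box.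
have [a a0 aO] := bounded_coord Omega_bounded.
apply: (@le_lt_trans _ _ (L (box (fun=> - a) (fun=> a)))); last first.
  by rewrite lebesgue_box ?ltry// => i; lra.
apply: le_measure; rewrite ?inE//; first exact: measurable_box.
by move=> x Ox i; have := aO x Ox i; rewrite ltr_norml => /andP[/ltW xl xh]; apply/andP.
Qed.

Section core.
Variables (Q : set (rV * rV)) (wb : rV -> R) (Z : set rV).
Hypothesis mQ : measurable Q.
Hypothesis offQ : off_exterior Omega `<=` Q.
Hypothesis mwb : measurable_fun [set: rV] wb.
Hypothesis wb_ge0 : forall x, 0 <= wb x.
Hypothesis wb_Omega : forall x, Omega x -> wb x = 0.
Hypothesis Z_Omega : Z `<=` ~` Omega.
Hypothesis cover : {ae L, forall x, ~ Omega x -> Z x \/ 0 < wb x}.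

Let wk (z : rV * rV) : R := if z \in Q then (distance z ^+ n)^-1 else 0.
Let wm : rV -> R := \1_Omega.

Let mwk : measurable_fun setT wk.
Proof.
by apply: measurable_weight => //; apply: measurable_funTS; exact: measurable_distance_powV.
Qed.

Let wk_ge0 z : 0 <= wk z.
Proof. by rewrite /wk; case: ifP => // _; rewrite invr_ge0 exprn_ge0// distance_ge0. Qed.

Let mwm : measurable_fun setT wm.
Proof. exact: measurable_indic. Qed.

Let wm_ge0 x : 0 <= wm x.
Proof. by rewrite /wm indicE. Qed.

(** The Dirichlet and the Robin spaces are the instances [Q = setT], [wb = 0],
    [Z = ~` Omega] and [Q = off_exterior Omega], [wb = 2 beta], [Z = set0]. *)
Definition core_space u : Prop :=
  [/\ measurable_fun [set: rV] u, (modular G Omega u < +oo)%E,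
      finite_wmod L G wb u, (modular_s s G Q u < +oo)%E &
      {ae L, forall x, Z x -> u x = 0}].

Let modularE u : modular G Omega u = (\int[L]_x (wdens G wm u x)%:E)%E.
Proof. exact: integral_indic_mkcond. Qed.

Let modular_sE u : modular_s s G Q u =
  (\int[(L \x L)%E]_z (wdens G wk (diff_quot s u) z)%:E)%E.
Proof.
rewrite /modular_s /int_dmu -[RHS]integral_weight_mkcond.
by apply: eq_integral => z _; rewrite mulrC.
Qed.

Let K := energy_space L (L \x L)%E G wm wb wk Z (@diff_quot R n s).

Let core_spaceP u : core_space u <-> K u.
Proof.
split=> [[mu u1 u2 u3 u4]|[u1 u2 u3 u4]].
  split => //; first by apply/(finite_wmodP _ HG mwm wm_ge0) => //; rewrite -modularE.
  apply/(finite_wmodP _ HG mwk wk_ge0); first exact: measurable_diff_quot.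
  by rewrite -modular_sE.
have mu : measurable_fun setT u by case: u1.
split => //; first by rewrite modularE; apply/(finite_wmodP _ HG mwm wm_ge0).
rewrite modular_sE; apply/(finite_wmodP _ HG mwk wk_ge0) => //.
exact: measurable_diff_quot.
Qed.

Let core_compactness (u : nat -> rV -> R) (C : R) :
  (forall k, K (u k)) -> (forall k, energy L (L \x L)%E G wb wk (@diff_quot R n s) (u k) <= C) ->
  (forall k, wmod L G wm (u k) <= C) -> admits_cauchy L G wm u.
Proof.
move=> Ku Eu Mu F UF _ e e0.
have mu k : measurable_fun setT (u k) by case: (Ku k) => -[].
have uM k : (\int[L]_(x in Omega) (G `|u k x|)%:E <= C%:E)%E.
  have [u1 _ _ _] := Ku k.
  by rewrite -/(modular G Omega (u k)) modularE (wmodE u1) lee_fin.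
have uE k : (\int[L \x L]_(z in off_exterior Omega) (quot_dens s G (u k) z)%:E <= C%:E)%E.
  have [_ _ u3 _] := Ku k.
  apply: (@le_trans _ _ (modular_s s G Q (u k))).
    apply: ge0_subset_integral => //.
    - exact: measurable_off_exterior.
    - apply: measurable_funTS; apply/measurable_EFinP.
      exact: (measurable_quot_dens s HG).
    - by move=> z _; rewrite lee_fin; exact: (quot_dens_ge0 s HG).
  rewrite modular_sE (wmodE u3) lee_fin; apply: le_trans (Eu k).
  by rewrite /energy lerDl (wmod_ge0 _ HG).
have [A FA HA] := mass_compactness HG n_gt0 s_gt0 Omega_open Omega_bounded UF mu uM uE e0.
exists A => // k l Ak Al; have := HA k l Ak Al.
have [u1 _ _ _] := energy_spaceB HG mwm mwb mwk wm_ge0 wb_ge0 wk_ge0 (@diff_quot_affine R n s) (Ku k) (Ku l).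
by rewrite -/(modular G Omega (fun x => u k x - u l x)) modularE (wmodE u1) lee_fin.
Qed.

Lemma exists_core_eigenfunction (mu : R) : 0 < mu ->
  exists u, exists Lam : R, [/\ core_space u, forall x, 0 <= u x,
    modular G Omega u = mu%:E, 0 <= Lam &
    forall v, core_space v -> exists a m : R,
      [/\ form_s s g Q u v = a%:E, form_mass Omega g u v = m%:E &
          a + wform L g wb u v = Lam * m]].
Proof.
move=> mu0.
have cov : {ae L, forall x, [\/ Z x, 0 < wm x | 0 < wb x]}.
  apply: filterS cover => x cx; have [Ox|nOx] := pselect (Omega x).
    by apply: Or32; rewrite /wm indicE mem_set.
  by have [?|?] := cx nOx; [apply: Or31|apply: Or33].
have [c [r [r01 BO]]] := open_contains_box.
have /andP[r0 _] := r01.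
have mb := measurable_bump c r.
have b0 x : ~ Omega x -> bump c r x = 0.
  move=> nOx; apply/eqP; apply/negPn/negP => /bump_support Bx; exact/nOx/BO.
have Kb : core_space (bump c r).
  split => //.
  - apply: le_lt_trans (bump_mass_lty HG c r0).
    apply: ge0_subset_integral => //.
      by apply/measurable_EFinP; exact: (measurableT_comp (measurable_young HG)).
    by move=> x _; rewrite lee_fin (youngN_ge0 HG).
  - apply/(finite_wmodP _ HG mwb wb_ge0) => //.
    rewrite integral0_eq// => x _; rewrite /wdens.
    have [Ox|nOx] := pselect (Omega x); first by rewrite wb_Omega// mul0r.
    by rewrite b0// normr0 (young0 HG) mulr0.
  - have be := bump_energy HG s_gt0 s_lt1 c r01.
    apply: le_lt_trans be; apply: ge0_subset_integral => //.
      by apply/measurable_EFinP; exact: (measurable_quot_dens s HG).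
    by move=> z _; rewrite lee_fin; exact: (quot_dens_ge0 s HG).
  - by apply: aeW => x /Z_Omega; exact: b0.
have Mb : 0 < wmod L G wm (bump c r).
  have /core_spaceP[f1 _ _ _] := Kb.
  rewrite -lte_fin -(wmodE f1) -modularE; exact: (bump_mass_gt0 HG n_gt0).
have /core_spaceP Kb' := Kb.
have [u [Lam [Ku u0 Mu Lam0 EL]]] := exists_eigenfunction HG mwm mwb mwk wm_ge0 wb_ge0 wk_ge0 cov
  (@diff_quot_affine R n s) (@measurable_diff_quot R n s) (@diff_quot_norm R n s)
  (@diff_quot_cvg R n s) core_compactness mu0 Kb' Mb.
have [u1 u2 u3 _] := Ku.
exists u, Lam; split => //; first exact/core_spaceP.
  by rewrite modularE (wmodE u1) Mu.
move=> v /core_spaceP Kv; have [v1 v2 v3 _] := Kv.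
exists (wform (L \x L)%E g wk (diff_quot s u) (diff_quot s v)), (wform L g wm u v).
split; last exact: EL.
- rewrite -(wformE HG mwk wk_ge0 u3 v3) -[RHS]integral_weight_mkcond.
  by apply: eq_integral => z _; rewrite mulrC.
- by rewrite -(wformE HG mwm wm_ge0 u1 v1) -[RHS]integral_indic_mkcond.
Qed.

End core.

Lemma W0_core u : W0 s Omega G u <-> core_space setT (fun=> 0) (~` Omega) u.
Proof.
have mG (f : rV -> R) : measurable_fun setT f -> measurable_fun setT (fun x => (G `|f x|)%:E).
  by move=> mf; apply/measurable_EFinP; exact: (measurableT_comp (measurable_young HG)).
split=> [[mu u1 u2 u3]|[mu u1 _ u2 u3]]; split => //.
- apply: le_lt_trans u1; apply: ge0_subset_integral => //; first exact: mG.
  by move=> x _; rewrite lee_fin (youngN_ge0 HG).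
- apply/(finite_wmodP L HG) => //; rewrite integral0_eq// => x _.
  by rewrite /wdens mul0r.
- apply: le_lt_trans u1; rewrite le_eqVlt; apply/orP; left; apply/eqP.
  rewrite [RHS]integral_indic_mkcond; apply: ae_eq_integral => //.
  + exact: mG.
  + apply/measurable_EFinP; apply: measurable_funM; first exact: measurable_indic.
    exact: (measurableT_comp (measurable_young HG)).
  + apply: filterS u3 => x ux _; rewrite indicE.
    have [Ox|nOx] := pselect (Omega x); first by rewrite mem_set// mul1r.
    by rewrite memNset// mul0r ux// normr0 (young0 HG).
Qed.

Lemma dirichlet_exists (mu : R) : 0 < mu -> exists (l : R) u,
  [/\ 0 < l, dirichlet_eigen s Omega g G l u, forall x, 0 <= u x &
      modular G Omega u = mu%:E].
Proof.
move=> mu0.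
have cov : {ae L, forall x, ~ Omega x -> (~` Omega) x \/ 0 < (0 : R)}.
  by apply: aeW => x nOx; left.
have [u [Lam [Ku u0 Mu Lam0 EL]]] :=
  @exists_core_eigenfunction setT (fun=> 0) (~` Omega) measurableT (fun _ _ => I)
    (measurable_cst _) (fun=> lexx _) (fun _ _ => erefl) (fun _ h => h) cov mu mu0.
exists (1 + Lam), u; split => //; first by rewrite ltr_pwDl.
split; first exact/W0_core.
move=> v /W0_core /EL[a [m [-> -> E]]].
have aE : a = Lam * m.
  rewrite -E /wform (_ : (\int[L]_x _)%R = 0) ?addr0//.
  by rewrite /Rintegral integral0_eq// => x _; rewrite mul0r.
by rewrite aE addrAC subrr add0r EFinM.
Qed.

Lemma constant_normalized (mu : R) : 0 < mu ->
  exists2 c : R, 0 <= c & modular G Omega (fun=> c) = mu%:E.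
Proof.
move=> mu0; have /andP[LO_gt0 LO_lty] := measure_Omega.
have VE : ((fine (L Omega))%:E = L Omega)%E by rewrite fineK// ge0_fin_numE.
have V0 : 0 < fine (L Omega) by rewrite -lte_fin VE.
have [|c c0 Gc] := young_surjective HG (_ : 0 < mu / fine (L Omega)).
  by rewrite divr_gt0.
exists c => //; rewrite /modular.
have -> : (\int[L]_(x in Omega) (G `|c|)%:E = (G `|c|)%:E * L Omega)%E.
  exact: integral_cst.
by rewrite (ger0_norm c0) Gc -VE -EFinM divfK// gt_eqF.
Qed.

Lemma modular_s_cst (Q : set (rV * rV)) (c : R) : modular_s s G Q (fun=> c) = 0%E.
Proof.
rewrite /modular_s /int_dmu integral0_eq// => z _.
by rewrite /D_s subrr mul0r normr0 (young0 HG) mul0r.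
Qed.

Lemma form_s_cst (Q : set (rV * rV)) (c : R) v : form_s s g Q (fun=> c) v = 0%E.
Proof.
rewrite /form_s /int_dmu integral0_eq// => z _.
by rewrite /D_s subrr mul0r /g_signed !(mul0r, mulr0).
Qed.

(** A constant has no difference quotient, so it solves both Neumann problems with
    [lambda = 1], where the right-hand side vanishes as well. *)
Lemma neumann_exists (mu : R) : 0 < mu -> exists2 c : R, 0 <= c &
  [/\ neumann_eigen s Omega g G 1 (fun=> c),
      regional_neumann_eigen s Omega g G 1 (fun=> c) &
      modular G Omega (fun=> c) = mu%:E].
Proof.
move=> mu0; have [c c0 Mc] := constant_normalized mu0.
exists c => //; split => //; split.
- by split; rewrite ?Mc ?modular_s_cst ?ltry.
- by move=> v _; rewrite /form_star form_s_cst subrr mule0 mul0e.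
- by split; rewrite ?Mc ?modular_s_cst ?ltry.
- by move=> v _; rewrite form_s_cst subrr mul0e.
Qed.

Section robin.
Variable beta : rV -> R.
Hypothesis mbeta : measurable_fun (~` Omega) beta.
Hypothesis beta_gt0 : {ae L, forall x, ~ Omega x -> 0 < beta x}.

Let wbeta x : R := if x \in ~` Omega then Num.max (beta x) 0 else 0.

Let two_gt0 : 0 < (2 : R).
Proof. by []. Qed.

Let mOmegaC : measurable (~` Omega).
Proof. exact: measurableC. Qed.

Let mwbeta : measurable_fun setT wbeta.
Proof.
apply: measurable_weight => //; apply: measurable_maxr => //.
Qed.

Let wbeta_ge0 x : 0 <= wbeta x.
Proof. by rewrite /wbeta; case: ifP => // _; rewrite le_max lexx orbT. Qed.

Let integral_wbeta (F : rV -> R) : measurable_fun setT F ->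
  (\int[L]_(x in ~` Omega) (beta x * F x)%:E = \int[L]_x (wbeta x * F x)%:E)%E.
Proof.
move=> mF; rewrite -integral_weight_mkcond; apply: ae_eq_integral => //.
- apply/measurable_EFinP; apply: measurable_funM => //; exact: measurable_funTS.
- apply/measurable_EFinP; apply: measurable_funM; last exact: measurable_funTS.
  exact: measurable_maxr.
- apply: filterS beta_gt0 => x bx nOx; congr (_ * _)%:E.
  by rewrite max_l// ltW// bx.
Qed.

Lemma Xspace_core u : Xspace s Omega beta G u <->
  core_space (off_exterior Omega) (fun x => 2 * wbeta x) set0 u.
Proof.
split=> [[[mu u1 u2] u3]|[mu u1 u2 u3 _]].
  split => //; last by apply: aeW => x [].
  apply/(finite_wmod_scale L G wbeta two_gt0); apply/(finite_wmodP L HG mwbeta wbeta_ge0) => //.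
  rewrite /wdens -integral_wbeta//.
  exact: (measurableT_comp (measurable_young HG)).
split => //; rewrite /modular_beta integral_wbeta; last first.
  exact: (measurableT_comp (measurable_young HG)).
apply/(finite_wmodP L HG mwbeta wbeta_ge0) => //.
by apply/(finite_wmod_scale _ G wbeta two_gt0).
Qed.

(** Minimising the star modular plus twice the boundary modular and dividing the
    Euler-Lagrange equation by two accounts for the factor one half in
    [form_star]. *)
Lemma robin_exists (mu : R) : 0 < mu -> exists (l : R) u,
  [/\ 0 < l, robin_eigen s Omega beta g G l u, forall x, 0 <= u x &
      modular G Omega u = mu%:E].
Proof.
move=> mu0.
have m2 : measurable_fun setT (fun x => 2 * wbeta x) by exact: measurable_funM.
have mO := measurable_off_exterior Omega_open.
have w0 x : 0 <= 2 * wbeta x by rewrite mulr_ge0.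
have wO x : Omega x -> 2 * wbeta x = 0.
  by move=> Ox; rewrite /wbeta memNset ?mulr0//; exact.
have cov : {ae L, forall x, ~ Omega x -> set0 x \/ 0 < 2 * wbeta x}.
  apply: filterS beta_gt0 => x bx nOx; right.
  by rewrite mulr_gt0// /wbeta mem_set// lt_max bx.
have [u [Lam [Ku u0 Mu Lam0 EL]]] :=
  @exists_core_eigenfunction (off_exterior Omega) (fun x => 2 * wbeta x) set0
    mO (@subset_refl _ _) m2 w0 wO (@sub0set _ _) cov mu mu0.
exists (1 + Lam / 2), u; split => //; first by rewrite ltr_pwDl// divr_ge0.
split; first exact/Xspace_core.
move=> v /Xspace_core Kv; have [a [m [aE mE E]]] := EL v Kv.
have [mu' _ ub _ _] := Ku; have [mv _ vb _ _] := Kv.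
have ub' := proj2 (finite_wmod_scale L G wbeta two_gt0 u) ub.
have vb' := proj2 (finite_wmod_scale L G wbeta two_gt0 v) vb.
have fb : form_beta Omega beta g u v = (wform L g wbeta u v)%:E.
  rewrite -(wformE HG mwbeta wbeta_ge0 ub' vb') -integral_wbeta.
    by apply: eq_integral => x _; rewrite mulrA.
  apply: measurable_funM => //.
  exact: (measurableT_comp (measurable_g_signed HG)).
rewrite (wform_scale 2 HG mwbeta wbeta_ge0 ub' vb') in E.
rewrite /form_star aE fb mE -!EFinM -EFinB; congr _%:E; lra.
Qed.

End robin.

End eigen.

Theorem theorem5p5 (R : realType) (n : nat) (s : R) (Omega : set 'rV[R]_n)
    (beta : 'rV[R]_n -> R) (g G : R -> R) (pminus pplus : R)
    (n_gt0 : (0 < n)%N)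
    (s_gt0 : 0 < s) (s_lt1 : s < 1)
    (Omega_neq0 : Omega !=set0)
    (Omega_open : open Omega)
    (Omega_bounded : bounded_set Omega)
    (Omega_lipschitz : lipschitz_boundary Omega)
    (beta_measurable : measurable_fun (~` Omega) beta)
    (beta_bounded : exists M : R,
       {ae lebesgue_rV n, forall x, ~ Omega x -> `|beta x| <= M})
    (beta_gt0 : {ae lebesgue_rV n, forall x, ~ Omega x -> 0 < beta x})
    (G_young : young_function g G)
    (pminus_gt1 : 1 < pminus)
    (G_growth : forall t, 0 < t -> pminus <= t * g t / G t <= pplus)
    (G_sqrt_convex :
       @convex_function R R^o `[0, +oo[%classic (fun t => G (Num.sqrt t)))
    (G_inv_0 : (\int[lebesgue_measure]_(t in `]0%R, 1%R[)
       (young_inv G t / t `^ ((n%:R + s) / n%:R))%:E < +oo)%E)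
    (G_inv_oo : (\int[lebesgue_measure]_(t in `]1%R, +oo[)
       (young_inv G t / t `^ ((n%:R + s) / n%:R))%:E = +oo)%E) :
  forall mu : R, 0 < mu ->
  exists lD lN lT lR : R,
  exists uD uN uT uR : 'rV[R]_n -> R,
    [/\ [/\ 0 < lD, 0 < lN, 0 < lT & 0 < lR],
        [/\ dirichlet_eigen s Omega g G lD uD,
            neumann_eigen s Omega g G lN uN,
            regional_neumann_eigen s Omega g G lT uT &
            robin_eigen s Omega beta g G lR uR],
        [/\ forall x, 0 <= uD x,
            forall x, 0 <= uN x,
            forall x, Omega x -> 0 <= uT x &
            forall x, 0 <= uR x] &
        [/\ modular G Omega uD = mu%:E,
            modular G Omega uN = mu%:E,
            modular G Omega uT = mu%:E &
            modular G Omega uR = mu%:E]].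
Proof.
move=> mu mu0.
have gpos t : 0 < t -> 0 < g t by case: G_young => -[_ _ _ + _] _ _; apply.
have Gpos t : 0 < t -> 0 < G t.
  move=> t0; have /andP[+ _] := G_growth t t0.
  rewrite ltNge; apply: contraTN => Gt0; rewrite -ltNge.
  apply: le_lt_trans (_ : 0 < _); last by rewrite (lt_trans ltr01).
  by rewrite mulr_ge0_le0 ?invr_le0// mulr_ge0 ?ltW// gpos.
have HG : admissible g G pplus.
  split => // t t0; have /andP[lo hi] := G_growth t t0.
  rewrite ler_pdivlMr ?Gpos// in lo; rewrite ler_pdivrMr ?Gpos// in hi.
  rewrite hi andbT (le_trans _ lo)// ler_peMl ?ltW// Gpos//.
have [lD [uD [? ? ? ?]]] := dirichlet_exists HG n_gt0 s_gt0 s_lt1 Omega_neq0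
  Omega_open Omega_bounded mu0.
have [c c0 [? ? ?]] := neumann_exists s HG Omega_neq0 Omega_open Omega_bounded mu0.
have [lR [uR [? ? ? ?]]] := robin_exists HG n_gt0 s_gt0 s_lt1 Omega_neq0
  Omega_open Omega_bounded beta_measurable beta_gt0 mu0.
by exists lD, 1, 1, lR, uD, (fun=> c), (fun=> c), uR; split.
Qed.
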